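(* Let $R\in\mathbb{N}^*$. Suppose that for every $r\in\{1,\dots,R\}$, $U^{rn}\to U^r$ in probability as $n\to+\infty$, and that $\theta^n_0\to\theta_0$ in probability as $n\to+\infty$. Under assumptions (H-R), (HUI), (HC1), (HC2), (HRG), (HS) and (HUA) of the context, there is a positive constant $C:=C(\gamma,\underline{\lambda})$ such that, for all $n,M\in\mathbb{N}^*$, $$\mathbb{E}\left[\left|\mathcal{E}^{R-R}_S(n,M)\right|\right]\le C\,\mathbb{E}\left[\left|\sum_{r=1}^R\mathbf{w}_rH(\theta^*,U^r)\right|^2\right]^{1/2}\gamma^{1/2}(M)\left(1+\phi^R_1(n)+\phi^R_2(M)\right),$$ where $\phi^R_1,\phi^R_2$ are two positive functions satisfying $\phi^R_1(n)\to0$ as $n\to+\infty$, $\phi^R_2(M)\to0$ as $M\to+\infty$, and $\phi^R_2$ is non-increasing.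
   Context: Setting. $\alpha>0$ is fixed, $H:\mathbb{R}^d\times\mathbb{R}^q\to\mathbb{R}^d$, $U$ and $U^n$ ($n\in\mathbb{N}^*$) are $\mathbb{R}^q$-valued random vectors, $h(\theta):=\mathbb{E}[H(\theta,U)]$, $h^n(\theta):=\mathbb{E}[H(\theta,U^n)]$; $\theta^*$ is the zero of $h$ and $\theta^{*,n}$ the zero of $h^n$. For each $n$, $(U^{rn})_{1\le r\le R}$ is a family of random vectors where $U^{rn}$ has the law of the approximation $U^m$ with $m=rn$; $U^1,\dots,U^R$ denote the limits (in probability) of $U^{n},U^{2n},\dots,U^{Rn}$, each $U^r$ having the law of $U$; all variables are defined on the same probability space. Weights. For $r\in\{1,\dots,R\}$, $$\mathbf{w}_r=(-1)^{R-r}\frac{r^{\alpha R}}{\prod_{j=0}^{r-1}(r^{\alpha}-j^{\alpha})\prod_{j=r+1}^R(j^{\alpha}-r^{\alpha})}I_d,$$ with the convention that an empty product equals $1$; $I_d$ is the $d\times d$ identity matrix. Schemes. For $r\in\{1,\dots,R\}$, $\theta^{rn}_{p+1}=\theta^{rn}_p-\gamma_{p+1}H(\theta^{rn}_p,(U^{rn})^{p+1})$, $p\in\{0,\dots,M-1\}$, where $((U^{rn})^p,\ r=1,\dots,R)_{1\le p\le M}$ is an i.i.d. sequence with the law of $(U^{rn},\ r=1,\dots,R)$; the initial conditions $\theta^{rn}_0$, $r=1,\dots,R$ (taken from a sequence $(\theta^n_0)_{n\ge1}$) are independent of the innovation sequence with $\sup_{n\ge1}\mathbb{E}|\theta^n_0|^2<+\infty$;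 $\gamma=(\gamma_p)_{p\ge1}$ is a deterministic decreasing sequence of non-negative steps with $\sum_p\gamma_p=+\infty$ and $\sum_p\gamma_p^2<+\infty$. Statistical error: $\mathcal{E}^{R-R}_S(n,M):=\sum_{r=1}^R\mathbf{w}_r(\theta^{*,rn}-\theta^{rn}_M)$. Assumptions. - (H-R): (1) for all $\theta\in\mathbb{R}^d$, $h(\theta)-h^n(\theta)=\sum_{j=1}^R\Lambda^0_j(\theta)n^{-\alpha j}+o(n^{-\alpha R})$; (2) $h,h^n\in\mathcal{C}^R(\mathbb{R}^d,\mathbb{R}^d)$ and for all $1\le l\le R-1$ and all $\theta$, $D^lh^n(\theta)-D^lh(\theta)=\sum_{j=1}^{R-l}\Lambda^l_j(\theta)n^{-\alpha j}+o(n^{-\alpha(R-l)})$, where the $\Lambda^l_j(\theta)$ and the remainder are multilinear maps from $(\mathbb{R}^d)^l$ to $\mathbb{R}^d$; (3) for all $l\in\{1,\dots,R\}$, $(D^lh^n)_{n\ge1}$ converges locally uniformly to $D^lh$; (4) $Dh(\theta^* )$ is invertible. - (HUI): there is $\delta>0$ such that for all $\theta\in\mathbb{R}^d$, $\sup_{n\in\mathbb{N}^*}\mathbb{E}[|H(\theta,U^n)|^{2+\delta}]<+\infty$. - (HC1): there is $C>0$ such that for all $n\in\mathbb{N}^*$ and $\theta\in\mathbb{R}^d$, $\mathbb{E}[|H(\theta,U^n)|^2]\le C(1+|\theta-\theta^{*,n}|^2)$. - (HC2): for all $\theta\in\mathbb{R}^d$, $\mathbb{P}(U\notin\mathcal{C}_\theta)=0$,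 where $\mathcal{C}_\theta:=\{x\in\mathbb{R}^q:\ H(\theta,\cdot)\text{ is continuous at }x\}$. - (HRG): there is $a\in(0,1]$ such that $\sup_{n\in\mathbb{N}^*,\,\theta\neq\theta'}\mathbb{E}|H(\theta,U^n)-H(\theta',U^n)|^2/|\theta-\theta'|^{2a}<+\infty$. - (HUA): for each $n\in\mathbb{N}^*$, $h^n$ is continuously differentiable on $\mathbb{R}^d$, with $Dh^n$ Lipschitz-continuous uniformly in $n$, and there exists $\underline{\lambda}>0$ such that $\inf_{n\in\mathbb{N}^*,\theta\in\mathbb{R}^d}\lambda_{\min}\big((Dh^n(\theta)+Dh^n(\theta)^T)/2\big)>\underline{\lambda}$, where $\lambda_{\min}(A)$ is the lowest eigenvalue of $A$. - (HS): $\gamma_p=\gamma(p)$, $p\ge1$, where $\gamma$ is a positive function on $[0,+\infty)$ decreasing to zero and satisfying one of: (i) $\gamma$ varies regularly with exponent $-\rho$, $\rho\in(1/2,1)$, i.e. $\lim_{t\to+\infty}\gamma(tx)/\gamma(t)=x^{-\rho}$ for every $x>0$; (ii) $\gamma(t)=\gamma_0/t$ for $t\ge1$, with $2\underline{\lambda}\gamma_0>1$.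
   Formalization: The formal theorem adds the hypothesis that E|sum_r w_r H(θ*,U^r)|^2 > 0; without it the right-hand side is 0 and the claim fails, e.g. for H(θ,u)=θ, deterministic θ_0 ≠ 0 and γ_p = 1.5/p. *)

(* Defs.v *)
From HB Require Import structures.
Set Warnings "-notation-overridden,-notation-incompatible-prefix".
From mathcomp Require Import all_boot all_order all_algebra.
From mathcomp Require Import finmap.
From mathcomp Require Import all_classical all_reals all_analysis.

Set Implicit Arguments.
Unset Strict Implicit.
Unset Printing Implicit Defensive.
Import Order.TTheory GRing.Theory Num.Theory.
Import numFieldNormedType.Exports.
Local Open Scope classical_set_scope.
Local Open Scope ring_scope.

(* Vectors of R^d are row vectors, so that the library's Jacobian ['J f x]
   applies; a matrix acts on them by [v *m A]. *)

(* R^d with its Borel sigma-algebra *)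
Notation bvec R d := (g_sigma_algebraType (@open 'rV[R]_d)).

(* Euclidean norm: the library norm on matrices is the sup norm *)
Definition enorm (R : realType) (d : nat) (x : 'rV[R]_d) : R :=
  Num.sqrt (\sum_(i < d) x 0 i ^+ 2).

Definition lambda_min (R : realType) (d : nat) (A : 'M[R]_d) : R :=
  inf [set a | eigenvalue A a].

Section differential_calculus.
Context {R : realType} {d : nat}.
Local Notation V := 'rV[R]_d.

(* [iter_diff f [:: v1; ...; vl] x] is D^l f(x)(v1, ..., vl) *)
Fixpoint iter_diff (f : V -> V) (vs : seq V) : V -> V :=
  match vs with
  | [::] => f
  | v :: vs' => fun x => 'd (iter_diff f vs') x v
  end.

Definition class_C (k : nat) (f : V -> V) : Prop :=
  (forall vs : seq V, (size vs < k)%N ->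
     forall x, differentiable (iter_diff f vs) x) /\
  (forall vs : seq V, (size vs <= k)%N -> continuous (iter_diff f vs)).

Definition tuple_set (l : nat) (vs : l.-tuple V) (i : 'I_l) (x : V) :
    l.-tuple V :=
  [tuple if j == i then x else tnth vs j | j < l].

Definition multilinear (l : nat) (T : l.-tuple V -> V) : Prop :=
  forall (i : 'I_l) (vs : l.-tuple V) (a : R) (x y : V),
    T (tuple_set vs i (a *: x + y)) =
    a *: T (tuple_set vs i x) + T (tuple_set vs i y).

(* the operator norm of [T] is at most [c] *)
Definition opnorm_le (l : nat) (T : l.-tuple V -> V) (c : R) : Prop :=
  forall vs : l.-tuple V, (forall i, enorm (tnth vs i) <= 1) ->
    enorm (T vs) <= c.

End differential_calculus.

Section random_elements.
Context {R : realType} {disp : measure_display} {Omega : measurableType disp}.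
Variable P : probability Omega R.

(* [distribution P X] and [distribution P Y] are compared on measurable sets
   only, since a measure is here a function defined on all sets *)
Definition same_law {dT : measure_display} {T : measurableType dT}
    (X Y : Omega -> T) : Prop :=
  forall A : set T, measurable A -> P (X @^-1` A) = P (Y @^-1` A).

Definition indep {d1 d2 : measure_display} {T1 : measurableType d1}
    {T2 : measurableType d2} (X : Omega -> T1) (Y : Omega -> T2) : Prop :=
  forall (A : set T1) (B : set T2), measurable A -> measurable B ->
    P (X @^-1` A `&` Y @^-1` B) = (P (X @^-1` A) * P (Y @^-1` B))%E.

Definition mutual_indep {I : choiceType} {dT : measure_display}
    {T : measurableType dT} (D : set I) (X : I -> Omega -> T) : Prop :=
  forall (J : {fset I}), [set` J] `<=` D ->
  forall (A : I -> set T), (forall i, i \in J -> measurable (A i)) ->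
    P (\bigcap_(i in [set` J]) (X i @^-1` A i)) =
    (\prod_(i <- J) P (X i @^-1` A i))%E.

Definition cvg_in_proba (d : nat) (X : nat -> Omega -> 'rV[R]_d)
    (Y : Omega -> 'rV[R]_d) : Prop :=
  forall eps : R, 0 < eps ->
    P [set w | eps <= enorm (X n w - Y w)] @[n --> \oo] --> 0%E.

Definition joint {T : Type} (L : nat) (X : 'I_L -> Omega -> T) (w : Omega) :
    L.-tuple T :=
  [tuple X r w | r < L].

Definition mean_field (d q : nat) (H : 'rV[R]_d -> 'rV[R]_q -> 'rV[R]_d)
    (U : Omega -> 'rV[R]_q) (th : 'rV[R]_d) : 'rV[R]_d :=
  \row_(i < d) fine ('E_P[fun w => H th (U w) ord0 i])%E.

End random_elements.

Section scheme.
Context {R : realType}.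

Definition weight (alpha : R) (L r : nat) : R :=
  (-1) ^+ (L - r) * r%:R `^ (alpha * L%:R) /
  ((\prod_(0 <= j < r) (r%:R `^ alpha - j%:R `^ alpha)) *
   (\prod_(r.+1 <= j < L.+1) (j%:R `^ alpha - r%:R `^ alpha))).

Definition weight_mx (d : nat) (alpha : R) (L r : nat) : 'M[R]_d :=
  (weight alpha L r)%:M.

(* the innovation [u p] drives the p-th step; [u 0] is not used *)
Fixpoint rm_scheme (d q : nat) (H : 'rV[R]_d -> 'rV[R]_q -> 'rV[R]_d)
    (gamma : R -> R) (x0 : 'rV[R]_d) (u : nat -> 'rV[R]_q) (p : nat) :
    'rV[R]_d :=
  match p with
  | 0%N => x0
  | p'.+1 => let x := rm_scheme H gamma x0 u p' in
             x - gamma p'.+1%:R *: H x (u p'.+1)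
  end.

(* [x0 m] is the initial condition of the scheme of bias index [m];
   [V r p] is the p-th innovation at level [r.+1] *)
Definition stat_error (d q : nat) (H : 'rV[R]_d -> 'rV[R]_q -> 'rV[R]_d)
    (gamma : R -> R) (alpha : R) (L : nat) (thstar : nat -> 'rV[R]_d)
    (x0 : nat -> 'rV[R]_d) (V : 'I_L -> nat -> 'rV[R]_q) (n M : nat) :
    'rV[R]_d :=
  \sum_(r < L)
    (thstar (r.+1 * n)%N - rm_scheme H gamma (x0 (r.+1 * n)%N) (V r) M)
      *m weight_mx d alpha L r.+1.

End scheme.

Section assumptions.
Context {R : realType}.

Definition admissible_steps (gamma : R -> R) : Prop :=
  [/\ forall p : nat, (0 < p)%N -> 0 <= gamma p%:R,
      forall p : nat, (0 < p)%N -> gamma p.+1%:R <= gamma p%:R,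
      (\sum_(1 <= p <oo) (gamma p%:R)%:E = +oo)%E &
      (\sum_(1 <= p <oo) (gamma p%:R ^+ 2)%R%:E < +oo)%E].

Definition HS (gamma : R -> R) (lambda : R) : Prop :=
  [/\ forall t : R, 0 <= t -> 0 < gamma t,
      forall s t : R, 0 <= s -> s <= t -> gamma t <= gamma s,
      gamma t @[t --> +oo] --> (0 : R) &
      (exists2 rho : R, 2^-1 < rho < 1 &
         forall x : R, 0 < x ->
           gamma (t * x) / gamma t @[t --> +oo] --> x `^ (- rho)) \/
      (exists2 gamma0 : R, 1 < 2 * lambda * gamma0 &
         forall t : R, 1 <= t -> gamma t = gamma0 / t)].

Context {d q : nat}.
Local Notation V := 'rV[R]_d.

Definition HR (alpha : R) (L : nat) (h : V -> V) (hn : nat -> V -> V)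
    (thstar : V) : Prop :=
  [/\ exists Lam : nat -> V -> V, forall x : V,
        (fun n : nat => h x - hn n x -
           \sum_(1 <= j < L.+1) n%:R `^ (- (alpha * j%:R)) *: Lam j x)
        =o_\oo (fun n : nat => n%:R `^ (- (alpha * L%:R)) : R^o),
      [/\ class_C L h,
          forall n, (0 < n)%N -> class_C L (hn n) &
          forall l : nat, (0 < l < L)%N ->
          exists2 Lam : nat -> V -> l.-tuple V -> V,
            forall j x, multilinear (Lam j x) &
            forall (x : V) (eps : R), 0 < eps -> \forall n \near \oo,
              opnorm_le (fun vs : l.-tuple V =>
                iter_diff (hn n) vs x - iter_diff h vs x -
                \sum_(1 <= j < (L - l).+1)
                  n%:R `^ (- (alpha * j%:R)) *: Lam j x vs)
              (eps * n%:R `^ (- (alpha * (L - l)%:R)))],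
      forall l : nat, (0 < l <= L)%N -> forall x : V,
        exists2 B : set V, nbhs x B &
        forall eps : R, 0 < eps -> \forall n \near \oo, forall y : V, B y ->
          opnorm_le (fun vs : l.-tuple V =>
            iter_diff (hn n) vs y - iter_diff h vs y) eps &
      'J h thstar \in unitmx].

Definition HUA (hn : nat -> V -> V) (lambda : R) : Prop :=
  [/\ forall n, (0 < n)%N -> class_C 1 (hn n),
      exists k : R, forall n, (0 < n)%N ->
        k.-lipschitz (fun x : V => 'J (hn n) x) &
      (lambda%:E < ereal_inf [set z | exists (n : nat) (x : V), (0 < n)%N /\
         z = (lambda_min (2^-1 *: ('J (hn n) x + ('J (hn n) x)^T)))%R%:E])%E].

Context {disp : measure_display} {Omega : measurableType disp}.
Variable P : probability Omega R.
Variable H : V -> 'rV[R]_q -> V.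

Definition HUI (Un : nat -> Omega -> 'rV[R]_q) : Prop :=
  exists2 delta : R, 0 < delta & forall x : V,
    (ereal_sup [set 'E_P[fun w => (enorm (H x (Un n w)) `^ (2 + delta))%R] |
                n in [set n | (0 < n)%N]] < +oo)%E.

Definition HC1 (Un : nat -> Omega -> 'rV[R]_q) (thstarn : nat -> V) : Prop :=
  exists2 C : R, 0 < C & forall (n : nat) (x : V), (0 < n)%N ->
    ('E_P[fun w => (enorm (H x (Un n w)) ^+ 2)%R] <=
     (C * (1 + enorm (x - thstarn n) ^+ 2))%R%:E)%E.

Definition HC2 (U : Omega -> 'rV[R]_q) : Prop :=
  forall x : V, P [set w | ~ {for U w, continuous (H x)}] = 0%E.

Definition HRG (Un : nat -> Omega -> 'rV[R]_q) : Prop :=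
  exists2 a : R, 0 < a <= 1 &
    (ereal_sup [set z | exists (n : nat) (x y : V),
       [/\ (0 < n)%N, x <> y &
           z = 'E_P[fun w => (enorm (H x (Un n w) - H y (Un n w)) ^+ 2)%R] *
               ((enorm (x - y) `^ (2 * a))^-1)%R%:E]] < +oo)%E.

End assumptions.

(* Main.v *)
Require Import Defs.
From HB Require Import structures.
From mathcomp Require Import all_boot all_order all_algebra.
From mathcomp Require Import finmap.
From mathcomp Require Import all_classical all_reals all_analysis.
From mathcomp Require Import measurable_realfun.
From mathcomp Require Import ring lra.
Set Implicit Arguments.
Unset Strict Implicit.
Unset Printing Implicit Defensive.
Import Order.TTheory GRing.Theory Num.Theory.
Import numFieldNormedType.Exports.
Local Open Scope classical_set_scope.
Local Open Scope ring_scope.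

(** Let e_p be the weighted sum over the levels r of theta^r_p - theta^{*,rn},
    so that the statistical error is - e_M, let A be the Jacobian of h at
    theta^* and write g_p for the steps. Around its own zero, every field
    h^{rn} is linear with the common matrix A, up to a slope error eps(n) that
    tends to zero and a quadratic remainder (field_regularity). Hence
      e_{p+1} = e_p - g_{p+1} e_p A - g_{p+1} N_{p+1} - g_{p+1} rho_p,
    where N_{p+1} is the weighted noise, centred given the past, and rho_p the
    weighted linearization error. The error is split into the martingale part
    m, which solves the same recursion without rho, and a residual, which
    solves it without N. The martingale part is estimated in mean square and
    the residual in mean: rho_p contains squared errors of the schemes, of
    which only the first moment is available.

    The constant may depend on the steps and on lambda only, so everything
    that depends on the problem has to end up in phi1 or phi2. Three facts
    make this possible.

    Steps. Under (HS) there is a rate c < lambda such that sqrt(g) decays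
    slower, up to a factor C0, than exp(- c t) in the elapsed time
    t = g_1 + ... + g_p (HS_slow). A recursion of rate lambda whose forcing
    is of order sqrt(g) then has solutions of order sqrt(g), and the start and
    any vanishing part of the forcing contribute o(sqrt(g)) only
    (gronwall_slow); the same holds for g at rate 2 lambda. The strict
    inequality in (HUA) leaves a margin above lambda in which the terms in
    g ^ 2 of the squared recursions are absorbed once the steps are small.
    In particular every scheme has a mean squared error of order g_p,
    uniformly in n, and the residual is of order eps(n) sqrt(g) + o(sqrt(g)).

    Noise. Given the past, the second moment of N_{p+1} is at most that of the
    weighted field. At theta^* the latter is eventually at most twice its
    limit v, by the continuous mapping theorem and uniform integrability
    (second_moment_limsup); away from theta^*, the mean-square Holder
    continuity (HRG) costs a fraction of v plus a multiple of squared
    distances, which vanish along the schemes. So E|N_{p+1}|^2 is at most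
    5 v plus a term in n and a term in p that tend to zero
    (noise_bound_asymptotic).

    Independence. The levels and the martingale part form a Markov chain
    driven by the joint innovations, so each innovation is independent of the
    current state (chain_indep) and the state can be frozen when a step is
    averaged (indep_freeze).

    Together, E|m_M|^2 is at most 5 C0^2 U g_M v up to vanishing terms, with U
    depending on the steps, lambda and c, and E|m_M| follows by
    x <= (tau + x^2 / tau) / 2 with tau = sqrt(g_M v). *)

(** * Discrete Gronwall estimates for slowly decaying steps *)

Section gronwall.
Context {R : realType}.
Implicit Types (g s u f : nat -> R).

Definition elapsed g (p : nat) : R := \sum_(i < p) g i.+1.

Lemma elapsedS g p : elapsed g p.+1 = elapsed g p + g p.+1.
Proof. by rewrite /elapsed big_ord_recr. Qed.

Lemma elapsed_le g : (forall i, 0 <= g i.+1) ->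
  {homo elapsed g : i j / (i <= j)%N >-> i <= j}.
Proof.
move=> g0; apply: homo_leq => [//||p]; first exact: le_trans.
by rewrite elapsedS lerDl.
Qed.

(** The sequences s that can serve as a target of a Gronwall estimate of rate
    above c. The condition bears on whole intervals, because one step of s may
    lose more than the discount of one step. *)
Definition slow g (c C0 : R) s := forall j p, (j <= p)%N ->
  s j * expR (- c * (elapsed g p - elapsed g j)) <= C0 * s p.

(** Discrete convolution of f with the exponential kernel of rate m in elapsed
    time. *)
Fixpoint leaky g (m z0 : R) f (p : nat) : R :=
  if p is p'.+1 then expR (- m * g p) * leaky g m z0 f p' + g p * f p else z0.

Lemma leakyD g m z0 z1 f u p :
  leaky g m z0 f p + leaky g m z1 u p =
  leaky g m (z0 + z1) (fun i => f i + u i) p.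
Proof. by elim: p => //= p <-; ring. Qed.

Lemma leaky_ge g m z0 f p : (forall i, 0 <= g i.+1) ->
  (forall i, 0 <= f i) ->
  expR (- m * elapsed g p) * z0 <= leaky g m z0 f p.
Proof.
move=> g0 f0; elim: p => [|p IH]; first by rewrite /elapsed big_ord0 mulr0 expR0 mul1r.
rewrite elapsedS /=.
have -> : expR (- m * (elapsed g p + g p.+1)) * z0 =
    expR (- m * g p.+1) * (expR (- m * elapsed g p) * z0).
  by rewrite mulrDr expRD; ring.
by rewrite -[leLHS]addr0 lerD ?mulr_ge0// ler_wpM2l ?expR_ge0.
Qed.

(** In continuous time the equilibrium under a constant input v is v / m. For
    steps bounded by gb, (1 + m gb) / m * v is still a barrier of the recursion,
    since exp(- m x) <= 1 / (1 + m x). *)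
Lemma leaky_cst_le g m gb v p : 0 < m -> 0 <= v ->
  (forall i, 0 <= g i.+1 <= gb) ->
  leaky g m 0 (fun=> v) p <= (1 + m * gb) / m * v.
Proof.
move=> m0 v0 gb0; elim: p => [|p IH] /=.
  have /andP[a b] := gb0 0%N.
  by rewrite mulr_ge0// divr_ge0 ?(ltW m0)// addr_ge0// mulr_ge0 ?(ltW m0)// (le_trans a).
have /andP[g0 gle] := gb0 p.
set x := g p.+1 in g0 gle *.
set U := (1 + m * gb) / m.
apply: (@le_trans _ _ (expR (- m * x) * (U * v) + x * v)).
  by rewrite lerD2r ler_wpM2l// expR_ge0.
have mx0 : 0 <= m * x by rewrite mulr_ge0// ltW.
have h1 : expR (- m * x) * (1 + m * x) <= 1.
  rewrite mulNr -[leRHS](expRxMexpNx_1 (m * x)) mulrC ler_wpM2r ?expR_ge0//.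
  exact: expR_ge1Dx.
have e1 : expR (- m * x) <= (1 + m * x)^-1.
  by rewrite -[leRHS]mul1r ler_pdivlMr// ltr_pwDl.
rewrite mulrA -mulrDl ler_wpM2r// -[leRHS](subrK (expR (- m * x) * U)).
rewrite addrC lerD2r -[X in X - _]mul1r -mulrBl.
apply: (@le_trans _ _ ((1 - (1 + m * x)^-1) * U)); last first.
  rewrite ler_wpM2r ?lerB// divr_ge0 ?(ltW m0)// addr_ge0// mulr_ge0 ?(ltW m0)//.
  exact: le_trans gle.
have -> : 1 - (1 + m * x)^-1 = m * x / (1 + m * x).
  by field; rewrite gt_eqF// ltr_pwDl.
rewrite /U.
have -> : m * x / (1 + m * x) * ((1 + m * gb) / m) = x * ((1 + m * gb) / (1 + m * x)).
  by field; rewrite !gt_eqF// ltr_pwDl.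
rewrite ler_peMr// ler_pdivlMr ?ltr_pwDl// mul1r lerD2l ler_wpM2l// ltW//.
Qed.

(** Past a rank where f is small the input is bounded by a small constant, and
    what was accumulated before is discounted by an unbounded elapsed time. *)
Lemma leaky_cvg0 g m gb z0 f : 0 < m -> (forall i, 0 <= g i.+1 <= gb) ->
  elapsed g p @[p --> \oo] --> +oo ->
  0 <= z0 -> (forall i, 0 <= f i) -> f p @[p --> \oo] --> 0 ->
  leaky g m z0 f p @[p --> \oo] --> 0.
Proof.
move=> m0 gb0 Goo z00 f0 fcvg.
have g0 i : 0 <= g i.+1 by have /andP[] := gb0 i.
have gb_ge0 : 0 <= gb by have /andP[a b] := gb0 0%N; exact: le_trans b.
have lk0 p : 0 <= leaky g m z0 f p.
  apply: le_trans (leaky_ge _ _ _ g0 f0); by rewrite mulr_ge0// expR_ge0.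
set U := (1 + m * gb) / m.
have U0 : 0 < U by rewrite divr_gt0// ltr_pwDl// mulr_ge0// ltW.
apply/cvgrPdist_le => eps eps0.
have e2 : 0 < eps / (2 * U) by rewrite divr_gt0// mulr_gt0.
have /cvgrPdist_le/(_ _ e2) [p1 _ Hp1] := fcvg.
have step p : (p1 <= p)%N -> leaky g m z0 f p <=
   expR (- m * (elapsed g p - elapsed g p1)) * leaky g m z0 f p1 +
   leaky g m 0 (fun=> eps / (2 * U)) p.
  elim: p => [|p IH].
    rewrite leqn0 => /eqP ->/=; by rewrite subrr mulr0 expR0 mul1r addr0.
  rewrite leq_eqVlt => /predU1P[->|].
    rewrite subrr mulr0 expR0 mul1r lerDl.
    apply: le_trans (leaky_ge _ _ _ g0 _); rewrite ?mulr0//.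
    by move=> _; exact: ltW.
  rewrite ltnS => p1p; have {}IH := IH p1p.
  have fp : f p.+1 <= eps / (2 * U).
    have := Hp1 p.+1 (leqW p1p); by rewrite /= sub0r normrN ger0_norm.
  rewrite /= elapsedS.
  have -> : - m * (elapsed g p + g p.+1 - elapsed g p1) =
    - m * g p.+1 + - m * (elapsed g p - elapsed g p1) by ring.
  rewrite expRD addrA -mulrA -mulrDr.
  by rewrite lerD// ler_wpM2l// expR_ge0.
have Hexp : expR (- m * (elapsed g p - elapsed g p1)) * leaky g m z0 f p1 @[p --> \oo] --> 0.
  rewrite -[X in _ --> X](mul0r (leaky g m z0 f p1)).
  apply: cvgM; last exact: cvg_cst.
  have -> : (fun p => expR (- m * (elapsed g p - elapsed g p1))) =
     (fun x => expR (- x)) \o (fun p => m * (elapsed g p - elapsed g p1)).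
    by apply/funext => p /=; rewrite mulNr.
  apply: (@cvg_comp _ _ _ _ _ _ (+oo%R)); last exact: cvgr_expR.
  apply/cvgryPge => A; move/cvgryPge : Goo => /(_ (A / m + elapsed g p1)).
  apply: filterS => p; rewrite -lerBrDr => h.
  by rewrite mulrC -ler_pdivrMr.
have eps20 : 0 < eps / 2 by rewrite divr_gt0.
move/cvgrPdist_le : Hexp => /(_ _ eps20) [p2 _ Hp2].
exists (maxn p1 p2) => // p /=; rewrite geq_max => /andP[p1p p2p].
rewrite sub0r normrN ger0_norm//.
apply: le_trans (step _ p1p) _.
have := Hp2 p p2p; rewrite /= sub0r normrN ger0_norm; last by rewrite mulr_ge0// expR_ge0.
have := @leaky_cst_le g m gb (eps / (2 * U)) p m0 (ltW e2) gb0.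
rewrite -/U.
have -> : U * (eps / (2 * U)) = eps / 2 by field; rewrite gt_eqF.
lra.
Qed.

(** After multiplication of a_p by the discount of rate c from p to the final
    rank, the target s enters through its final value only, and a recursion of
    rate l - c > 0 with input v + u remains. The start and the vanishing input u go
    into psi, which is fixed before v and the sequence a are known: v thus comes
    with a constant that depends on the steps and the rates only. *)
Lemma gronwall_slow g s (l c C0 gb : R) :
  (forall i, 0 <= g i.+1 <= gb) -> elapsed g p @[p --> \oo] --> +oo ->
  (forall p, 0 < s p) -> c < l -> 1 <= C0 -> slow g c C0 s ->
  forall (p0 : nat) (A : R) u, 0 <= A -> (forall p, 0 <= u p) ->
  u p @[p --> \oo] --> 0 ->
  exists psi : nat -> R,
  [/\ forall M, 0 <= psi M, psi M @[M --> \oo] --> 0 &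
   forall M v (a : nat -> R), 0 <= v ->
   (forall p, (p <= p0)%N -> (p <= M)%N -> a p <= A) ->
   (forall p, (p0 <= p < M)%N ->
      a p.+1 <= expR (- l * g p.+1) * a p + g p.+1 * (s p.+1 * (v + u p.+1))) ->
   a M <= C0 * s M * ((1 + (l - c) * gb) / (l - c) * v + psi M)].
Proof.
move=> gb0 Goo s0 cl C01 slow_s p0 A u A0 u0 ucvg.
have g0 i : 0 <= g i.+1 by have /andP[] := gb0 i.
set m := l - c; have m0 : 0 < m by rewrite subr_gt0.
set B := \sum_(p < p0.+1) (s p)^-1.
have B0 : 0 <= B by apply: sumr_ge0 => i _; rewrite invr_ge0 ltW.
have sB p : (p <= p0)%N -> 1 <= s p * B.
  move=> pp0; rewrite -ltnS in pp0; rewrite /B (bigD1 (Ordinal pp0))//= mulrDr.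
  rewrite mulfV ?gt_eqF// lerDl mulr_ge0 ?(ltW (s0 _))//.
  by apply: sumr_ge0 => i _; rewrite invr_ge0 ltW.
(* B is at least 1 / s p for p <= p0, so A * B is at least A / s p there; the
   exponential keeps the solution started at z0 above A * B up to rank p0 *)
set z0 := A * B * expR (m * elapsed g p0).
have z00 : 0 <= z0 by rewrite !mulr_ge0// expR_ge0.
set psi := leaky g m z0 u.
have psi0 M : 0 <= psi M.
  by apply: le_trans (leaky_ge _ _ _ g0 u0); rewrite mulr_ge0// expR_ge0.
have C00 : 0 < C0 by apply: lt_le_trans C01.
exists psi; split => //; first exact: (leaky_cvg0 m0 gb0).
move=> N v a v0 aA astep.
have psiA p : (p <= p0)%N -> A * B <= psi p.
  move=> pp0; apply: le_trans (leaky_ge _ _ _ g0 u0).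
  rewrite /z0 mulrCA -expRD -[leLHS]mulr1 ler_wpM2l ?mulr_ge0//.
  rewrite -[leLHS]expR0 ler_expR mulNr addrC -mulrBr mulr_ge0 ?(ltW m0)// subr_ge0.
  exact: elapsed_le.
have U0 : 0 <= (1 + m * gb) / m.
  have /andP[x y] := gb0 0%N.
  by rewrite divr_ge0 ?(ltW m0)// addr_ge0// mulr_ge0 ?(ltW m0)// (le_trans x).
have small p : (p <= p0)%N -> (p <= N)%N -> a p <= C0 * s p * psi p.
  move=> pp0 pN; apply: le_trans (aA _ pp0 pN) _.
  apply: (@le_trans _ _ (C0 * s p * (A * B))); last first.
    by rewrite ler_wpM2l ?psiA// mulr_ge0 ?ltW.
  have -> : C0 * s p * (A * B) = A * (C0 * (s p * B)) by ring.
  rewrite ler_peMr// -[leLHS]mulr1 ler_pM//; exact: sB.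
have [Np0|p0N] := leqP N p0.
  apply: le_trans (small _ Np0 (leqnn _)) _.
  by rewrite ler_wpM2l ?mulr_ge0 ?(ltW C00) ?(ltW (s0 _))// lerDr mulr_ge0.
set f := fun i => v + u i.
have key p : (p0 <= p <= N)%N ->
    a p * expR (- c * (elapsed g N - elapsed g p)) <= C0 * s N * leaky g m z0 f p.
  have f0 i : 0 <= f i by rewrite addr_ge0.
  elim: p => [|p IH] /andP[p0p pN].
    move: p0p; rewrite leqn0 => /eqP p00.
    apply: (@le_trans _ _ (A * expR (- c * (elapsed g N - elapsed g 0)))).
      by rewrite ler_wpM2r ?expR_ge0// aA// p00.
    have h := slow_s 0%N N isT.
    apply: (@le_trans _ _ (A * B * (s 0%N * expR (- c * (elapsed g N - elapsed g 0))))).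
      rewrite mulrA ler_wpM2r ?expR_ge0// -mulrA ler_peMr// mulrC sB//.
    rewrite mulrC; apply: ler_pM => //; rewrite ?mulr_ge0 ?expR_ge0 ?(ltW (s0 _))//.
    by rewrite /= /z0 p00 /elapsed big_ord0 mulr0 expR0 mulr1.
  move: p0p; rewrite leq_eqVlt => /predU1P[p0E|].
    apply: (@le_trans _ _ (A * expR (- c * (elapsed g N - elapsed g p.+1)))).
      by rewrite ler_wpM2r ?expR_ge0// aA// p0E.
    have h := slow_s p.+1 N pN.
    apply: (@le_trans _ _ (A * B * (s p.+1 * expR (- c * (elapsed g N - elapsed g p.+1))))).
      rewrite mulrA ler_wpM2r ?expR_ge0// -mulrA ler_peMr// mulrC sB// p0E//.
    rewrite mulrC; apply: ler_pM => //; rewrite ?mulr_ge0 ?expR_ge0 ?(ltW (s0 _))//.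
    apply: le_trans (leaky_ge _ _ _ g0 f0).
    by rewrite /z0 p0E mulrCA -expRD mulNr addNr expR0 mulr1.
  rewrite ltnS => p0p.
  have {}IH := IH (introT andP (conj p0p (ltnW pN))).
  have st := astep p (introT andP (conj p0p pN)).
  rewrite /=.
  set E := expR (- c * (elapsed g N - elapsed g p.+1)).
  apply: (@le_trans _ _ ((expR (- l * g p.+1) * a p + g p.+1 * (s p.+1 * f p.+1)) * E)).
    by rewrite ler_wpM2r// expR_ge0.
  rewrite [leLHS]mulrDl [leRHS]mulrDr; apply: lerD.
    have -> : expR (- l * g p.+1) * a p * E = expR (- m * g p.+1) *
       (a p * expR (- c * (elapsed g N - elapsed g p))).
      rewrite /E mulrAC -expRD [RHS]mulrCA -expRD mulrC; congr (_ * expR _).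
      by rewrite elapsedS /m; ring.
    by rewrite [leRHS]mulrCA ler_wpM2l// expR_ge0.
  have -> : g p.+1 * (s p.+1 * f p.+1) * E = g p.+1 * f p.+1 * (s p.+1 * E) by ring.
  rewrite [leRHS]mulrC ler_wpM2l ?mulr_ge0//.
  exact: slow_s.
have := key N; rewrite (ltnW p0N) leqnn => /(_ isT).
rewrite subrr mulr0 expR0 mulr1 => /le_trans; apply.
rewrite ler_wpM2l ?mulr_ge0 ?(ltW C00) ?(ltW (s0 _))//.
have -> : leaky g m z0 f N = leaky g m 0 (fun=> v) N + psi N.
  by rewrite leakyD add0r.
by rewrite lerD2r (leaky_cst_le _ _ _ gb0).
Qed.

End gronwall.

(** * Admissible step sequences decay slowly *)

Section steps.
Context {R : realType}.
Variable gamma : R -> R.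

Lemma elapsed_cvgy : admissible_steps gamma ->
  elapsed (fun p => gamma p%:R) p @[p --> \oo] --> +oo.
Proof.
case=> g0 _ sum_oo _; apply/cvgeryP.
have : (\sum_(1 <= p < n) (gamma p%:R)%:E)%E @[n --> \oo] --> +oo%E.
  rewrite -sum_oo; apply: is_cvg_nneseries => p p1 _; rewrite lee_fin g0//.
rewrite -cvg_shiftS; apply: cvg_trans; apply: near_eq_cvg; near=> n.
by rewrite /elapsed /= big_add1 /= sumEFin big_mkord.
Unshelve. all: end_near. Qed.

(** Regular variation enters through the single ratio x = 2, whose limit
    2^(- rho) exceeds 1/2 because rho < 1. *)
Lemma regular_variation_doubling (rho : R) : rho < 1 ->
  (forall t : R, 0 <= t -> 0 < gamma t) ->
  (forall x : R, 0 < x -> gamma (t * x) / gamma t @[t --> +oo] --> x `^ (- rho)) ->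
  exists2 q : R, 2^-1 < q & exists2 T : R, 0 < T &
    forall t, T <= t -> q * gamma t <= gamma (2 * t).
Proof.
move=> rho1 gam0 /(_ 2 (ltr0n _ 2)) rv.
have lim_gt : 2^-1 < (2 : R) `^ (- rho).
  rewrite -powR_inv1// /powR pnatr_eq0/= ltr_expR ltr_pM2r ?ltrN2//.
  by rewrite ln_gt0// ltr1n.
set q := (2^-1 + (2 : R) `^ (- rho)) / 2.
have q_gt : 2^-1 < q by rewrite /q; lra.
have q_lt : q < (2 : R) `^ (- rho) by rewrite /q; lra.
exists q => //.
have := cvgr_gt _ rv _ q_lt => -[T0 [T0real HT]].
exists (Num.max T0 0 + 1).
  by rewrite ltr_wpDl// le_max lexx orbT.
move=> t ht.
have t0 : 0 <= t.
  by apply: le_trans ht; rewrite addr_ge0// le_max lexx orbT.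
have tT0 : T0 < t.
  by apply: lt_le_trans ht; rewrite ltr_pwDr// le_max lexx.
by have /= := HT t tT0; rewrite [t * 2]mulrC ltr_pdivlMr ?gam0// => /ltW.
Qed.

Lemma unbounded_exp (x B : R) : 1 < x -> exists n : nat, B <= x ^+ n.
Proof.
move=> x1; set h := x - 1; have h0 : 0 < h by rewrite subr_gt0.
have bern n : 1 + n%:R * h <= x ^+ n.
  elim: n => [|n IH]; first by rewrite mul0r addr0 expr0.
  rewrite exprS; apply: le_trans (ler_wpM2l _ IH); last by lra.
  have -> : x = 1 + h by rewrite /h; ring.
  rewrite -natr1; have : 0 <= n%:R * h * h by rewrite !mulr_ge0// ltW.
  lra.
exists (Num.bound `|B / h|); apply: le_trans (bern _).
apply: (@le_trans _ _ (`|B / h| * h)); first by rewrite -ler_pdivrMr// ler_norm.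
rewrite -[leLHS]add0r lerD// ler_wpM2r ?(ltW h0)//.
by rewrite ltW// archi_boundP.
Qed.

Lemma elapsed_mass (g : nat -> R) i k B :
  (forall p, (p <= i + k)%N -> B <= g p) ->
  k%:R * B <= elapsed g (i + k) - elapsed g i.
Proof.
elim: k => [|k IH] Bg; first by rewrite mul0r addn0 subrr.
have /IH {}IH : forall p, (p <= i + k)%N -> B <= g p.
  by move=> p pk; rewrite Bg// addnS leqW.
by rewrite addnS elapsedS -natr1 mulrDl mul1r addrAC lerD// Bg// addnS.
Qed.

(** Each doubling of t multiplies t gamma(t) by at least 2 q > 1. Consequently
    the time elapsed between the ranks p/2 and p, at least p gamma(p) / 2, tends to
    infinity. *)
Lemma doubling_mass_unbounded (q T : R) :
  (forall t : R, 0 <= t -> 0 < gamma t) ->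
  (forall s t : R, 0 <= s -> s <= t -> gamma t <= gamma s) ->
  2^-1 < q -> 0 < T -> (forall t, T <= t -> q * gamma t <= gamma (2 * t)) ->
  forall B, exists T', forall t, T' <= t -> B <= t * gamma t.
Proof.
move=> gam0 gam_dec q2 T0 dbl B.
pose f t := t * gamma t; pose f0 := T * gamma (2 * T).
have f00 : 0 < f0 by rewrite mulr_gt0// gam0// mulr_ge0// ltW.
have fdbl t : T <= t -> 2 * q * f t <= f (2 * t).
  move=> Tt; rewrite /f; have t0 : 0 <= t := le_trans (ltW T0) Tt.
  have -> : 2 * q * (t * gamma t) = (2 * t) * (q * gamma t) by ring.
  by rewrite ler_wpM2l ?dbl// mulr_ge0.
have fhalf t : 2 * T <= t -> 2 * q * f (t / 2) <= f t.
  move=> Tt; rewrite -[t in leRHS](@divfK _ 2)// [t / 2 * 2]mulrC fdbl//.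
  by rewrite ler_pdivlMr// mulrC.
have q1 : 1 < 2 * q by lra.
(* f is bounded below on [T, 2 T], and does not decrease when t is doubled *)
have base j t : T <= t -> t <= 2 ^+ j * T -> f0 <= f t.
  elim: j t => [|j IH] t Tt.
    rewrite expr0 mul1r => tT; have -> : t = T by apply/le_anti/andP.
    by rewrite /f0 /f ler_wpM2l ?(ltW T0)// gam_dec ?(ltW T0)// ler_peMl ?ler1n// ltW.
  have [tT _|tT tj] := leP t (2 * T).
    have t0 : 0 <= t := le_trans (ltW T0) Tt.
    rewrite /f0 /f; apply: ler_pM => //; first exact: ltW.
      by rewrite ltW// gam0// mulr_ge0// ltW.
    exact: gam_dec.
  apply: le_trans (fhalf _ (ltW tT)).
  have h : f0 <= f (t / 2).
    apply: IH; first by rewrite ler_pdivlMr// mulrC ltW.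
    rewrite ler_pdivrMr//; apply: le_trans tj _; rewrite exprS.
    by have -> : 2 ^+ j * T * 2 = 2 * 2 ^+ j * T by ring.
  have : 0 <= f (t / 2) by apply: le_trans h; exact: ltW.
  by move=> h2; apply: le_trans h _; rewrite ler_peMl// ltW.
have level k t : 2 ^+ k * T <= t -> (2 * q) ^+ k * f0 <= f t.
  elim: k t => [|k IH] t; rewrite ?expr0 ?mul1r => Tt.
    apply: (base (Num.bound (t / T))) => //.
    rewrite -ler_pdivrMr// ltW// upper_nthrootP//.
  apply: le_trans (fhalf _ _).
    rewrite exprS -mulrA ler_wpM2l ?IH ?(le_trans _ (ltW q1))//.
    by rewrite ler_pdivlMr// mulrC mulrA -exprS.
  apply: le_trans Tt; rewrite ler_wpM2r ?(ltW T0)// exprS ler_peMr//.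
  by rewrite exprn_ege1// ler1n.
have [k Hk] := unbounded_exp (B / f0) q1.
exists (2 ^+ k * T) => t /level; apply: le_trans.
by rewrite -ler_pdivrMr.
Qed.

(** The rate c is taken strictly between 1 / (2 gamma0) and lambda. From p to
    p + 1, the square root of gamma0 / p loses a factor of about 1 - 1 / (2 p),
    which is eventually milder than the discount exp(- c gamma0 / (p + 1)); before,
    it varies within a bounded range. *)
Lemma slow_hyperbolic (lambda gamma0 : R) : 0 < lambda ->
  (forall t : R, 0 <= t -> 0 < gamma t) ->
  (forall s t : R, 0 <= s -> s <= t -> gamma t <= gamma s) ->
  1 < 2 * lambda * gamma0 -> (forall t : R, 1 <= t -> gamma t = gamma0 / t) ->
  exists c C0 : R, [/\ 0 < c, c < lambda, 1 <= C0 &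
    slow (fun p => gamma p%:R) c C0 (fun p => Num.sqrt (gamma p%:R))].
Proof.
move=> l0 gam0 gam_dec lg gamE.
have g00 : 0 < gamma0.
  have : 0 < 2 * lambda * gamma0 by lra.
  by rewrite pmulr_rgt0 ?mulr_gt0.
set c := ((2 * gamma0)^-1 + lambda) / 2.
have i0 : 0 < (2 * gamma0)^-1 by rewrite invr_gt0 mulr_gt0.
have il : (2 * gamma0)^-1 < lambda.
  rewrite -[X in X < _]mul1r ltr_pdivrMr ?mulr_gt0//; lra.
have c0 : 0 < c by rewrite /c; lra.
have cl : c < lambda by rewrite /c; lra.
have ic : 1 < 2 * c * gamma0.
  have : (2 * gamma0)^-1 < c by rewrite /c; lra.
  rewrite -[X in X < _]mul1r ltr_pdivrMr ?mulr_gt0//; lra.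
set h := 2 * c * gamma0 - 1; have h0 : 0 < h by rewrite /h; lra.
set p0 := (Num.bound (h^-1)).+1.
have gp0 p : 0 < gamma p%:R by apply: gam0.
have gp_dec j p : (j <= p)%N -> gamma p%:R <= gamma j%:R.
  by move=> jp; rewrite gam_dec// ler_nat.
have gE p : gamma p.+1%:R = gamma0 / p.+1%:R by rewrite gamE// ler1n.
pose s p := Num.sqrt (gamma p%:R).
have s0 p : 0 < s p by rewrite sqrtr_gt0 gam0.
have s_dec j p : (j <= p)%N -> s p <= s j.
  by move=> jp; rewrite ler_sqrt ?gp_dec// ltW.
have step p : (p0 <= p)%N -> expR (- c * gamma p.+1%:R) * s p <= s p.+1.
  move=> pp0; have p_gt0 : (0 < p)%N by apply: leq_trans pp0.
  have hp : 1 <= h * p%:R.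
    rewrite mulrC -ler_pdivrMr// div1r; apply: (@le_trans _ _ (Num.bound h^-1)%:R).
      by rewrite ltW// archi_boundP// invr_ge0 ltW.
    by rewrite ler_nat; apply: leq_trans pp0.
  rewrite -ler_sqr ?nnegrE ?mulr_ge0 ?expR_ge0 ?(ltW (s0 _))//.
  rewrite exprMn /s !sqr_sqrtr ?(ltW (gp0 _))//.
  rewrite -expRM_natl -(prednK p_gt0) (gE p.-1) prednK// gE.
  set x : R := p%:R; have x0 : 0 < x by rewrite ltr0n.
  have -> : p.+1%:R = x + 1 by rewrite natr1.
  have e1 := expR_ge1Dx (2%:R * (c * (gamma0 / (x + 1)))).
  have : expR (2%:R * (- c * (gamma0 / (x + 1)))) * expR (2%:R * (c * (gamma0 / (x + 1)))) = 1.
    by rewrite -expRD mulNr mulrN addNr expR0.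
  set E := expR (_ * (- c * _)) => EE.
  have E0 : 0 <= E by rewrite expR_ge0.
  have E1 : E * (1 + 2%:R * (c * (gamma0 / (x + 1)))) <= 1.
    by rewrite -[leRHS]EE ler_wpM2l.
  have x1 : 0 < x + 1 by lra.
  have k : (x + 1) / x <= 1 + 2%:R * (c * (gamma0 / (x + 1))).
    have -> : (x + 1) / x = 1 + x^-1 by field; rewrite gt_eqF.
    rewrite lerD2l -[leLHS]mul1r ler_pdivrMr//.
    have -> : 2%:R * (c * (gamma0 / (x + 1))) * x = (1 + h) * x / (x + 1).
      by rewrite /h; field; rewrite gt_eqF.
    rewrite ler_pdivlMr//; have := hp; rewrite -/x; lra.
  rewrite ler_pdivlMr//.
  have -> : E * (gamma0 / x) * (x + 1) = gamma0 * (E * ((x + 1) / x)).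
    by field; rewrite gt_eqF.
  rewrite -[leRHS]mulr1 ler_wpM2l ?(ltW g00)//.
  by apply: le_trans E1; rewrite ler_wpM2l.
exists c, (Num.max 1 (s 0%N / s p0)); split => //; first by rewrite le_max lexx.
set C0 := Num.max _ _.
have C00 : 0 <= C0 by rewrite le_max ler01.
have exp_le1 j p : (j <= p)%N ->
    expR (- c * (elapsed (fun p => gamma p%:R) p - elapsed (fun p => gamma p%:R) j)) <= 1.
  move=> jp; rewrite -[leRHS]expR0 ler_expR mulNr oppr_le0 mulr_ge0 ?(ltW c0)//.
  by rewrite subr_ge0 elapsed_le// => i; exact: ltW.
move=> j p; elim: p => [|p IH] jp.
  move: jp; rewrite leqn0 => /eqP ->; rewrite subrr mulr0 expR0 mulr1.
  by rewrite ler_peMl ?(ltW (s0 _))// le_max lexx.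
have [pp0|p0p] := leqP p.+1 p0.
  apply: (@le_trans _ _ (s j * 1)); first by rewrite ler_wpM2l ?exp_le1// (ltW (s0 _)).
  rewrite mulr1; apply: (@le_trans _ _ (s 0%N / s p0 * s p.+1)); last first.
    by rewrite ler_wpM2r ?(ltW (s0 _))// le_max lexx orbT.
  apply: (le_trans (s_dec 0%N j isT)).
  by rewrite mulrAC -mulrA ler_peMr ?(ltW (s0 _))// ler_pdivlMr// mul1r s_dec.
move: jp; rewrite leq_eqVlt => /predU1P[->|jp].
  by rewrite subrr mulr0 expR0 mulr1 ler_peMl ?(ltW (s0 _))// le_max lexx.
have {}IH := IH jp.
rewrite elapsedS.
have -> : - c * (elapsed (fun p => gamma p%:R) p + gamma p.+1%:R -
    elapsed (fun p => gamma p%:R) j) = - c * gamma p.+1%:R +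
   - c * (elapsed (fun p => gamma p%:R) p - elapsed (fun p => gamma p%:R) j) by ring.
rewrite expRD mulrCA.
apply: (@le_trans _ _ (expR (- c * gamma p.+1%:R) * (C0 * s p))).
  by rewrite ler_wpM2l ?expR_ge0.
by rewrite mulrCA ler_wpM2l// step.
Qed.

(** Regular variation leaves the relative drop of gamma at one step o(1), which
    may exceed the discount c gamma(p) of that step. So p is compared with p/2
    instead of p - 1: halving p multiplies sqrt(gamma) by at most 2, while the time
    elapsed between p/2 and p is eventually beyond 1 / c and its discount is at most
    1/2. The two factors cancel in the strong induction on p. *)
Lemma slow_regular_variation (lambda rho : R) : 0 < lambda -> rho < 1 ->
  (forall t : R, 0 <= t -> 0 < gamma t) ->
  (forall s t : R, 0 <= s -> s <= t -> gamma t <= gamma s) ->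
  (forall x : R, 0 < x -> gamma (t * x) / gamma t @[t --> +oo] --> x `^ (- rho)) ->
  exists c C0 : R, [/\ 0 < c, c < lambda, 1 <= C0 &
    slow (fun p => gamma p%:R) c C0 (fun p => Num.sqrt (gamma p%:R))].
Proof.
move=> l0 rho1 gam0 gam_dec rv.
have [q q2 [T T0 dbl]] := regular_variation_doubling rho1 gam0 rv.
set c := lambda / 2; have c0 : 0 < c by rewrite /c; lra.
have [T' HT'] := doubling_mass_unbounded gam0 gam_dec q2 T0 dbl (2 * c^-1).
pose g := fun p : nat => gamma p%:R.
pose s p := Num.sqrt (gamma p%:R).
have gp0 p : 0 < g p by rewrite /g gam0.
have gp_dec j p : (j <= p)%N -> g p <= g j.
  by move=> jp; rewrite gam_dec// ler_nat.
have s0 p : 0 < s p by rewrite sqrtr_gt0 gam0.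
have s_dec j p : (j <= p)%N -> s p <= s j.
  by move=> jp; rewrite ler_sqrt ?(ltW (gp0 _))//; exact: gp_dec.
(* past p0, the doubling inequality applies at p/2 and the bound on t gamma(t)
   at p *)
set p0 := (2 * (maxn (Num.bound `|T|) (Num.bound `|T'|))).+1.
have big p : (p0 < p)%N -> T <= (p./2)%:R /\ T' <= p%:R.
  move=> pp0; split.
    apply: le_trans (ler_norm _) _; apply: le_trans (ltW (archi_boundP _)) _ => //.
    rewrite ler_nat; apply: leq_trans (leq_maxl _ (Num.bound `|T'|)) _.
    rewrite -(doubleK (maxn _ _)) half_leq// -mul2n; apply: leq_trans (ltnW pp0).
    exact: leqnSn.
  apply: le_trans (ler_norm _) _; apply: le_trans (ltW (archi_boundP _)) _ => //.
  rewrite ler_nat; apply: leq_trans (leq_maxr (Num.bound `|T|) _) _.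
  by apply: leq_trans (ltnW pp0); rewrite leqW// leq_pmull.
have halving p : (p0 < p)%N -> s p./2 <= 2 * s p.
  move=> /big[Tp _].
  rewrite -ler_sqr ?nnegrE ?mulr_ge0 ?(ltW (s0 _))//.
  rewrite exprMn /s !sqr_sqrtr ?(ltW (gp0 _))//.
  have a1 := dbl _ Tp.
  have a2 : T <= 2 * (p./2)%:R by apply: le_trans Tp _; rewrite ler_peMl// ler1n.
  have {}a2 := dbl _ a2.
  have ge : gamma (2 * (2 * (p./2)%:R)) <= g p.
    rewrite gam_dec// -!natrM ler_nat mulnA.
    have k0 : (0 < p./2)%N by rewrite -(ltr_nat R); exact: lt_le_trans Tp.
    rewrite -{1}[p]odd_double_half -mul2n (_ : 2 * 2 = 2 + 2)%N// mulnDl leq_add2r.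
    by apply: leq_trans (leq_b1 _) _; rewrite muln_gt0.
  have := gp0 p./2; rewrite /g in ge *.
  have : q * (q * gamma (p./2)%:R) <= gamma p%:R.
    apply: le_trans ge; apply: le_trans a2; rewrite ler_wpM2l//; lra.
  have : 4^-1 * gamma (p./2)%:R <= q * q * gamma (p./2)%:R.
    by rewrite ler_wpM2r ?(ltW (gp0 _))//; nra.
  lra.
have decay p : (p0 < p)%N ->
    expR (- c * (elapsed g p - elapsed g p./2)) <= 2^-1.
  move=> /big[_ Tp].
  have mass : (p - p./2)%:R * g p <= elapsed g p - elapsed g p./2.
    have hp : (p./2 <= p)%N by rewrite -{2}[p]odd_double_half -addnn addnA leq_addl.
    rewrite -[in X in _ <= X - _](subnKC hp); apply: elapsed_mass => i.
    by rewrite subnKC// => ip; exact: gp_dec.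
  have pc := HT' _ Tp.
  have half : p%:R * g p <= 2 * ((p - p./2)%:R * g p).
    rewrite mulrA ler_wpM2r ?(ltW (gp0 _))// -natrM ler_nat mulnBr !mul2n.
    have hp : ((p./2).*2 <= p)%N by rewrite -{2}[p]odd_double_half leq_addl.
    have hp2 : ((p./2).*2 <= p.*2)%N by rewrite (leq_trans hp)// -addnn leq_addr.
    by rewrite leq_subRL// -[p.*2]addnn leq_add2r.
  have : 1 <= c * (elapsed g p - elapsed g p./2).
    have h1 : c^-1 <= elapsed g p - elapsed g p./2 by rewrite /g in mass half *; lra.
    by rewrite -(ler_pM2l c0) mulfV ?gt_eqF// in h1.
  set y := c * _ => y1.
  rewrite mulNr -/y expRN lef_pV2 ?posrE ?expR_gt0//.
  apply: le_trans (expR_ge1Dx _); lra.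
exists c, (Num.max 2 (s 0%N / s p0)); split => //; first by rewrite /c; lra.
  by rewrite le_max ler1n.
set C0 := Num.max _ _.
have exp_le1 j p : (j <= p)%N -> expR (- c * (elapsed g p - elapsed g j)) <= 1.
  move=> jp; rewrite -[leRHS]expR0 ler_expR mulNr oppr_le0 mulr_ge0 ?(ltW c0)//.
  by rewrite subr_ge0 elapsed_le// => i; exact: ltW.
move=> j p; elim/ltn_ind: p => p IH jp; rewrite -/g -/(s j) -/(s p).
have sj1 k : (j <= k)%N -> s j * expR (- c * (elapsed g k - elapsed g j)) <= s j.
  by move=> jk; rewrite ler_piMr ?exp_le1// (ltW (s0 _)).
have [pp0|p0p] := leqP p p0.
  apply: le_trans (sj1 _ jp) _.
  apply: (@le_trans _ _ (s 0%N / s p0 * s p)); last first.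
    by rewrite ler_wpM2r ?(ltW (s0 _))// le_max lexx orbT.
  apply: (le_trans (s_dec 0%N j isT)).
  by rewrite mulrAC -mulrA ler_peMr ?(ltW (s0 _))// ler_pdivlMr// mul1r s_dec.
have [jh|hj] := leqP p./2 j.
  apply: le_trans (sj1 _ jp) _; apply: le_trans (s_dec _ _ jh) _.
  apply: le_trans (halving _ p0p) _.
  by rewrite ler_wpM2r ?(ltW (s0 _))// le_max lexx.
have hp : (p./2 < p)%N.
  by rewrite ltn_half_double -addnn -[X in (X < _)%N]add0n ltn_add2r (leq_trans _ p0p).
have {}IH := IH _ hp (ltnW hj); rewrite -/g -/(s j) -/(s _) in IH.
have -> : - c * (elapsed g p - elapsed g j) =
  - c * (elapsed g p - elapsed g p./2) + - c * (elapsed g p./2 - elapsed g j) by ring.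
rewrite expRD mulrCA.
have C00 : 0 <= C0 by rewrite le_max ler0n.
apply: (@le_trans _ _ (2^-1 * (C0 * s p./2))).
  by apply: ler_pM; rewrite ?expR_ge0 ?decay// mulr_ge0 ?expR_ge0// (ltW (s0 _)).
apply: (@le_trans _ _ (2^-1 * (C0 * (2 * s p)))).
  by rewrite !ler_wpM2l ?halving.
have -> // : 2^-1 * (C0 * (2 * s p)) = C0 * s p by field.
Qed.

Lemma HS_slow (lambda : R) : 0 < lambda -> HS gamma lambda ->
  exists c C0 : R, [/\ 0 < c, c < lambda, 1 <= C0 &
    slow (fun p => gamma p%:R) c C0 (fun p => Num.sqrt (gamma p%:R))].
Proof.
move=> l0 [gam0 gam_dec _ [[rho /andP[_ rho1] rv]|[gamma0 lg gamE]]].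
  exact: slow_regular_variation rho1 gam0 gam_dec rv.
exact: slow_hyperbolic l0 gam0 gam_dec lg gamE.
Qed.

End steps.

(** * Euclidean norm, lowest eigenvalue and mean values *)

Section euclidean.
Context {R : realType}.

Lemma cvg_sumr {T I : Type} {F : set_system T} {FF : Filter F} (r : seq I)
    (f : I -> T -> R) (l : I -> R) :
  (forall i, f i x @[x --> F] --> l i) ->
  (\sum_(i <- r) f i x) @[x --> F] --> \sum_(i <- r) l i.
Proof.
move=> fl; elim: r => [|i r IH].
  by under eq_fun do rewrite big_nil; rewrite big_nil; exact: cvg_cst.
under eq_fun do rewrite big_cons; rewrite big_cons.
exact: (cvgD (fl i) IH).
Qed.

Definition dot {d} (x y : 'rV[R]_d) : R := \sum_(i < d) x 0 i * y 0 i.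

Section dot.
Context {d : nat}.
Implicit Types x y z : 'rV[R]_d.

Lemma dotC x y : dot x y = dot y x.
Proof. by apply: eq_bigr => i _; rewrite mulrC. Qed.

Lemma dotDl x y z : dot (x + y) z = dot x z + dot y z.
Proof. by rewrite /dot -big_split; apply: eq_bigr => i _; rewrite mxE mulrDl. Qed.

Lemma dotZl a x y : dot (a *: x) y = a * dot x y.
Proof. by rewrite /dot mulr_sumr; apply: eq_bigr => i _; rewrite mxE mulrA. Qed.

Lemma dotDr x y z : dot z (x + y) = dot z x + dot z y.
Proof. by rewrite dotC dotDl ![dot z _]dotC. Qed.

Lemma dotZr a x y : dot y (a *: x) = a * dot y x.
Proof. by rewrite dotC dotZl dotC. Qed.

Lemma dotNl x y : dot (- x) y = - dot x y.
Proof. by rewrite -scaleN1r dotZl mulN1r. Qed.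

Lemma dotNr x y : dot y (- x) = - dot y x.
Proof. by rewrite dotC dotNl dotC. Qed.

Lemma dotBl x y z : dot (x - y) z = dot x z - dot y z.
Proof. by rewrite dotDl dotNl. Qed.

Lemma dotBr x y z : dot z (x - y) = dot z x - dot z y.
Proof. by rewrite dotDr dotNr. Qed.

Lemma dotxx_ge0 x : 0 <= dot x x.
Proof. by apply: sumr_ge0 => i _; rewrite -expr2 sqr_ge0. Qed.

Lemma enormE x : enorm x = Num.sqrt (dot x x).
Proof. by congr Num.sqrt; apply: eq_bigr => i _; rewrite expr2. Qed.

Lemma enorm_sqr x : enorm x ^+ 2 = dot x x.
Proof. by rewrite enormE sqr_sqrtr ?dotxx_ge0. Qed.

Lemma enorm_ge0 x : 0 <= enorm x.
Proof. exact: sqrtr_ge0. Qed.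

Lemma coord_le_enorm x i : `|x 0 i| <= enorm x.
Proof.
rewrite -sqrtr_sqr enormE ler_sqrt ?dotxx_ge0// /dot (bigD1 i)//= expr2 lerDl.
by apply: sumr_ge0 => j _; rewrite -expr2 sqr_ge0.
Qed.

Lemma enorm_eq0 x : enorm x = 0 -> x = 0.
Proof.
move=> x0; apply/rowP => i; rewrite mxE; apply/eqP; rewrite -normr_le0 -x0.
exact: coord_le_enorm.
Qed.

Lemma dotx0 x : dot x 0 = 0.
Proof. by rewrite -(scale0r (0 : 'rV_d)) dotZr mul0r. Qed.

Lemma dot0x x : dot 0 x = 0.
Proof. by rewrite dotC dotx0. Qed.

Lemma enorm0 : enorm (0 : 'rV[R]_d) = 0.
Proof. by rewrite enormE dotx0 sqrtr0. Qed.

Lemma cauchy_schwarz x y : dot x y <= enorm x * enorm y.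
Proof.
have [->|x0] := eqVneq x 0; first by rewrite dot0x enorm0 mul0r.
have xx : 0 < dot x x.
  rewrite lt_neqAle dotxx_ge0 andbT eq_sym; apply: contra x0 => /eqP h.
  by apply/eqP/enorm_eq0; rewrite enormE h sqrtr0.
have : 0 <= dot (y - (dot x y / dot x x) *: x) (y - (dot x y / dot x x) *: x) by exact: dotxx_ge0.
rewrite dotBl !dotBr !dotZl !dotZr [dot y x]dotC.
set a := dot x x in xx *; set b := dot x y; set c := dot y y.
have -> : c - b / a * b - (b / a * b - b / a * (b / a * a)) = c - b ^+ 2 / a.
  by field; rewrite gt_eqF.
rewrite subr_ge0 ler_pdivrMr// => h.
apply: le_trans (ler_norm _) _; rewrite -ler_sqr ?nnegrE ?mulr_ge0 ?enorm_ge0//.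
by rewrite real_normK ?num_real// exprMn !enorm_sqr mulrC.
Qed.

Lemma enormD x y : enorm (x + y) <= enorm x + enorm y.
Proof.
rewrite -ler_sqr ?nnegrE ?addr_ge0 ?enorm_ge0// sqrrD !enorm_sqr.
rewrite dotDl !dotDr [dot y x]dotC; have := cauchy_schwarz x y; lra.
Qed.

Lemma enormZ a x : enorm (a *: x) = `|a| * enorm x.
Proof.
by rewrite !enormE dotZl dotZr mulrA -expr2 sqrtrM ?sqr_ge0// sqrtr_sqr.
Qed.

Lemma enormN x : enorm (- x) = enorm x.
Proof. by rewrite -scaleN1r enormZ normrN1 mul1r. Qed.

Lemma enormB x y : enorm (x - y) <= enorm x + enorm y.
Proof. by rewrite -(enormN y) enormD. Qed.

Lemma enorm_dist x y : enorm (x - y) = enorm (y - x).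
Proof. by rewrite -enormN opprB. Qed.

Lemma enorm_sum (I : Type) (r : seq I) (P : pred I) (f : I -> 'rV[R]_d) :
  enorm (\sum_(i <- r | P i) f i) <= \sum_(i <- r | P i) enorm (f i).
Proof.
elim/big_rec2: _ => [|i y x _ h]; first by rewrite enorm0.
by apply: le_trans (enormD _ _) _; rewrite lerD2l.
Qed.

Lemma enorm_le_sum x : enorm x <= \sum_(i < d) `|x 0 i|.
Proof.
have -> : x = \sum_(i < d) x 0 i *: delta_mx 0 i.
  by rewrite [LHS]row_sum_delta.
apply: le_trans (enorm_sum _ _ _) _; apply: ler_sum => i _.
rewrite enormZ summxE (bigD1 i)//= big1 ?addr0; last first.
  by move=> j ji; rewrite !mxE eqxx/= eq_sym (negbTE ji) mulr0.
rewrite !mxE !eqxx mulr1 ler_piMr// enormE /dot (bigD1 i)//= big1 ?addr0.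
  by rewrite mxE !eqxx mulr1 sqrtr1.
by move=> j ji; rewrite mxE eqxx/= (negbTE ji) mulr0.
Qed.

Lemma enorm_le_norm x : enorm x <= d%:R * `|x|.
Proof.
apply: le_trans (enorm_le_sum x) _.
rewrite mulr_natl -[X in _ *+ X]card_ord -sumr_const; apply: ler_sum => i _.
rewrite [leRHS]/Num.Def.normr/= mx_normrE.
by apply: le_trans; last exact: (le_bigmax _ _ (0, i)).
Qed.

Lemma norm_le_enorm x : `|x| <= enorm x.
Proof.
rewrite [leLHS]/Num.Def.normr/= mx_normrE bigmax_le ?enorm_ge0// => -[i j] _.
by rewrite /= (ord1 i) coord_le_enorm.
Qed.

End dot.

(** Dominates the Euclidean operator norm while being continuous in the
    entries. *)
Definition mxsum {m n} (A : 'M[R]_(m, n)) : R := \sum_i \sum_j `|A i j|.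

Lemma mxsum_ge0 m n (A : 'M[R]_(m, n)) : 0 <= mxsum A.
Proof. by apply: sumr_ge0 => i _; apply: sumr_ge0. Qed.

Lemma enorm_mulmx m n (x : 'rV[R]_m) (A : 'M[R]_(m, n)) :
  enorm (x *m A) <= mxsum A * enorm x.
Proof.
apply: le_trans (enorm_le_sum _) _.
rewrite /mxsum exchange_big /= mulr_suml; apply: ler_sum => j _.
rewrite mxE; apply: le_trans (ler_norm_sum _ _ _) _; rewrite mulr_suml.
apply: ler_sum => i _; rewrite normrM mulrC ler_wpM2l//.
exact: coord_le_enorm.
Qed.

Lemma mxsum_le_norm m n (A : 'M[R]_(m, n)) : mxsum A <= (m * n)%:R * `|A|.
Proof.
have h i j : `|A i j| <= `|A|.
  rewrite [leRHS]/Num.Def.normr/= mx_normrE.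
  by apply: le_trans; last exact: (le_bigmax _ _ (i, j)).
rewrite /mxsum (le_trans (ler_sum _ (fun i _ => ler_sum _ (fun j _ => h i j))))//.
by rewrite sumr_const sumr_const !card_ord -mulrnA mulr_natl mulnC.
Qed.

Section lambda_min.
Context {d : nat}.
Implicit Types x y : 'rV[R]_d.

Let continuous_quad (S : 'M[R]_d) : continuous (fun x => dot x (x *m S)).
Proof.
move=> x; apply: (@cvg_sumr _ _ (nbhs x) _) => i; apply: cvgM; first exact: coord_continuous.
rewrite (_ : (fun y : 'rV[R]_d => (y *m S) 0 i) = (fun y => \sum_j y 0 j * S j i)).
  rewrite mxE; apply: (@cvg_sumr _ _ (nbhs x) _) => j; apply: cvgMr_tmp; exact: coord_continuous.
by apply/funext => y; rewrite mxE.
Qed.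

Lemma dot_mulmx_tr x y (S : 'M[R]_d) : dot (x *m S) y = dot x (y *m S^T).
Proof.
rewrite /dot; under eq_bigr do rewrite mxE mulr_suml.
rewrite exchange_big /=; apply: eq_bigr => i _; rewrite mxE mulr_sumr.
by apply: eq_bigr => j _; rewrite mxE mulrAC mulrA.
Qed.

(** On the unit sphere the quadratic form attains its minimum m at some c. Along
    the defect z = c S - m c, the first variation of the form at c is 2 |z|^2, so
    minimality forces z = 0 and m is an eigenvalue. Conversely, every eigenvalue is
    a value of the form on the sphere, so m is the lowest one. *)
Lemma lambda_min_quad (S : 'M[R]_d) x : S^T = S ->
  lambda_min S * dot x x <= dot x (x *m S).
Proof.
move=> symS.
have [->|x0] := eqVneq x 0; first by rewrite mul0mx !dotx0 mulr0.
have unit_dir y : y != 0 -> dot ((enorm y)^-1 *: y) ((enorm y)^-1 *: y) = 1.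
  move=> y0; have ey : enorm y != 0 by apply: contra y0 => /eqP/enorm_eq0 ->.
  by rewrite dotZl dotZr -enorm_sqr; field.
pose K := [set y : 'rV[R]_d | dot y y = 1].
have K0 : K !=set0 by exists ((enorm x)^-1 *: x); exact: unit_dir.
have cK : compact K.
  apply: bounded_closed_compact.
    exists 1; split; first exact: num_real.
    move=> b b1 y Ky; apply: le_trans (norm_le_enorm y) _.
    by rewrite enormE Ky sqrtr1 ltW.
  apply: (@preimage_closed _ _ (fun y : 'rV[R]_d => dot y y) [set 1]).
    move=> y _; have := @continuous_quad 1%:M y.
    by under eq_fun do rewrite mulmx1.
  exact: closed_eq.
have [c cK' cmin] := EVT_min_rV K0 cK (continuous_subspaceT (@continuous_quad S)).
have Kc : dot c c = 1 by move: cK'; rewrite inE.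
set m := dot c (c *m S) in cmin.
have mmin y : m * dot y y <= dot y (y *m S).
  have [->|y0] := eqVneq y 0; first by rewrite mul0mx !dotx0 mulr0.
  have := cmin ((enorm y)^-1 *: y); rewrite inE => /(_ (unit_dir _ y0)).
  have ey : 0 < enorm y.
    rewrite lt_neqAle enorm_ge0 andbT eq_sym.
    by apply: contra y0 => /eqP/enorm_eq0 ->.
  rewrite -scalemxAl dotZl dotZr => h.
  rewrite -enorm_sqr mulrC expr2 -mulrA -!ler_pdivlMl//.
have eig_c : c *m S = m *: c.
  apply/eqP; rewrite -subr_eq0; apply/eqP/enorm_eq0; rewrite enormE.
  set z := c *m S - m *: c.
  have zE : z = c *m S - m *: c by [].
  clearbody z.
  (* minimality of c against c + t z *)
  have Q t : 0 <= 2 * t * dot z z + t ^+ 2 * (dot z (z *m S) - m * dot z z).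
    have := mmin (c + t *: z); rewrite -subr_ge0.
    rewrite mulmxDl -scalemxAl !dotDl !dotDr !dotZl !dotZr -/m.
    have -> : dot c (z *m S) = dot z (c *m S) by rewrite -{1}symS -dot_mulmx_tr dotC.
    have zz : dot z z = dot z (c *m S) - m * dot z c by rewrite {2}zE dotBr dotZr.
    rewrite [dot c z]dotC Kc => h.
    move: h; rewrite (_ : dot z (c *m S) = dot z z + m * dot z c); last by lra.
    move=> {}h; apply: (le_trans h); rewrite le_eqVlt; apply/orP; left.
    by apply/eqP; ring.
  have z0 := dotxx_ge0 z.
  suff : dot z z = 0 by move=> ->; rewrite sqrtr0.
  apply/eqP; rewrite eq_le z0 andbT leNgt; apply/negP => zz.
  set q := dot z (z *m S) - _ in Q.
  have [q0|q0] := leP q 0.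
    have := Q (-1); nra.
  have := Q (- (dot z z / q)).
  have -> : 2 * - (dot z z / q) * dot z z + (- (dot z z / q)) ^+ 2 * q = - (dot z z) ^+ 2 / q.
    by field; rewrite gt_eqF.
  by rewrite mulNr oppr_ge0 leNgt divr_gt0// exprn_gt0.
have lm : lambda_min S <= m.
  apply: ge_inf; last first.
    apply/eigenvalueP; exists c => //; apply: contra_eqN Kc => /eqP ->.
    by rewrite dotx0 eq_sym oner_eq0.
  exists m => a /eigenvalueP[v vS v0].
  have := mmin v; rewrite vS dotZr ler_pM2r//.
  rewrite lt_neqAle dotxx_ge0 andbT eq_sym; apply: contra v0 => /eqP h.
  by apply/eqP/enorm_eq0; rewrite enormE h sqrtr0.
by apply: le_trans (mmin x); rewrite ler_wpM2r ?dotxx_ge0.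
Qed.

(** A matrix and its symmetric part have the same quadratic form. *)
Lemma lambda_min_sym_part (J : 'M[R]_d) x :
  lambda_min (2^-1 *: (J + J^T)) * dot x x <= dot x (x *m J).
Proof.
apply: le_trans (lambda_min_quad x _) _.
  by rewrite linearZ /= linearD /= trmxK addrC.
rewrite -scalemxAr mulmxDr dotZr dotDr.
have -> : dot x (x *m J^T) = dot x (x *m J) by rewrite -dot_mulmx_tr dotC.
lra.
Qed.

End lambda_min.

End euclidean.

Section mean_value.
Context {R : realType} {d : nat}.
Local Notation V := 'rV[R]_d.

Lemma is_derive_dot_line (f : V -> V) (x y u : V) (t : R) :
  differentiable f (x + t *: y) ->
  is_derive t 1 (fun s => dot (f (x + s *: y)) u) (dot (y *m 'J f (x + t *: y)) u).
Proof.
move=> df; set a := x + t *: y in df *.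
have Hd : (fun h => h^-1 *: ((f \o shift a) (h *: y) - f a)) @ 0^' --> y *m 'J f a.
  by rewrite -deriveEjacobian//; exact: diff_derivable.
have Hphi : (fun h => h^-1 *: (((fun s => dot (f (x + s *: y)) u) \o shift t) (h *: 1) -
     dot (f (x + t *: y)) u)) @ 0^' --> dot (y *m 'J f a) u.
  rewrite (_ : (fun h => _) = (fun h : R =>
      \sum_i (h^-1 *: ((f \o shift a) (h *: y) - f a)) 0 i * u 0 i)).
    apply: cvg_sumr => i; apply: cvgMr_tmp.
    exact: (cvg_comp _ _ Hd (@coord_continuous R 1 d 0 i _)).
  apply/funext => h /=; rewrite -dotBl -[LHS]/(h^-1 * _) -dotZl.
  congr (dot (_ *: (f _ - f _)) u).
  by rewrite /shift /= scalerDl /a [h *: 1]mulr1 addrCA.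
split; first by apply/cvg_ex; eexists; exact: Hphi.
exact: cvg_lim Hphi.
Qed.

(** A vector-valued map satisfies a mean value equality only after projection
    on a fixed direction u; the intermediate point depends on u. *)
Lemma mean_value_dot (f : V -> V) (x y u : V) :
  (forall z, differentiable f z) ->
  exists2 c : R, 0 <= c <= 1 &
    dot (f (x + y) - f x) u = dot (y *m 'J f (x + c *: y)) u.
Proof.
move=> df.
have := @MVT_segment R (fun s => dot (f (x + s *: y)) u)
  (fun t => dot (y *m 'J f (x + t *: y)) u) 0 1 ler01.
case.
- by move=> t _; apply: is_derive_dot_line.
- apply: derivable_within_continuous => t _.
  by have [] := @is_derive_dot_line f x y u t (df _).
- move=> c; rewrite in_itv /= => c01; rewrite scale1r scale0r addr0 subr0 mulr1 -dotBl => ->.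
  by exists c.
Qed.

(** The increment is projected on y itself, which turns the Jacobian at the
    intermediate point into a quadratic form. *)
Lemma strong_monotone (f : V -> V) (l : R) :
  (forall z, differentiable f z) ->
  (forall z, l <= lambda_min (2^-1 *: ('J f z + ('J f z)^T))) ->
  forall x y, l * enorm y ^+ 2 <= dot (f (x + y) - f x) y.
Proof.
move=> df lmin x y; have [c _ ->] := mean_value_dot x y y df.
rewrite dotC; apply: le_trans (lambda_min_sym_part _ _).
by rewrite enorm_sqr ler_wpM2r ?dotxx_ge0.
Qed.

Lemma jacobian_lip (f : V -> V) (k : R) :
  (forall z z', `|'J f z - 'J f z'| <= k * `|z - z'|) ->
  forall z z', mxsum ('J f z - 'J f z') <= (d * d)%:R * `|k| * enorm (z - z').
Proof.
move=> lip z z'; apply: le_trans (mxsum_le_norm _) _.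
rewrite -mulrA ler_wpM2l//; apply: le_trans (lip _ _) _.
apply: (@le_trans _ _ (`|k| * `|z - z'|)); first by rewrite ler_wpM2r ?ler_norm.
by rewrite ler_wpM2l// norm_le_enorm.
Qed.

(** The remainder r is projected on itself in the mean value equality:
    |r|^2 is then at most |y (Df(x + c y) - Df(x))| |r|. *)
Lemma quadratic_remainder (f : V -> V) (K : R) :
  (forall z, differentiable f z) -> 0 <= K ->
  (forall z z', mxsum ('J f z - 'J f z') <= K * enorm (z - z')) ->
  forall x y, enorm (f (x + y) - f x - y *m 'J f x) <= K * enorm y ^+ 2.
Proof.
move=> df K0 lip x y; set r := f (x + y) - f x - y *m 'J f x.
have rE : r = f (x + y) - f x - y *m 'J f x by [].
clearbody r.
have [c /andP[c0 c1] Hc] := mean_value_dot x y r df.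
have [r0|r0] := eqVneq (enorm r) 0.
  by rewrite r0 mulr_ge0// exprn_ge0// enorm_ge0.
have er : 0 < enorm r by rewrite lt_neqAle eq_sym r0 enorm_ge0.
have rr : enorm r ^+ 2 = dot (y *m ('J f (x + c *: y) - 'J f x)) r.
  have -> : enorm r ^+ 2 = dot (f (x + y) - f x) r - dot (y *m 'J f x) r.
    by rewrite -dotBl -rE enorm_sqr.
  by rewrite Hc -dotBl -mulmxBr.
rewrite -(ler_pM2r er) -[leLHS]expr2 rr.
apply: le_trans (cauchy_schwarz _ _) _; rewrite ler_wpM2r ?enorm_ge0//.
apply: le_trans (enorm_mulmx _ _) _.
rewrite expr2 mulrA ler_wpM2r ?enorm_ge0//.
apply: le_trans (lip _ _) _; rewrite [x + _]addrC addrK enormZ ger0_norm//.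
by rewrite ler_wpM2l// ler_piMl// enorm_ge0.
Qed.

(** Expansion of the square. The term in g ^ 2 is absorbed, for small g, by
    lowering the rate l slightly. *)
Lemma euler_step_sqr (A : 'M[R]_d) (l g : R) (y : V) : 0 <= g ->
  l * enorm y ^+ 2 <= dot y (y *m A) ->
  enorm (y - g *: (y *m A)) ^+ 2 <=
    (1 - 2 * l * g + mxsum A ^+ 2 * g ^+ 2) * enorm y ^+ 2.
Proof.
move=> g0 ly.
have h3 : enorm (y *m A) ^+ 2 <= (mxsum A * enorm y) ^+ 2.
  by rewrite ler_sqr ?nnegrE ?mulr_ge0 ?enorm_ge0 ?mxsum_ge0// enorm_mulmx.
have -> : enorm (y - g *: (y *m A)) ^+ 2 = enorm y ^+ 2 -
    2 * g * dot y (y *m A) + g ^+ 2 * enorm (y *m A) ^+ 2.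
  by rewrite !enorm_sqr dotBl !dotBr !dotZl !dotZr [dot (y *m A) y]dotC; ring.
have h4 := ler_wpM2l g0 ly.
have h5 := ler_wpM2l (sqr_ge0 g) h3.
lra.
Qed.

End mean_value.

(** * Measurability of vector-valued maps *)

Section bvec.
Context {R : realType}.

Lemma continuous_bvec_measurable (d : nat) (f : 'rV[R]_d -> R) :
  continuous f -> measurable_fun [set: bvec R d] (f : bvec R d -> R).
Proof.
move=> cf; apply: (measurability _ (@RGenOInfty.measurableE R)) => //.
move=> _ [_ [x ->] <-]; rewrite setTI.
apply: sub_sigma_algebra => /=; exact: open_comp.
Qed.

Lemma measurable_coord (d : nat) (i : 'I_d) :
  measurable_fun [set: bvec R d] (fun x : bvec R d => (x : 'rV[R]_d) 0 i : R).
Proof. by apply: continuous_bvec_measurable; exact: coord_continuous. Qed.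

(** Borel sets are generated by the open sets, and an open set is a countable
    union of boxes with rational centre and radius, whose preimages are finite
    intersections of coordinate events. *)
Lemma measurable_bvec d (T : measurableType d) (k : nat) (f : T -> 'rV[R]_k) :
  (forall i, measurable_fun setT (fun w => f w 0 i)) ->
  measurable_fun setT (f : T -> bvec R k).
Proof.
move=> mf; apply: (@measurability _ _ T (bvec R k) setT f (@open 'rV[R]_k) erefl).
move=> _ [G oG <-]; rewrite setTI.
pose box (c : 'rV[rat]_k * rat) : set 'rV[R]_k :=
  [set x | forall i, `|x 0 i - ratr (c.1 0 i)| < ratr c.2].
have mbox c : measurable (f @^-1` box c).
  have -> : f @^-1` box c =
      \bigcap_(i in [set: 'I_k]) [set w | `|f w 0 i - ratr (c.1 0 i)| < ratr c.2].
    by apply/seteqP; split => [w h i _|w h i]; [exact: h|exact: (h i I)].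
  apply: fin_bigcap_measurable => // i _.
  have mb : measurable_fun setT (fun w => `|f w 0 i - ratr (c.1 0 i)| < ratr c.2).
    apply: measurable_fun_ltr => //; apply: measurableT_comp => //.
    exact: measurable_funB.
  by have := mb measurableT [set true] I; rewrite setTI.
have -> : f @^-1` G = \bigcup_(c in [set c | box c `<=` G]) (f @^-1` box c).
  apply/seteqP; split => w; last by move=> [c cG cw]; exact: cG.
  move=> Gw; have Gfw : G (f w) by [].
  have /nbhs_ballP[e /= e0 eG] : nbhs (f w) G by apply: open_nbhs_nbhs.
  have [r] : exists r : rat, (0 : R) < ratr r < e / 2.
    have /rat_in_itvoo[r] : 0 < e / 2 by rewrite divr_gt0.
    by rewrite in_itv /= => h; exists r.
  move=> /andP[r0 re].
  have /choice[c Hc] : forall i, exists c : rat, `|f w 0 i - ratr c| < ratr r.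
    move=> i; have /rat_in_itvoo[c] : f w 0 i < f w 0 i + ratr r by rewrite ltrDl.
    rewrite in_itv /= => /andP[h1 h2]; exists c.
    by rewrite ltr_distlC h2 andbT ltrBlDr (lt_trans h1)// ltrDl.
  exists (\row_i c i, r) => [y /= Hy|i /=]; last by rewrite mxE.
  apply: eG; split => // j i; rewrite (ord1 j) /ball /=.
  have h1 := Hc i; have := Hy i; rewrite mxE => h2.
  apply: (@le_lt_trans _ _ (`|f w 0 i - ratr (c i)| + `|y 0 i - ratr (c i)|)).
    by rewrite [ `|y 0 i - _|]distrC (le_trans _ (ler_normD _ _))// addrA subrK.
  lra.
rewrite bigcup_mkcond; apply: countable_bigcupT_measurable; first exact: countableP.
by move=> c; case: ifP.
Qed.

Lemma measurable_enorm d (T : measurableType d) (k : nat) (f : T -> 'rV[R]_k) :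
  (forall i, measurable_fun setT (fun w => f w 0 i)) ->
  measurable_fun setT (fun w => enorm (f w)).
Proof.
move=> mf.
have ms : measurable_fun setT (@Num.sqrt R).
  by apply: continuous_measurable_fun; exact: sqrt_continuous.
apply: (measurableT_comp ms).
by apply: measurable_sum => i; apply: measurable_funX.
Qed.

End bvec.

(** * Independence and freezing *)

Section independence.
Context {R : realType} {disp : measure_display} {Omega : measurableType disp}.
Variable P : probability Omega R.

Let preimage_meas {d1} {T1 : measurableType d1} (X : Omega -> T1) A :
  measurable_fun setT X -> measurable A -> measurable (X @^-1` A).
Proof. by move=> mX mA; rewrite -[X in measurable X]setTI; exact: mX. Qed.

(** As functions of S, both sides are measures which on rectangles coincide with
    the product of the law of X and the law of Y scaled by P E; such a measure is
    unique. *)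
Lemma indep_pair_event {d1 d2} {T1 : measurableType d1} {T2 : measurableType d2}
    (X : Omega -> T1) (Y : Omega -> T2) (E : set Omega) :
  measurable_fun setT X -> measurable_fun setT Y -> measurable E ->
  (forall A B, measurable A -> measurable B ->
     P (X @^-1` A `&` Y @^-1` B) = (P (X @^-1` A) * P (Y @^-1` B))%E) ->
  (forall A B, measurable A -> measurable B ->
     P (X @^-1` A `&` (Y @^-1` B `&` E)) = (P (X @^-1` A) * P (Y @^-1` B) * P E)%E) ->
  forall S : set (T1 * T2), measurable S ->
    P ((fun w => (X w, Y w)) @^-1` S `&` E) =
    (P ((fun w => (X w, Y w)) @^-1` S) * P E)%E.
Proof.
move=> mX mY mE XY XYE S mS.
pose e : {nonneg R} := NngNum (fine_ge0 (measure_ge0 P E)).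
have eE : e%:num%:E = P E by rewrite /= fineK// fin_num_measure.
pose X' : {RV P >-> T1} := HB.pack X (isMeasurableFun.Build _ _ _ _ X mX).
pose Y' : {RV P >-> T2} := HB.pack Y (isMeasurableFun.Build _ _ _ _ Y mY).
pose XYf w := (X w, Y w).
have mXY : measurable_fun setT XYf by exact: measurable_fun_pair.
pose XY' : {RV P >-> (T1 * T2)%type} :=
  HB.pack XYf (isMeasurableFun.Build _ _ _ _ XYf mXY).
have H1 := @product_measure_unique _ _ T1 T2 R (distribution P X')
  (mscale e (distribution P Y')) (pushforward (mrestr P mE) XY').
have H2 := @product_measure_unique _ _ T1 T2 R (distribution P X')
  (mscale e (distribution P Y')) (mscale e (distribution P XY')).
transitivity (pushforward (mrestr P mE) XY' S); first by [].
rewrite -H1//; last first.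
  move=> A B mA mB; rewrite /= /mscale /pushforward /mrestr /distribution.
  rewrite [e%:num%:E]eE.
  have -> : XY' @^-1` (A `*` B) `&` E = X @^-1` A `&` (Y @^-1` B `&` E).
    by rewrite setIA; congr (_ `&` _); apply/seteqP; split.
  by rewrite XYE// [(P E * _)%E]muleC muleA.
rewrite H2//; last first.
  move=> A B mA mB.
  change ((e%:num%:E * P (X @^-1` A `&` Y @^-1` B)) =
    (P (X @^-1` A) * (e%:num%:E * P (Y @^-1` B))))%E.
  by rewrite XY// muleCA.
by rewrite /= /mscale [e%:num%:E]eE muleC.
Qed.

(** By uniqueness of the product measure, the joint law of X and Y is the
    product of their laws, and Tonelli's theorem integrates Y first. *)
Lemma indep_freeze {d1 d2} {T1 : measurableType d1} {T2 : measurableType d2}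
    (X : Omega -> T1) (Y : Omega -> T2) (F : T1 * T2 -> R) :
  measurable_fun setT X -> measurable_fun setT Y ->
  indep P X Y -> measurable_fun setT F -> (forall z, 0 <= F z) ->
  (\int[P]_w (F (X w, Y w))%:E = \int[P]_w \int[P]_w' (F (X w, Y w'))%:E)%E.
Proof.
move=> mX mY XY mF F0.
pose X' : {RV P >-> T1} := HB.pack X (isMeasurableFun.Build _ _ _ _ X mX).
pose Y' : {RV P >-> T2} := HB.pack Y (isMeasurableFun.Build _ _ _ _ Y mY).
pose XYf w := (X w, Y w).
have mXY : measurable_fun setT XYf by exact: measurable_fun_pair.
pose XY' : {RV P >-> (T1 * T2)%type} :=
  HB.pack XYf (isMeasurableFun.Build _ _ _ _ XYf mXY).
have H1 := @product_measure_unique _ _ T1 T2 R (distribution P X')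
  (distribution P Y') (distribution P XY').
have mEF : measurable_fun setT (EFin \o F) by exact/measurable_EFinP.
transitivity (\int[distribution P XY']_z (F z)%:E)%E.
  by rewrite ge0_integral_distribution// => z; rewrite lee_fin.
transitivity (\int[(distribution P X' \x distribution P Y')%E]_z (F z)%:E)%E.
  apply: eq_measure_integral => S mS _; by apply/esym; apply: H1.
rewrite (fubini_tonelli1 (EFin \o F))//=.
rewrite ge0_integral_distribution//; last 2 first.
- exact: measurable_fun_fubini_tonelli_F.
- by move=> y; apply: integral_ge0 => z _; rewrite lee_fin.
apply: eq_integral => w _ /=; rewrite /fubini_F ge0_integral_distribution//.
  by apply: measurableT_comp => //; exact: pair1_measurable.
by move=> z; rewrite lee_fin.
Qed.

(** The induction carries a stronger property: an event on S p factors from the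
    events on all the innovations of ranks p + 1 to M taken together. One step of
    the chain merges S p and the next innovation into a pair, which is independent
    of the later ones because the three are jointly independent. *)
Lemma chain_indep {d1 d2} {T1 : measurableType d1} {T2 : measurableType d2}
    (S : nat -> Omega -> T1) (V : nat -> Omega -> T2)
    (Phi : nat -> T1 * T2 -> T1) (M : nat) :
  measurable_fun setT (S 0%N) ->
  (forall p, (0 < p <= M)%N -> measurable_fun setT (V p)) ->
  (forall p, measurable_fun setT (Phi p)) ->
  (forall p w, S p.+1 w = Phi p (S p w, V p.+1 w)) ->
  (forall A (D : nat -> set T2), measurable A -> (forall p, measurable (D p)) ->
    P (S 0%N @^-1` A `&` \bigcap_(p in [set p | (0 < p <= M)%N]) (V p @^-1` D p)) =
    (P (S 0%N @^-1` A) * \prod_(1 <= p < M.+1) P (V p @^-1` D p))%E) ->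
  forall p, (p < M)%N ->
    measurable_fun setT (S p) /\ indep P (S p) (V p.+1).
Proof.
move=> mS0 mV mPhi SE ind0.
pose I (p : nat) (D : nat -> set T2) :=
  \bigcap_(k in [set k | (p < k <= M)%N]) (V k @^-1` D k).
have mI p D : (forall p, measurable (D p)) -> measurable (I p D).
  move=> mD; apply: fin_bigcap_measurable.
    by apply: sub_finite_set (finite_II M.+1) => k /= /andP[_]; rewrite ltnS.
  move=> k /= /andP[pk kM]; apply: preimage_meas => //; apply: mV.
  by rewrite (leq_trans _ pk).
have IS p D : (p < M)%N -> I p D = V p.+1 @^-1` D p.+1 `&` I p.+1 D.
  move=> pM; apply/seteqP; split => [w Iw|w [V1 Iw] k /= /andP[]].
    split; first by apply: Iw; rewrite /= ltnSn.
    by move=> k /= /andP[pk kM]; apply: Iw; rewrite /= kM (ltnW pk).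
  by rewrite leq_eqVlt => /predU1P[<- //|pk] kM; apply: Iw; rewrite /= pk.
have I_indep p : (p <= M)%N -> measurable_fun setT (S p) /\
    forall A D, measurable A -> (forall p, measurable (D p)) ->
    P (S p @^-1` A `&` I p D) =
    (P (S p @^-1` A) * \prod_(p.+1 <= k < M.+1) P (V k @^-1` D k))%E.
  elim: p => [|p IH] pM.
    by split => // A D mA mD; exact: ind0.
  have [mS indp] := IH (ltnW pM).
  have mV1 : measurable_fun setT (V p.+1) by apply: mV.
  have indV B D : measurable B -> (forall p, measurable (D p)) ->
    P (V p.+1 @^-1` B `&` I p.+1 D) =
    (P (V p.+1 @^-1` B) * \prod_(p.+2 <= k < M.+1) P (V k @^-1` D k))%E.
    move=> mB mD.
    have := indp setT (fun k => if k == p.+1 then B else D k) measurableT.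
    rewrite preimage_setT setTI probability_setT mul1e IS// eqxx big_ltn// eqxx.
    have -> : I p.+1 (fun k => if k == p.+1 then B else D k) = I p.+1 D.
      by apply: eq_bigcapr => k /= /andP[pk _]; rewrite gtn_eqF.
    move=> ->; last by move=> k; case: ifP.
    by congr (_ * _)%E; apply: eq_big_nat => k /andP[pk _]; rewrite gtn_eqF.
  have indI D : (forall p, measurable (D p)) ->
    P (I p.+1 D) = (\prod_(p.+2 <= k < M.+1) P (V k @^-1` D k))%E.
    move=> mD; have := indV setT D measurableT mD.
    by rewrite preimage_setT setTI probability_setT mul1e.
  have indSV A B D : measurable A -> measurable B -> (forall p, measurable (D p)) ->
    P (S p @^-1` A `&` (V p.+1 @^-1` B `&` I p.+1 D)) =
    (P (S p @^-1` A) * P (V p.+1 @^-1` B) * P (I p.+1 D))%E.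
    move=> mA mB mD.
    have := indp A (fun k => if k == p.+1 then B else D k) mA.
    rewrite IS// eqxx big_ltn// eqxx.
    have -> : I p.+1 (fun k => if k == p.+1 then B else D k) = I p.+1 D.
      by apply: eq_bigcapr => k /= /andP[pk _]; rewrite gtn_eqF.
    move=> ->; last by move=> k; case: ifP.
    rewrite indI// muleA; congr (_ * _)%E; apply: eq_big_nat => k /andP[pk _].
    by rewrite gtn_eqF.
  have IT : I p.+1 (fun=> setT) = setT by apply/seteqP; split.
  have indS A B : measurable A -> measurable B ->
    P (S p @^-1` A `&` V p.+1 @^-1` B) = (P (S p @^-1` A) * P (V p.+1 @^-1` B))%E.
    move=> mA mB; have := indSV A B (fun=> setT) mA mB (fun=> measurableT).
    by rewrite IT setIT probability_setT mule1.
  have SpE : S p.+1 = Phi p \o (fun w => (S p w, V p.+1 w)).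
    by apply/funext => w; rewrite SE.
  split.
    rewrite SpE; apply: measurableT_comp => //; exact: measurable_fun_pair.
  move=> A D mA mD; rewrite -indI// SpE comp_preimage.
  apply: indep_pair_event => //.
  - exact: mI.
  - by move=> A' B mA' mB; exact: indSV.
  - by rewrite -[X in measurable X]setTI; exact: mPhi.
move=> p pM; have [mS indp] := I_indep p (ltnW pM); split => // A B mA mB.
have := indp A (fun k => if k == p.+1 then B else setT) mA.
rewrite IS// eqxx big_ltn// eqxx.
have -> : I p.+1 (fun k => if k == p.+1 then B else setT) = setT.
  apply/seteqP; split => // w _ k /= /andP[pk _]; by rewrite gtn_eqF.
rewrite setIT => ->; last by move=> k; case: ifP.
rewrite big_nat big1 ?mule1// => k /andP[pk _]; rewrite gtn_eqF//.
by rewrite preimage_setT probability_setT.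
Qed.

End independence.

Section innovations.
Context {R : realType} {disp : measure_display} {Omega : measurableType disp}.
Variable P : probability Omega R.

Lemma measurable_joint {d1} {T1 : measurableType d1} n (X : 'I_n -> Omega -> T1) :
  (forall i, measurable_fun setT (X i)) -> measurable_fun setT (joint X).
Proof.
move=> mX; apply/measurable_fun_tnthP => i.
rewrite (_ : _ \o _ = X i)//; apply/funext => w /=; exact: tnth_mktuple.
Qed.

Lemma same_law_integral {d1} {T1 : measurableType d1} (X Y : Omega -> T1)
    (F : T1 -> \bar R) :
  measurable_fun setT X -> measurable_fun setT Y -> same_law P X Y ->
  measurable_fun setT F -> (forall z, (0 <= F z)%E) ->
  (\int[P]_w F (X w) = \int[P]_w F (Y w))%E.
Proof.
move=> mX mY XY mF F0.
pose X' : {RV P >-> T1} := HB.pack X (isMeasurableFun.Build _ _ _ _ X mX).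
pose Y' : {RV P >-> T1} := HB.pack Y (isMeasurableFun.Build _ _ _ _ Y mY).
transitivity (\int[distribution P X']_z F z)%E.
  by rewrite ge0_integral_distribution.
transitivity (\int[distribution P Y']_z F z)%E.
  by apply: eq_measure_integral => A mA _; exact: XY.
by rewrite ge0_integral_distribution.
Qed.

(** Provides the factorization from which chain_indep starts: an intersection of
    events on the separate innovations is an event on the joint innovation, to
    which independence from the initial state applies, and mutual independence then
    splits its probability. *)
Lemma chain_initial {d0 d1 d2} {T0 : measurableType d0} {T1 : measurableType d1}
    {T2 : measurableType d2} (W0 : Omega -> T0) (f : T0 -> T1)
    (V : nat -> Omega -> T2) (M : nat) :
  measurable_fun setT W0 -> measurable_fun setT f ->
  (forall p, (0 < p <= M)%N -> measurable_fun setT (V p)) ->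
  mutual_indep P [set p | (0 < p <= M)%N] V ->
  indep P W0 (joint (fun p : 'I_M => V p.+1)) ->
  forall A (D : nat -> set T2), measurable A -> (forall p, measurable (D p)) ->
    P ((f \o W0) @^-1` A `&` \bigcap_(p in [set p | (0 < p <= M)%N]) (V p @^-1` D p)) =
    (P ((f \o W0) @^-1` A) * \prod_(1 <= p < M.+1) P (V p @^-1` D p))%E.
Proof.
move=> mW mf mV indV indW A D mA mD.
pose B : set (M.-tuple T2) := \bigcap_(i in [set: 'I_M]) (fun v => tnth v i) @^-1` D i.+1.
have mB : measurable B.
  apply: fin_bigcap_measurable => // i _; rewrite -[X in measurable X]setTI.
  exact: measurable_tnth.
have -> : \bigcap_(p in [set p | (0 < p <= M)%N]) (V p @^-1` D p) =
    joint (fun p : 'I_M => V p.+1) @^-1` B.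
  apply/seteqP; split => [w Iw i _|w Bw [//|p] /= pM].
    by rewrite /= tnth_mktuple; apply: Iw => /=.
  by have := Bw (Ordinal pM) I; rewrite /= tnth_mktuple.
rewrite comp_preimage indW//; last first.
  by rewrite -[X in measurable X]setTI; exact: mf.
congr (_ * _)%E.
pose J : {fset nat} := [fset p in index_iota 1 M.+1]%fset.
have JE p : (p \in J) = (0 < p <= M)%N.
  by rewrite inE mem_index_iota ltnS.
have := indV J _ D _.
have -> : \bigcap_(p in [set` J]) (V p @^-1` D p) =
    joint (fun p : 'I_M => V p.+1) @^-1` B.
  apply/seteqP; split => [w Iw i _|w Bw [|p] /=]; rewrite /= ?JE//.
    by rewrite tnth_mktuple; apply: Iw => /=; rewrite JE/=.
  by move=> pM; have := Bw (Ordinal pM) I; rewrite /= tnth_mktuple.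
move=> ->; last 2 first.
- by move=> p /=; rewrite JE.
- by [].
apply: perm_big; apply: uniq_perm; rewrite ?iota_uniq ?fset_uniq//.
by move=> p; rewrite JE mem_index_iota ltnS.
Qed.

End innovations.

(** * Bounded means and convergence in probability *)

Section mean_le.
Context {R : realType} {disp : measure_display} {Omega : measurableType disp}.
Variable P : probability Omega R.
Implicit Types f g : Omega -> R.

(** Measurability and nonnegativity are bundled with the bound, so that bounds on
    means can be added, scaled and compared without side conditions on
    integrals. *)
Definition mean_le f (c : R) : Prop :=
  [/\ measurable_fun setT f, forall w, 0 <= f w & (\int[P]_w (f w)%:E <= c%:E)%E].

Lemma mean_le_mono f g c : measurable_fun setT f -> (forall w, 0 <= f w) ->
  (forall w, f w <= g w) -> mean_le g c -> mean_le f c.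
Proof.
move=> mf f0 fg [mg g0 gc]; split => //; apply: le_trans gc.
apply: ge0_le_integral => //.
- by move=> w _; rewrite lee_fin.
- exact/measurable_EFinP.
- exact/measurable_EFinP.
- by move=> w _; rewrite lee_fin.
Qed.

Lemma mean_le_trans f c e : c <= e -> mean_le f c -> mean_le f e.
Proof. by move=> ce [? ? fc]; split => //; apply: le_trans fc _; rewrite lee_fin. Qed.

Lemma mean_leD f g c e : mean_le f c -> mean_le g e ->
  mean_le (fun w => f w + g w) (c + e).
Proof.
move=> [mf f0 fc] [mg g0 ge]; split.
- exact: measurable_funD.
- by move=> w; rewrite addr_ge0.
under eq_integral do rewrite EFinD.
rewrite ge0_integralD//; first by rewrite EFinD leeD.
- by move=> w _; rewrite lee_fin.
- exact/measurable_EFinP.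
- by move=> w _; rewrite lee_fin.
- exact/measurable_EFinP.
Qed.

Lemma mean_leZ a f c : 0 <= a -> mean_le f c -> mean_le (fun w => a * f w) (a * c).
Proof.
move=> a0 [mf f0 fc]; split.
- exact: measurable_funM.
- by move=> w; rewrite mulr_ge0.
under eq_integral do rewrite EFinM.
rewrite ge0_integralZl_EFin//; first by rewrite EFinM lee_wpmul2l// lee_fin.
- by move=> w _; rewrite lee_fin.
- exact/measurable_EFinP.
Qed.

Lemma mean_le_cst c : 0 <= c -> mean_le (fun=> c) c.
Proof.
move=> c0; split => //.
by have := expectation_cst P c; rewrite unlock => ->.
Qed.

Lemma mean_le_sum (I : Type) (r : seq I) (f : I -> Omega -> R) (c : I -> R) :
  (forall i, mean_le (f i) (c i)) ->
  mean_le (fun w => \sum_(i <- r) f i w) (\sum_(i <- r) c i).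
Proof.
move=> fc; elim: r => [|i r IH].
  rewrite (_ : (fun w => _) = (fun=> 0)).
    by rewrite big_nil; exact: mean_le_cst.
  by apply/funext => w; rewrite big_nil.
rewrite (_ : (fun w => _) = (fun w => f i w + \sum_(j <- r) f j w)).
  by rewrite big_cons; exact: mean_leD.
by apply/funext => w; rewrite big_cons.
Qed.

Lemma mean_le_indic (A : set Omega) c : measurable A -> (P A <= c%:E)%E ->
  mean_le (\1_A) c.
Proof.
move=> mA PA; split; first exact: measurable_indic.
  by move=> w; rewrite indicE.
by rewrite integral_indic// setIT.
Qed.

End mean_le.

Section continuous_mapping.
Context {R : realType} {disp : measure_display} {Omega : measurableType disp}.
Variable P : probability Omega R.

Lemma cvg_in_proba_mean_le (k : nat) (X : nat -> Omega -> 'rV[R]_k) (Y : Omega -> 'rV[R]_k) :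
  (forall n i, measurable_fun setT (fun w => X n w 0 i)) ->
  (forall i, measurable_fun setT (fun w => Y w 0 i)) ->
  cvg_in_proba P X Y ->
  forall eps eta : R, 0 < eps -> 0 < eta -> exists N, forall n, (N <= n)%N ->
    mean_le P (\1_[set w | eps <= enorm (X n w - Y w)]) eta.
Proof.
move=> mX mY XY eps eta eps0 eta0.
have mA n : measurable [set w | eps <= enorm (X n w - Y w)].
  have mb : measurable_fun setT (fun w => eps <= enorm (X n w - Y w)).
    apply: measurable_fun_ler => //.
    apply: measurable_enorm => i; under eq_fun do rewrite !mxE.
    exact: measurable_funB.
  by have := mb measurableT [set true] I; rewrite setTI.
have /fine_cvgP[fin /cvgrPdist_le/(_ _ eta0)] := XY eps eps0.
move=> h; have [N _ HN] := filterI fin h.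
exists N => n Nn; have [/= h1 h2] := HN n Nn.
apply: mean_le_indic => //; rewrite -(fineK h1) lee_fin.
by move: h2; rewrite sub0r normrN ger0_norm// fine_ge0.
Qed.

Section oscillation.
Context {q d : nat}.
Variable G : 'rV[R]_q -> 'rV[R]_d.

(** Both y and z are free near x, rather than one of them being x: this makes the
    set open for an arbitrary G, hence Borel. *)
Definition oscillating (e : R) (k : nat) : set 'rV[R]_q :=
  [set x | exists y z, [/\ `|x - y| < k.+1%:R^-1, `|x - z| < k.+1%:R^-1 &
                          e <= enorm (G y - G z)]].

Lemma oscillating_open e k : open (oscillating e k).
Proof.
rewrite openE => x [y [z [xy xz eyz]]]; apply/nbhs_ballP.
exists (Num.min (k.+1%:R^-1 - `|x - y|) (k.+1%:R^-1 - `|x - z|)) => /=.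
  by rewrite lt_min !subr_gt0 xy xz.
move=> t; rewrite -ball_normE /= lt_min => /andP[ty tz].
exists y, z; split => //.
  have h : `|x - t| + `|x - y| < k.+1%:R^-1 by rewrite -ltrBrDr.
  apply: le_lt_trans h.
  by rewrite [ `|x - t|]distrC (le_trans _ (ler_normD _ _))// addrA subrK.
have h : `|x - t| + `|x - z| < k.+1%:R^-1 by rewrite -ltrBrDr.
apply: le_lt_trans h.
by rewrite [ `|x - t|]distrC (le_trans _ (ler_normD _ _))// addrA subrK.
Qed.

Lemma oscillating_decr e : nonincreasing_seq (oscillating e).
Proof.
move=> k l kl; apply/subsetPset => x [y [z [xy xz eyz]]].
have h : (l.+1%:R^-1 : R) <= k.+1%:R^-1 by rewrite lef_pV2 ?posrE// ler_nat.
by exists y, z; split => //; apply: lt_le_trans h.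
Qed.

(** The right-hand side is built from open sets, so discontinuity sets are Borel.
    Continuity refers to the sup norm and oscillation to the Euclidean norm, whence
    the factor d in the proof. *)
Lemma discontinuity_oscillating :
  [set x | ~ {for x, continuous G}] =
  \bigcup_j \bigcap_k oscillating j.+1%:R^-1 k.
Proof.
apply/seteqP; split => [x|x [j _ osc] cG].
  apply: contra_notP => /= nosc; apply/(@cvgrPdist_lt _ _ _ (nbhs x)) => eps eps0.
  have d0 : 0 < eps / 2 by rewrite divr_gt0.
  pose j := Num.bound (eps / 2)^-1.
  have jeps : (j.+1%:R^-1 : R) <= eps / 2.
    rewrite -[leRHS]invrK lef_pV2 ?posrE ?invr_gt0//.
    apply: le_trans (ltW (archi_boundP _)) _; first by rewrite invr_ge0 ltW.
    by rewrite ler_nat.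
  have : ~ (\bigcap_k oscillating j.+1%:R^-1 k) x by move=> h; apply: nosc; exists j.
  rewrite /bigcap /= => /existsNP[k /not_implyP[_ nk]].
  apply/nbhs_ballP; exists k.+1%:R^-1 => /=; first by rewrite invr_gt0.
  move=> y; rewrite -ball_normE /= => xy.
  apply: le_lt_trans (norm_le_enorm _) _.
  rewrite ltNge; apply/negP => h; apply: nk; exists x, y; split => //.
    by rewrite subrr normr0 invr_gt0.
  apply: le_trans jeps _; apply: le_trans h.
  by rewrite ler_pdivrMr// ler_peMr ?ler1n// ltW.
set e : R := j.+1%:R^-1 in osc; have e0 : 0 < e by rewrite invr_gt0.
pose e' := e / (4 * (d%:R + 1)).
have d1 : 0 < (d%:R + 1 : R) by rewrite ltr_wpDl.
have e'0 : 0 < e' by rewrite divr_gt0// mulr_gt0.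
have /(@cvgrPdist_lt _ _ _ (nbhs x))/(_ _ e'0)/nbhs_ballP[r /= r0 Hr] := cG.
pose k := Num.bound r^-1.
have kr : (k.+1%:R^-1 : R) <= r.
  rewrite -[leRHS]invrK lef_pV2 ?posrE ?invr_gt0//.
  apply: le_trans (ltW (archi_boundP _)) _; first by rewrite invr_ge0 ltW.
  by rewrite ler_nat.
have [y [z [xy xz]]] := osc k I.
have close t : `|x - t| < k.+1%:R^-1 -> enorm (G x - G t) <= d%:R * e'.
  move=> xt; apply: le_trans (enorm_le_norm _) _; rewrite ler_wpM2l// ltW//.
  by apply: Hr; rewrite -ball_normE /=; apply: lt_le_trans kr.
apply/negP; rewrite -ltNge.
have -> : G y - G z = (G x - G z) - (G x - G y) by rewrite opprB [RHS]addrC addrA subrK.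
apply: le_lt_trans (enormB _ _) _.
have := close _ xy; have := close _ xz.
have : d%:R * e' <= e / 4.
  have -> : e / 4 = (d%:R + 1) * e' by rewrite /e'; field; rewrite gt_eqF.
  by rewrite ler_wpM2r ?(ltW e'0)// lerDl.
lra.
Qed.

Lemma measurable_oscillating e k :
  measurable (oscillating e k : set (bvec R q)).
Proof. by apply: sub_sigma_algebra; exact: oscillating_open. Qed.

Lemma measurable_discontinuity :
  measurable ([set x | ~ {for x, continuous G}] : set (bvec R q)).
Proof.
rewrite discontinuity_oscillating; apply: bigcupT_measurable => j.
by apply: bigcapT_measurable => k; exact: measurable_oscillating.
Qed.

(** The events that G oscillates by eps near Y at scale 1 / (k + 1) decrease with
    k to an event where G is discontinuous at Y, of probability zero; so one of
    them has a small probability. Off that event, G (X n) and G Y differ by eps only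
    if X n and Y are at distance at least 1 / (k + 1). *)
Lemma continuous_mapping (X : nat -> {RV P >-> bvec R q}) (Y : {RV P >-> bvec R q}) :
  measurable_fun [set: bvec R q] (G : bvec R q -> bvec R d) ->
  P [set w | ~ {for Y w, continuous G}] = 0%E ->
  cvg_in_proba P X Y ->
  forall eps eta : R, 0 < eps -> 0 < eta -> exists N, forall n, (N <= n)%N ->
    mean_le P (\1_[set w | eps <= enorm (G (X n w) - G (Y w))]) eta.
Proof.
move=> mG Y0 XY eps eta eps0 eta0.
have eta20 : 0 < eta / 2 by rewrite divr_gt0.
have mcoord (Z : {RV P >-> bvec R q}) i : measurable_fun setT (fun w => (Z w : 'rV_q) 0 i).
  apply: (@measurableT_comp _ _ _ _ _ _ (fun x : bvec R q => (x : 'rV_q) 0 i)) => //.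
  exact: measurable_coord.
have mGcoord (Z : {RV P >-> bvec R q}) i : measurable_fun setT (fun w => G (Z w) 0 i).
  apply: (@measurableT_comp _ _ _ _ _ _ (fun x : bvec R d => (x : 'rV_d) 0 i)) => //.
    exact: measurable_coord.
  by apply: measurableT_comp.
have mpre (A : set (bvec R q)) : measurable A -> measurable (Y @^-1` A).
  have mY : measurable_fun setT Y by [].
  by move=> mA; rewrite -[X in measurable X]setTI; exact: mY.
pose B k := Y @^-1` oscillating eps k.
have mB k : measurable (B k).
  by apply: mpre; exact: measurable_oscillating.
have PB0 : P (\bigcap_k B k) = 0%E.
  apply/eqP; rewrite eq_le measure_ge0 andbT -Y0; apply: le_measure; rewrite ?inE.
  - exact: bigcapT_measurable.
  - by apply: (mpre [set x | ~ {for x, continuous G}]); exact: measurable_discontinuity.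
  - move=> w Bw /=.
    have : [set x | ~ {for x, continuous G}] (Y w); last by [].
    rewrite discontinuity_oscillating.
    have [j jeps] : exists j : nat, (j.+1%:R^-1 : R) <= eps.
      exists (Num.bound eps^-1).
      rewrite -[leRHS]invrK lef_pV2 ?posrE ?invr_gt0//.
      apply: le_trans (ltW (archi_boundP _)) _; first by rewrite invr_ge0 ltW.
      by rewrite ler_nat.
    exists j => // k _; have [y [z [h1 h2 h3]]] := Bw k I.
    by exists y, z; split => //; apply: le_trans jeps h3.
have Bcvg : P \o B @ \oo --> 0%E.
  rewrite -PB0; apply: nonincreasing_cvg_mu => //.
  - by rewrite (le_lt_trans (probability_le1 _ _))// ltry.
  - exact: bigcapT_measurable.
  - move=> k l kl; apply/subsetPset => w; move/oscillating_decr/subsetPset : kl; exact.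
have /fine_cvgP[fin /cvgrPdist_le/(_ _ eta20) h] := Bcvg.
have [k _ Hk] := filterI fin h.
have [/= h1 h2] := Hk k (leqnn k).
have Pk : mean_le P (\1_(B k)) (eta / 2).
  apply: mean_le_indic => //; rewrite -(fineK h1) lee_fin.
  by move: h2; rewrite sub0r normrN ger0_norm// fine_ge0.
have [|N HN] := cvg_in_proba_mean_le (fun n i => mcoord (X n) i) (mcoord Y) XY _ eta20 (eps := k.+1%:R^-1).
  by rewrite invr_gt0.
exists N => n Nn.
have mE : measurable [set w | eps <= enorm (G (X n w) - G (Y w))].
  have mb : measurable_fun setT (fun w => eps <= enorm (G (X n w) - G (Y w))).
    apply: measurable_fun_ler => //.
    apply: measurable_enorm => i; under eq_fun do rewrite !mxE.
    exact: measurable_funB.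
  by have := mb measurableT [set true] I; rewrite setTI.
have := mean_leD (HN n Nn) Pk; rewrite -splitr.
apply: mean_le_mono.
- exact: measurable_indic.
- by move=> w; rewrite indicE.
- move=> w; rewrite !indicE.
  set Gbad := (X in (w \in X)%:R <= _); set Xbad := (X in _ <= (w \in X)%:R + _).
  have [|h3] := boolP (w \in Gbad); last by rewrite addr_ge0.
  rewrite inE /= => Gw.
  have [_|] := boolP (w \in Xbad); first by rewrite lerDl.
  rewrite notin_setE /= => /negP; rewrite -ltNge => XYw.
  rewrite (_ : (w \in B k) = true) ?lerDr//; apply/mem_set.
  exists (X n w), (Y w); split => //.
    by rewrite distrC; apply: le_lt_trans (norm_le_enorm _) XYw.
  by rewrite subrr normr0 invr_gt0.
Qed.

End oscillation.
End continuous_mapping.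

Section second_moment.
Context {R : realType} {disp : measure_display} {Omega : measurableType disp}.
Variable P : probability Omega R.

(** The form in which a bounded moment of order 2 + delta yields uniform
    integrability of the squares: eta multiplies the bounded moment, and K is paid
    on events of small probability. *)
Lemma sqr_le_powR (delta eta : R) : 0 < delta -> 0 < eta ->
  exists2 K : R, 0 <= K & forall t, 0 <= t -> t ^+ 2 <= K + eta * t `^ (2 + delta).
Proof.
move=> d0 e0; set T := (eta^-1) `^ delta^-1.
have T0 : 0 < T by rewrite powR_gt0// invr_gt0.
exists (T ^+ 2); first by rewrite exprn_ge0// ltW.
move=> t t0; have [tT|Tt] := leP t T.
  rewrite -[leLHS]addr0 lerD ?mulr_ge0 ?powR_ge0 ?(ltW e0)//.
  by rewrite ler_sqr// nnegrE ltW.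
have t_gt0 : 0 < t by apply: lt_trans Tt.
rewrite powRD ?(gt_eqF t_gt0) ?implybT// powR_mulrn//.
have : eta^-1 <= t `^ delta.
  have -> : eta^-1 = T `^ delta.
    by rewrite /T -powRrM mulVf ?gt_eqF// powRr1// invr_ge0 ltW.
  by apply: ge0_ler_powR; rewrite ?nnegrE ?(ltW d0) ?(ltW T0) ?(ltW Tt).
rewrite -div1r ler_pdivrMr// mulrC => h.
have t2 : 0 <= t ^+ 2 by rewrite exprn_ge0.
rewrite -[leLHS]add0r lerD ?sqr_ge0// mulrCA ler_peMr//.
Qed.

Section weighted.
Context {L d : nat}.
Variables (wgt : 'I_L -> R).
Let W := \sum_r `|wgt r|.
Let W0 : 0 <= W. Proof. exact: sumr_ge0. Qed.

Lemma weighted_enorm_le (z : 'I_L -> 'rV[R]_d) (c : R) :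
  (forall r, enorm (z r) <= c) -> enorm (\sum_r wgt r *: z r) <= W * c.
Proof.
move=> zc; apply: le_trans (enorm_sum _ _ _) _; rewrite /W mulr_suml.
by apply: ler_sum => r _; rewrite enormZ ler_wpM2l.
Qed.

Lemma weighted_enorm_sqr_le (z : 'I_L -> 'rV[R]_d) :
  enorm (\sum_r wgt r *: z r) ^+ 2 <= W ^+ 2 * \sum_r enorm (z r) ^+ 2.
Proof.
set S := \sum_r enorm (z r) ^+ 2.
have S0 : 0 <= S by apply: sumr_ge0 => r _; rewrite sqr_ge0.
rewrite -[S in leRHS]sqr_sqrtr// -exprMn ler_sqr ?nnegrE ?mulr_ge0 ?enorm_ge0 ?sqrtr_ge0//.
apply: weighted_enorm_le => r.
rewrite -(ger0_norm (enorm_ge0 (z r))) -sqrtr_sqr ler_sqrt//.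
by rewrite /S (bigD1 r)//= lerDl sumr_ge0// => j _; rewrite sqr_ge0.
Qed.

Lemma measurable_weighted_enorm (z : 'I_L -> Omega -> 'rV[R]_d) :
  (forall r i, measurable_fun setT (fun w => z r w 0 i)) ->
  measurable_fun setT (fun w => enorm (\sum_r wgt r *: z r w)).
Proof.
move=> mz; apply: measurable_enorm => i.
rewrite (_ : (fun w => _) = (fun w => \sum_r wgt r * z r w 0 i)).
  by apply: measurable_sum => r; exact: measurable_funM.
by apply/funext => w; rewrite summxE; apply: eq_bigr => r _; rewrite mxE.
Qed.

(** Convergence in probability and uniform integrability of the squares make
    second moments converge; the factor 2 leaves room for the errors. Where all
    Z r n are eps-close to their limits, (x + y)^2 <= 3/2 x^2 + 3 y^2 compares the
    two weighted sums; elsewhere each square is at most K, on an event of small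
    probability, plus eta times a moment of order 2 + delta. *)
Lemma second_moment_limsup (Z : 'I_L -> nat -> Omega -> 'rV[R]_d)
    (Zoo : 'I_L -> Omega -> 'rV[R]_d) (delta B e : R) :
  (forall r n i, measurable_fun setT (fun w => Z r n w 0 i)) ->
  (forall r eps eta, 0 < eps -> 0 < eta -> exists N, forall n, (N <= n)%N ->
     mean_le P (\1_[set w | eps <= enorm (Z r n w - Zoo r w)]) eta) ->
  0 < delta -> 0 <= B ->
  (forall r n, (0 < n)%N -> mean_le P (fun w => enorm (Z r n w) `^ (2 + delta)) B) ->
  0 < e -> mean_le P (fun w => enorm (\sum_r wgt r *: Zoo r w) ^+ 2) e ->
  exists N, forall n, (N <= n)%N ->
    mean_le P (fun w => enorm (\sum_r wgt r *: Z r n w) ^+ 2) (2 * e).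
Proof.
move=> mZ cvgZ d0 B0 UI e0 Ee.
(* eps, eta and zeta bound three errors by e / 6 each, so that the total stays
   below 3/2 e + e / 2 *)
pose eps := Num.sqrt (e / (18 * (W ^+ 2 + 1))).
have W21 : 0 < W ^+ 2 + 1 by rewrite ltr_wpDl// exprn_ge0.
have eps0 : 0 < eps by rewrite sqrtr_gt0 divr_gt0// mulr_gt0.
have epsE : 3 * (W * eps) ^+ 2 <= e / 6.
  rewrite exprMn sqr_sqrtr ?divr_ge0 ?mulr_ge0 ?(ltW e0) ?(ltW W21)//.
  have -> : 3 * (W ^+ 2 * (e / (18 * (W ^+ 2 + 1)))) = e / 6 * (W ^+ 2 / (W ^+ 2 + 1)).
    by field; rewrite gt_eqF.
  rewrite ler_piMr ?divr_ge0 ?(ltW e0)// ler_pdivrMr// mul1r lerDl//.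
set W2 := W ^+ 2 in W21 *.
have W20 : 0 <= W2 by rewrite exprn_ge0.
have LB0 : 0 <= W2 * L%:R * B by rewrite !mulr_ge0.
pose eta := e / (6 * (W2 * L%:R * B + 1)).
have LB1 : 0 < W2 * L%:R * B + 1 by rewrite ltr_wpDl.
have eta0 : 0 < eta by rewrite divr_gt0// mulr_gt0.
have etaE : W2 * eta * (L%:R * B) <= e / 6.
  have -> : W2 * eta * (L%:R * B) = e / 6 * (W2 * L%:R * B / (W2 * L%:R * B + 1)).
    by rewrite /eta; field; rewrite gt_eqF.
  by rewrite ler_piMr ?divr_ge0 ?(ltW e0)// ler_pdivrMr// mul1r lerDl.
have [K K0 HK] := sqr_le_powR d0 eta0.
have LK0 : 0 <= W2 * L%:R * K * L%:R by rewrite !mulr_ge0.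
pose zeta := e / (6 * (W2 * L%:R * K * L%:R + 1)).
have LK1 : 0 < W2 * L%:R * K * L%:R + 1 by rewrite ltr_wpDl.
have zeta0 : 0 < zeta by rewrite divr_gt0// mulr_gt0.
have zetaE : W2 * L%:R * K * (L%:R * zeta) <= e / 6.
  have -> : W2 * L%:R * K * (L%:R * zeta) =
      e / 6 * (W2 * L%:R * K * L%:R / (W2 * L%:R * K * L%:R + 1)).
    by rewrite /zeta; field; rewrite gt_eqF.
  by rewrite ler_piMr ?divr_ge0 ?(ltW e0)// ler_pdivrMr// mul1r lerDl.
have /choice[N HN] : forall r, exists N, forall n, (N <= n)%N ->
     mean_le P (\1_[set w | eps <= enorm (Z r n w - Zoo r w)]) zeta.
  by move=> r; exact: cvgZ.
exists (maxn 1 (\max_r N r)) => n; rewrite geq_max => /andP[n0 nN].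
have HNn r : mean_le P (\1_[set w | eps <= enorm (Z r n w - Zoo r w)]) zeta.
  by apply: HN; apply: leq_trans nN; exact: leq_bigmax.
have sumL (x : R) : \sum_(r < L) x = L%:R * x by rewrite sumr_const card_ord mulr_natl.
have M1 : mean_le P (fun w => 3 / 2 * enorm (\sum_r wgt r *: Zoo r w) ^+ 2) (3 / 2 * e).
  by apply: mean_leZ => //; lra.
have M2 : mean_le P (fun=> 3 * (W * eps) ^+ 2) (3 * (W * eps) ^+ 2).
  by apply: mean_le_cst; rewrite mulr_ge0 ?sqr_ge0.
have M3 : mean_le P (fun w => W2 * L%:R * K *
    \sum_r \1_[set w | eps <= enorm (Z r n w - Zoo r w)] w) (W2 * L%:R * K * (L%:R * zeta)).
  apply: mean_leZ; first by rewrite !mulr_ge0.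
  by rewrite -sumL; apply: mean_le_sum => r; exact: HNn.
have M4 : mean_le P (fun w => W2 * eta * \sum_r enorm (Z r n w) `^ (2 + delta))
    (W2 * eta * (L%:R * B)).
  apply: mean_leZ; first by rewrite mulr_ge0// ltW.
  by rewrite -sumL; apply: mean_le_sum => r; exact: UI.
have M := mean_leD (mean_leD M1 M2) (mean_leD M3 M4).
apply: mean_le_trans (_ : 3 / 2 * e + 3 * (W * eps) ^+ 2 +
  (W2 * L%:R * K * (L%:R * zeta) + W2 * eta * (L%:R * B)) <= _) _; first by lra.
apply: mean_le_mono M.
- by apply: measurable_funX; apply: measurable_weighted_enorm.
- by move=> w; rewrite sqr_ge0.
move=> w /=.
set Sbad := \sum_r \1_ _ w; set Spow := \sum_r _ `^ _.
have Spow0 : 0 <= Spow by apply: sumr_ge0 => r _; exact: powR_ge0.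
have Sbad0 : 0 <= Sbad by apply: sumr_ge0 => r _; rewrite indicE.
have [/existsP[r0 bad]|/existsPn good] :=
    boolP [exists r, eps <= enorm (Z r n w - Zoo r w)].
  have Sbad1 : 1 <= Sbad.
    rewrite /Sbad (bigD1 r0)//= [X in X + _]indicE mem_set// lerDl.
    by apply: sumr_ge0 => r _; rewrite indicE.
  apply: (@le_trans _ _ (W2 * (L%:R * K + eta * Spow))).
    apply: le_trans (weighted_enorm_sqr_le _) _; rewrite ler_wpM2l//.
    have -> : L%:R * K + eta * Spow = \sum_(r < L) (K + eta * enorm (Z r n w) `^ (2 + delta)).
      by rewrite big_split /= sumL mulr_sumr.
    by apply: ler_sum => r _; apply: HK; exact: enorm_ge0.
  have : W2 * L%:R * K <= W2 * L%:R * K * Sbad by rewrite ler_peMr// !mulr_ge0.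
  have := sqr_ge0 (enorm (\sum_r wgt r *: Zoo r w)); have := sqr_ge0 (W * eps).
  lra.
have : enorm (\sum_r wgt r *: Z r n w - \sum_r wgt r *: Zoo r w) <= W * eps.
  rewrite -sumrB (eq_bigr (fun r => wgt r *: (Z r n w - Zoo r w))); last first.
    by move=> r _; rewrite scalerBr.
  by apply: weighted_enorm_le => r; rewrite leNgt; apply: contra (good r) => /ltW.
set a := \sum_r wgt r *: Z r n w; set b := \sum_r wgt r *: Zoo r w => ab.
have ab2 : enorm a <= enorm b + W * eps.
  have -> : a = b + (a - b) by rewrite addrC subrK.
  by apply: le_trans (enormD _ _) _; rewrite lerD2l.
apply: (@le_trans _ _ (3 / 2 * enorm b ^+ 2 + 3 * (W * eps) ^+ 2)); last first.
  rewrite lerDl; apply: addr_ge0; first by rewrite !mulr_ge0.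
  by apply: mulr_ge0 => //; rewrite mulr_ge0// ltW.
have := enorm_ge0 a; have := enorm_ge0 b; have : 0 <= W * eps by rewrite mulr_ge0// ltW.
move: ab2; set x := enorm a; set y := enorm b; set t := W * eps => h t0 y0 x0.
have : x ^+ 2 <= (y + t) ^+ 2 by rewrite ler_sqr ?nnegrE ?addr_ge0.
have := sqr_ge0 (y - 2 * t).
nra.
Qed.

End weighted.
End second_moment.

(** * One-step mean estimates *)

Section one_step.
Context {R : realType} {disp : measure_display} {Omega : measurableType disp}.
Variable P : probability Omega R.

(** Trades a Holder modulus of exponent at most 2 for a small constant and a
    large multiple of the square. *)
Lemma powR_le_sqr (b eta : R) : 0 < b <= 2 -> 0 < eta ->
  exists2 K : R, 0 <= K & forall t, 0 <= t -> t `^ b <= eta + K * t ^+ 2.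
Proof.
move=> /andP[b0 b2] e0; set T := eta `^ b^-1.
have T0 : 0 < T by rewrite powR_gt0.
exists ((T `^ (2 - b))^-1); first by rewrite invr_ge0 powR_ge0.
have TbE : T `^ b = eta by rewrite /T -powRrM mulVf ?gt_eqF// powRr1// ltW.
move=> t t0; have [tT|Tt] := leP t T.
  rewrite -[leLHS]addr0 lerD ?mulr_ge0 ?invr_ge0 ?powR_ge0 ?sqr_ge0//.
  by rewrite -TbE ge0_ler_powR ?nnegrE ?(ltW b0) ?(ltW T0).
have t_gt0 : 0 < t by apply: lt_trans Tt.
rewrite -[leLHS]add0r lerD ?(ltW e0)// mulrC ler_pdivlMr ?powR_gt0//.
rewrite -(@powR_mulrn _ t 2) ?(ltW t_gt0)//.
have -> : t `^ 2%:R = t `^ b * t `^ (2 - b).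
  by rewrite -powRD ?(gt_eqF t_gt0) ?implybT//; congr (_ `^ _); ring.
rewrite ler_wpM2l ?powR_ge0// ge0_ler_powR ?nnegrE ?subr_ge0 ?(ltW T0) ?(ltW t_gt0)//.
exact: ltW.
Qed.

Lemma integral_linear_comb (I : Type) (r : seq I) (a : I -> R) (Y : I -> Omega -> R) (m : I -> R) :
  (forall i, P.-integrable setT (fun w => (Y i w)%:E)) ->
  (forall i, m i = fine (\int[P]_w (Y i w)%:E)%E) ->
  P.-integrable setT (fun w => (\sum_(i <- r) a i * Y i w)%:E) /\
  (\int[P]_w (\sum_(i <- r) a i * Y i w)%:E)%E = (\sum_(i <- r) a i * m i)%:E.
Proof.
move=> iY mE; elim: r => [|i r [intS IH]].
  have -> : (fun w => (\sum_(i <- [::]) a i * Y i w)%:E) = cst 0%E.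
    by apply/funext => w; rewrite big_nil.
  by rewrite big_nil integral0; split => //; exact: integrable0.
have iZ : P.-integrable setT (fun w => ((a i)%:E * (Y i w)%:E)%E).
  by apply: integrableZl.
have -> : (fun w => (\sum_(j <- i :: r) a j * Y j w)%:E) =
    (fun w => ((a i)%:E * (Y i w)%:E + (\sum_(j <- r) a j * Y j w)%:E)%E).
  by apply/funext => w; rewrite big_cons EFinD EFinM.
split; first exact: integrableD.
rewrite integralD// IH big_cons integralZl// mE EFinD EFinM fineK//.
exact: integrable_fin_num.
Qed.

Lemma mean_le_integrable (f g : Omega -> R) c : measurable_fun setT f ->
  (forall w, `|f w| <= g w) -> mean_le P g c -> P.-integrable setT (fun w => (f w)%:E).
Proof.
move=> mf fg [mg g0 gc]; apply/integrableP; split; first exact/measurable_EFinP.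
apply: le_lt_trans (ltry c); apply: le_trans gc.
apply: ge0_le_integral => //.
- by apply: measurableT_comp => //; exact/measurable_EFinP.
- exact/measurable_EFinP.
- by move=> w _; rewrite abse_EFin lee_fin.
Qed.

Section vector.
Context {d : nat}.
Variables (Y : Omega -> 'rV[R]_d) (c : R) (m : 'rV[R]_d).
Hypothesis mY : forall i, measurable_fun setT (fun w => Y w 0 i).
Hypothesis Yc : mean_le P (fun w => enorm (Y w) ^+ 2) c.
Hypothesis mE : forall i, m 0 i = fine (\int[P]_w (Y w 0 i)%:E)%E.

Lemma coord_integrable i : P.-integrable setT (fun w => (Y w 0 i)%:E).
Proof.
apply: (@mean_le_integrable _ (fun w => 1 + enorm (Y w) ^+ 2) (1 + c)) => //.
  move=> w; apply: le_trans (coord_le_enorm _ _) _.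
  have := sqr_ge0 (enorm (Y w) - 1); have := enorm_ge0 (Y w); nra.
by apply: mean_leD => //; exact: mean_le_cst.
Qed.

(** In the expansion of the square, Y contributes to the cross term by its mean
    only. *)
Lemma mean_le_affine_sqr (y : 'rV[R]_d) (g : R) :
  mean_le P (fun w => enorm (y - g *: Y w) ^+ 2)
            (enorm y ^+ 2 - 2 * g * dot y m + g ^+ 2 * c).
Proof.
have [iS IS] := integral_linear_comb (index_enum 'I_d) (fun i => - (2 * g) * y 0 i)
  coord_integrable mE.
have c0 : 0 <= c.
  have [_ f0 fc] := Yc; rewrite -lee_fin; apply: le_trans fc.
  by apply: integral_ge0 => w _; rewrite lee_fin.
split.
- apply: measurable_funX; apply: measurable_enorm => i.
  rewrite (_ : (fun w => _) = (fun w => y 0 i - g * Y w 0 i)); last first.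
    by apply/funext => w; rewrite !mxE.
  by apply: measurable_funB => //; exact: measurable_funM.
- by move=> w; rewrite sqr_ge0.
have M1 : mean_le P (fun w => enorm y ^+ 2 + g ^+ 2 * enorm (Y w) ^+ 2)
    (enorm y ^+ 2 + g ^+ 2 * c).
  apply: mean_leD; first by apply: mean_le_cst; rewrite sqr_ge0.
  by apply: mean_leZ => //; rewrite sqr_ge0.
have i1 : P.-integrable setT (fun w => (enorm y ^+ 2 + g ^+ 2 * enorm (Y w) ^+ 2)%:E).
  have [mf f0 _] := M1; apply: mean_le_integrable M1 => // w.
  by rewrite ger0_norm.
have -> : (fun w => (enorm (y - g *: Y w) ^+ 2)%:E) =
  (fun w => ((enorm y ^+ 2 + g ^+ 2 * enorm (Y w) ^+ 2)%:E +
     (\sum_i - (2 * g) * y 0 i * Y w 0 i)%:E)%E).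
  apply/funext => w; rewrite -EFinD; congr (_%:E).
  have -> : \sum_i - (2 * g) * y 0 i * Y w 0 i = - (2 * g) * dot y (Y w).
    by rewrite /dot mulr_sumr; apply: eq_bigr => i _; rewrite mulrA.
  rewrite !enorm_sqr dotBl !dotBr !dotZl !dotZr [dot (Y w) y]dotC; ring.
rewrite integralD// IS.
have -> : \sum_i - (2 * g) * y 0 i * m 0 i = - (2 * g) * dot y m.
  by rewrite /dot mulr_sumr; apply: eq_bigr => i _; rewrite mulrA.
have [_ _ M1c] := M1.
apply: le_trans (leeD M1c (lexx _)) _; rewrite -EFinD lee_fin; lra.
Qed.

(** A variance is at most the second moment, so that centring does not change
    the constant in front of c. *)
Lemma mean_le_centered_sqr (y : 'rV[R]_d) (g : R) :
  mean_le P (fun w => enorm (y - g *: (Y w - m)) ^+ 2) (enorm y ^+ 2 + g ^+ 2 * c).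
Proof.
have := mean_le_affine_sqr (y + g *: m) g.
have -> : (fun w => enorm (y + g *: m - g *: Y w) ^+ 2) =
  (fun w => enorm (y - g *: (Y w - m)) ^+ 2).
  by apply/funext => w; rewrite scalerBr opprB addrA.
apply: mean_le_trans.
rewrite !enorm_sqr dotDl !dotDr !dotZl !dotZr [dot m y]dotC dotDl dotZl.
have : 0 <= g ^+ 2 * dot m m by rewrite mulr_ge0 ?sqr_ge0 ?dotxx_ge0.
lra.
Qed.

End vector.

(** The principle behind every recursion on means: a bound that holds for each
    frozen state x and an innovation Y' holds for a random state X and an innovation
    of the same law independent of X. *)
Lemma mean_le_freeze {d1 d2} {T1 : measurableType d1} {T2 : measurableType d2}
    (X : Omega -> T1) (Y Y' : Omega -> T2) (F : T1 * T2 -> R) (G : T1 -> R) (c : R) :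
  measurable_fun setT X -> measurable_fun setT Y -> measurable_fun setT Y' ->
  indep P X Y -> same_law P Y Y' ->
  measurable_fun setT F -> (forall z, 0 <= F z) ->
  (forall x, mean_le P (fun w => F (x, Y' w)) (G x)) ->
  mean_le P (fun w => G (X w)) c ->
  mean_le P (fun w => F (X w, Y w)) c.
Proof.
move=> mX mY mY' XY YY' mF F0 FG [mG G0 Gc]; split => //.
  by apply: measurableT_comp => //; exact: measurable_fun_pair.
rewrite indep_freeze//; apply: le_trans Gc.
have mEF : measurable_fun setT (EFin \o F) by exact/measurable_EFinP.
apply: ge0_le_integral => //.
- by move=> w _; apply: integral_ge0 => w' _; rewrite lee_fin.
- pose F2 (z : T1 * Omega) := (F (z.1, Y z.2))%:E.
  have mF2 : measurable_fun setT F2.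
    apply: (measurableT_comp mEF); apply: measurable_fun_pair => //.
    exact: (measurableT_comp mY).
  have F20 z : (0 <= F2 z)%E by rewrite lee_fin.
  have h := @measurable_fun_fubini_tonelli_F _ _ _ _ _ P F2 mF2 F20.
  exact: (measurableT_comp h).
- exact/measurable_EFinP.
move=> w _; have [_ _] := FG (X w); apply: le_trans.
rewrite le_eqVlt; apply/orP; left; apply/eqP.
apply: (same_law_integral (F := fun v => (F (X w, v))%:E)) => //.
  by apply: (measurableT_comp mEF); exact: pair1_measurable.
by move=> z; rewrite lee_fin.
Qed.

End one_step.

(** * Decay of the moment recursions *)

Section decay.
Context {R : realType}.
Variables (gamma : R -> R) (lambda c C0 : R).
Let g (p : nat) : R := gamma p%:R.
Let s (p : nat) : R := Num.sqrt (gamma p%:R).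
Hypothesis g0 : forall p, 0 < g p.
Hypothesis gdec : forall i j, (i <= j)%N -> g j <= g i.
Hypothesis gcvg : g p @[p --> \oo] --> 0.
Hypothesis gsum : elapsed g p @[p --> \oo] --> +oo.
Hypothesis c0 : 0 < c.
Hypothesis cl : c < lambda.
Hypothesis C01 : 1 <= C0.
Hypothesis slow_s : slow g c C0 s.

Lemma sqrt_step_gt0 p : 0 < s p.
Proof. by rewrite sqrtr_gt0 g0. Qed.

Lemma sqrt_step_sqr p : s p ^+ 2 = g p.
Proof. by rewrite sqr_sqrtr// ltW// g0. Qed.

Lemma sqrt_step_cvg0 : s p @[p --> \oo] --> 0.
Proof.
rewrite -[X in _ --> X](@sqrtr0 R); apply: (cvg_comp _ _ gcvg).
exact: sqrt_continuous.
Qed.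

Lemma step_bounds i : 0 <= g i.+1 <= g 0%N.
Proof. by rewrite ltW ?g0// gdec. Qed.

(** Squaring doubles the rate, in accordance with second moments being contracted
    at rate 2 lambda. *)
Lemma slow_step : slow g (2 * c) (C0 ^+ 2) g.
Proof.
move=> j p jp; rewrite -(sqrt_step_sqr j) -(sqrt_step_sqr p) -exprMn.
have -> : expR (- (2 * c) * (elapsed g p - elapsed g j)) =
   expR (- c * (elapsed g p - elapsed g j)) ^+ 2.
  by rewrite -expRM_natl; congr expR; ring.
have sj := ltW (sqrt_step_gt0 j); have sp := ltW (sqrt_step_gt0 p).
rewrite -exprMn ler_sqr ?nnegrE ?mulr_ge0 ?expR_ge0 ?slow_s//.
exact: le_trans C01.
Qed.

Lemma slow_consecutive p : s p <= C0 * expR (c * g 0%N) * s p.+1.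
Proof.
have := slow_s (leqnSn p).
rewrite elapsedS [_ + g _]addrC addrK => h.
have h2 : expR (- c * g p.+1) * expR (c * g p.+1) = 1.
  by rewrite -expRD mulNr addNr expR0.
apply: (@le_trans _ _ (s p * expR (- c * g p.+1) * expR (c * g p.+1))).
  by rewrite -mulrA h2 mulr1.
apply: (@le_trans _ _ (C0 * s p.+1 * expR (c * g p.+1))).
  by rewrite ler_wpM2r ?expR_ge0.
rewrite mulrAC ler_wpM2r ?(ltW (sqrt_step_gt0 _))// ler_wpM2l ?(le_trans _ C01)//.
by rewrite ler_expR ler_wpM2l ?(ltW c0)// gdec.
Qed.

(** For small x, the gap between l' and lambda pays for the quadratic term and
    leaves the exact discount of rate 2 lambda. *)
Lemma quadratic_le_exp (l' k x : R) : 0 <= x -> k * x <= 2 * (l' - lambda) ->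
  1 - 2 * l' * x + k * x ^+ 2 <= expR (- (2 * lambda) * x).
Proof.
move=> x0 kx; apply: le_trans (expR_ge1Dx _).
have := ler_wpM2l x0 kx; lra.
Qed.

Lemma step_small (k e : R) : 0 < e -> exists p1, forall p, (p1 <= p)%N -> k * g p.+1 <= e.
Proof.
move=> e0; have k1 : 0 < `|k| + 1 by rewrite ltr_wpDl.
have ek : 0 < e / (`|k| + 1) by rewrite divr_gt0.
have /cvgrPdist_le/(_ _ ek)[p1 _ Hp1] := gcvg; exists p1 => p p1p.
have := Hp1 p.+1 (leqW p1p); rewrite /= sub0r normrN ger0_norm ?(ltW (g0 _))//.
rewrite ler_pdivlMr// => h; apply: le_trans h.
rewrite mulrC ler_wpM2l ?(ltW (g0 _))// (le_trans (ler_norm _))// lerDl//.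
Qed.

(** Dominates the mean squared error of one scheme. Up to rank p1 the steps may
    be too large to contract, and each of them costs a constant factor. *)
Definition second_moment_seq (k a0 : R) (p1 : nat) :=
  fix a (p : nat) : R := if p is p'.+1 then
    (if (p' < p1)%N then 1 + k * g 0%N ^+ 2 else expR (- (2 * lambda) * g p)) * a p'
      + k * g p ^+ 2
  else a0.

(** The forcing k g^2 = g * (g * k) is that of gronwall_slow for the target g
    itself. *)
Lemma second_moment_seq_le (k a0 : R) p1 : 0 <= k -> 0 <= a0 ->
  exists2 C2 : R, 0 <= C2 & forall p, 0 <= second_moment_seq k a0 p1 p <= C2 * g p.
Proof.
move=> k0 a00; set a := second_moment_seq k a0 p1.
have a_ge0 p : 0 <= a p.
  elim: p => //= p IH; apply: addr_ge0; last by apply: mulr_ge0; rewrite ?sqr_ge0.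
  apply: mulr_ge0 => //.
  by case: ifP => _; rewrite ?expR_ge0// addr_ge0// mulr_ge0// sqr_ge0.
set A := \sum_(i < p1.+1) a i.
have A0 : 0 <= A by apply: sumr_ge0 => i _; exact: a_ge0.
have aA p : (p <= p1)%N -> a p <= A.
  move=> pp1; rewrite -ltnS in pp1; rewrite /A (bigD1 (Ordinal pp1))//= lerDl.
  by apply: sumr_ge0 => i _; exact: a_ge0.
have cl2 : 2 * c < 2 * lambda by rewrite ltr_pM2l.
have C021 : 1 <= C0 ^+ 2 by rewrite exprn_ege1.
have [psi [psi0 psicvg Hpsi]] := gronwall_slow step_bounds gsum g0 cl2 C021
  slow_step p1 A0 (fun=> lexx 0) (@cvg_cst _ _ _ _ _).
have [B B0 psiB] : exists2 B : R, 0 <= B & forall p, psi p <= B.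
  have /cvg_seq_bounded[B [Breal HB]] : cvgn psi by apply/cvg_ex; exists 0.
  exists (`|B| + 1); first by rewrite addr_ge0.
  move=> p; apply: le_trans (ler_norm _) _; apply: HB => //.
  by rewrite (le_lt_trans (ler_norm _))// ltrDl.
set U := (1 + (2 * lambda - 2 * c) * g 0%N) / (2 * lambda - 2 * c) in Hpsi.
have U0 : 0 <= U.
  have : 0 < 2 * lambda - 2 * c by rewrite subr_gt0.
  by move=> h; rewrite divr_ge0 ?(ltW h)// addr_ge0// mulr_ge0 ?(ltW h) ?(ltW (g0 _)).
exists (C0 ^+ 2 * (U * k + B)).
  by rewrite mulr_ge0 ?sqr_ge0// addr_ge0// mulr_ge0.
move=> p; rewrite a_ge0/=.
have := Hpsi p k a k0 (fun i ip1 _ => aA i ip1).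
have H : forall i, (p1 <= i < p)%N ->
    a i.+1 <= expR (- (2 * lambda) * g i.+1) * a i + g i.+1 * (g i.+1 * (k + 0)).
  move=> i /andP[pi _]; rewrite /= ltnNge pi /= addr0 lerD2l expr2.
  by rewrite mulrC mulrA.
move=> /(_ H) /le_trans; apply.
rewrite mulrAC ler_wpM2r ?(ltW (g0 _))// ler_wpM2l ?sqr_ge0// lerD2l.
exact: psiB.
Qed.

(** Dominates the second moment of the martingale part. Its noise has a second
    moment B1, plus D times the mean squared errors C2 g of the schemes. *)
Definition martingale_seq (B1 D C2 : R) (p0 : nat) :=
  fix b (p : nat) : R := if p is p'.+1 then
    if (p' < p0)%N then 0 else
    expR (- (2 * lambda) * g p) * b p' + g p ^+ 2 * (B1 + D * (C2 * g p'))
  else 0.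

(** The errors of the schemes vanish and go into psi, which does not depend on
    the noise level B1. *)
Lemma martingale_seq_le (D C2 : R) (p0 : nat) : 0 <= D -> 0 <= C2 ->
  exists psi : nat -> R, [/\ forall N, 0 <= psi N, psi N @[N --> \oo] --> 0 &
    forall B1 N, 0 <= B1 -> martingale_seq B1 D C2 p0 N <= C0 ^+ 2 * g N *
      ((1 + (2 * lambda - 2 * c) * g 0%N) / (2 * lambda - 2 * c) * B1 + psi N)].
Proof.
move=> D0 C20; have cl2 : 2 * c < 2 * lambda by rewrite ltr_pM2l.
have C021 : 1 <= C0 ^+ 2 by rewrite exprn_ege1.
pose u p := D * (C2 * g p.-1).
have u0 p : 0 <= u p by rewrite !mulr_ge0// ltW.
have ucvg : u p @[p --> \oo] --> 0.
  rewrite -(@cvg_shiftS _ u) /u /=.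
  have h : D * (C2 * g p) @[p --> \oo] --> D * (C2 * 0).
    by apply: cvgMl_tmp; apply: cvgMl_tmp.
  by rewrite !mulr0 in h.
have [psi [psi0 psicvg Hpsi]] := gronwall_slow step_bounds gsum g0 cl2 C021
  slow_step p0 (lexx 0) u0 ucvg.
exists psi; split => // B1 N B10; apply: Hpsi => //.
- by case=> [|p] // pp0 _; rewrite /= pp0.
move=> p /andP[p0p pN]; rewrite /= ltnNge p0p /= lerD2l expr2 mulrA.
by rewrite /u /= !mulrA.
Qed.

(** Dominates the mean norm of the residual. The linearization error consists of
    a slope eps times an error of order s, and of a quadratic term of order
    s^2 = g. *)
Definition residual_seq (eps K W C2 Ares : R) (p0 : nat) :=
  fix r (p : nat) : R := if p is p'.+1 then
    if (p' < p0)%N then Ares else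
    expR (- lambda * g p) * r p' +
      g p * (W * (eps * ((1 + C2) * s p') + K * (C2 * g p')))
  else Ares.

(** The quadratic term is negligible against s and goes into psi, together with
    the start Ares; neither C6 nor psi depends on the slope eps. *)
Lemma residual_seq_le (K W C2 Ares : R) (p0 : nat) :
  0 <= K -> 0 <= W -> 0 <= C2 -> 0 <= Ares ->
  exists (C6 : R) (psi : nat -> R),
   [/\ 0 <= C6, forall N, 0 <= psi N, psi N @[N --> \oo] --> 0 &
    forall eps N, 0 <= eps ->
      residual_seq eps K W C2 Ares p0 N <= C0 * s N * (C6 * eps + psi N)].
Proof.
move=> K0 W0 C20 A0.
set C1 := C0 * expR (c * g 0%N).
have C10 : 0 <= C1 by rewrite mulr_ge0 ?expR_ge0// (le_trans _ C01).
pose u p := W * K * C2 * C1 * s p.-1.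
have WKC0 : 0 <= W * K * C2 * C1 by apply: mulr_ge0 => //; rewrite !mulr_ge0.
have u0 p : 0 <= u p by apply: mulr_ge0 => //; exact: ltW (sqrt_step_gt0 _).
have ucvg : u p @[p --> \oo] --> 0.
  rewrite -(@cvg_shiftS _ u) /u /=.
  have h : W * K * C2 * C1 * s p @[p --> \oo] --> W * K * C2 * C1 * 0.
    by apply: cvgMl_tmp; exact: sqrt_step_cvg0.
  by rewrite !mulr0 in h.
have [psi [psi0 psicvg Hpsi]] := gronwall_slow step_bounds gsum sqrt_step_gt0 cl C01
  slow_s p0 A0 u0 ucvg.
set U := (1 + (lambda - c) * g 0%N) / (lambda - c) in Hpsi.
have U0 : 0 <= U.
  have h : 0 < lambda - c by rewrite subr_gt0.
  by rewrite divr_ge0 ?(ltW h)// addr_ge0// mulr_ge0 ?(ltW h) ?(ltW (g0 _)).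
exists (U * (W * (1 + C2) * C1)), psi; split => //.
  by apply: mulr_ge0 => //; apply: mulr_ge0 => //; rewrite mulr_ge0// addr_ge0.
move=> eps N eps0.
have -> : U * (W * (1 + C2) * C1) * eps = U * (W * (1 + C2) * C1 * eps) by ring.
apply: Hpsi; first by do 2 apply: mulr_ge0 => //; rewrite mulr_ge0// addr_ge0.
  by case=> [|p] // pp0 _; rewrite /= pp0.
move=> p /andP[p0p pN]; rewrite /= ltnNge p0p /= lerD2l ler_wpM2l ?(ltW (g0 _))//.
have sp := slow_consecutive p; rewrite -/C1 in sp.
have s0p := ltW (sqrt_step_gt0 p).
rewrite -sqrt_step_sqr.
have h1 : W * eps * (1 + C2) * s p <= W * eps * (1 + C2) * (C1 * s p.+1).
  by rewrite ler_wpM2l// !mulr_ge0// addr_ge0.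
have h2 : W * K * C2 * s p * s p <= W * K * C2 * s p * (C1 * s p.+1).
  by rewrite ler_wpM2l// !mulr_ge0.
rewrite /u /=; lra.
Qed.

End decay.

(** * The coupled schemes and their martingale part *)

Section coupled_schemes.
Context {R : realType} {disp : measure_display} {Omega : measurableType disp}.
Variable P : probability Omega R.
Context {d q L : nat}.
Variables (H : 'rV[R]_d -> 'rV[R]_q -> 'rV[R]_d) (gamma : R -> R).
Variables (wgt : 'I_L -> R) (A : 'M[R]_d).
Variables (f : 'I_L -> 'rV[R]_d -> 'rV[R]_d) (root : 'I_L -> 'rV[R]_d).
Variables (law : 'I_L -> {RV P >-> bvec R q}).
Variables (x0 : 'I_L -> {RV P >-> bvec R d}) (V : 'I_L -> nat -> {RV P >-> bvec R q}).
Variables (M p0 : nat).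
Hypothesis mH : measurable_fun [set: bvec R d * bvec R q]
    (fun z : bvec R d * bvec R q => H z.1 z.2 : bvec R d).
Hypothesis fcont : forall r, continuous (f r).
Hypothesis fE : forall r x i, f r x 0 i = fine (\int[P]_w (H x (law r w) 0 i)%:E)%E.
Hypothesis V_law : forall p, (0 < p <= M)%N ->
  same_law P (joint (fun r => V r p)) (joint law).
Hypothesis V_indep : mutual_indep P [set p | (0 < p <= M)%N] (fun p => joint (fun r => V r p)).
Hypothesis x0_indep : indep P (joint x0) (joint (fun p : 'I_M => joint (fun r => V r p.+1))).

Let g (p : nat) : R := gamma p%:R.

Definition level r p w : 'rV[R]_d := rm_scheme H gamma (x0 r w) (fun k => V r k w) p.

Definition noise (x : 'I_L -> 'rV[R]_d) (u : 'I_L -> 'rV[R]_q) : 'rV[R]_d :=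
  \sum_r wgt r *: (H (x r) (u r) - f r (x r)).

(** The part of the weighted error driven by the centred noise. It is held at
    zero up to rank p0, from which the steps are small enough for y - g y A to
    contract; the residual takes charge of what happens before. *)
Fixpoint martingale p w : 'rV[R]_d :=
  if p is p'.+1 then
    if (p' < p0)%N then 0 else
    martingale p' w - g p *: (martingale p' w *m A)
      - g p *: noise (fun r => level r p' w) (fun r => V r p w)
  else 0.

Definition weighted_error p w : 'rV[R]_d := \sum_r wgt r *: (level r p w - root r).

Definition residual p w : 'rV[R]_d := weighted_error p w - martingale p w.

Local Notation state := (L.-tuple (bvec R d) * bvec R d)%type.
Local Notation innov := (L.-tuple (bvec R q))%type.

(** All levels and the martingale part together: one Markov chain driven by the
    joint innovations of the levels. *)
Definition state_at p w : state := (joint (fun r => level r p : Omega -> bvec R d) w, martingale p w).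

Definition next_state p (z : state * innov) : state :=
  ([tuple (tnth z.1.1 r : 'rV[R]_d) - g p.+1 *: H (tnth z.1.1 r) (tnth z.2 r) | r < L],
   if (p < p0)%N then 0 else
   (z.1.2 : 'rV[R]_d) - g p.+1 *: ((z.1.2 : 'rV[R]_d) *m A)
     - g p.+1 *: noise (fun r => tnth z.1.1 r) (fun r => tnth z.2 r)).

Lemma state_atS p w :
  state_at p.+1 w = next_state p (state_at p w, joint (fun r => V r p.+1) w).
Proof.
rewrite /state_at /next_state /=; congr pair.
  by apply: eq_from_tnth => r; rewrite !tnth_mktuple /=.
case: ifP => // _; congr (_ - _ *: _).
by apply: eq_bigr => r _; rewrite !tnth_mktuple.
Qed.

Lemma measurable_H_coord {d1} {T : measurableType d1} (a : T -> bvec R d) (b : T -> bvec R q) i :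
  measurable_fun setT a -> measurable_fun setT b ->
  measurable_fun setT (fun z => H (a z) (b z) 0 i).
Proof.
move=> ma mb.
apply: (@measurableT_comp _ _ _ _ _ _ (fun x : bvec R d => (x : 'rV_d) 0 i)).
  exact: measurable_coord.
exact: (measurableT_comp mH (measurable_fun_pair ma mb)).
Qed.

Lemma measurable_field_coord {d1} {T : measurableType d1} r (a : T -> bvec R d) i :
  measurable_fun setT a -> measurable_fun setT (fun z => f r (a z) 0 i).
Proof.
move=> ma; apply: (@measurableT_comp _ _ _ _ _ _ (fun x : bvec R d => f r x 0 i : R)) => //.
apply: continuous_bvec_measurable => x.
apply: (@continuous_comp _ _ _ (f r) (fun y : 'rV[R]_d => y 0 i)); first exact: fcont.
exact: coord_continuous.
Qed.

Lemma measurable_coord_of {d1} {T : measurableType d1} k (a : T -> bvec R k) i :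
  measurable_fun setT a -> measurable_fun setT (fun z => (a z : 'rV[R]_k) 0 i).
Proof.
move=> ma; apply: (@measurableT_comp _ _ _ _ _ _ (fun x : bvec R k => (x : 'rV_k) 0 i)) => //.
exact: measurable_coord.
Qed.

Let mtnth1 r : measurable_fun [set: state * innov]
  (fun z : state * innov => tnth z.1.1 r : bvec R d).
Proof.
apply: (@measurableT_comp _ _ _ _ _ _ (fun x : L.-tuple (bvec R d) => tnth x r)).
  exact: measurable_tnth.
exact: measurableT_comp.
Qed.

Let mtnth2 r : measurable_fun [set: state * innov]
  (fun z : state * innov => tnth z.2 r : bvec R q).
Proof.
apply: (@measurableT_comp _ _ _ _ _ _ (fun x : L.-tuple (bvec R q) => tnth x r)) => //.
exact: measurable_tnth.
Qed.

Let mz12 : measurable_fun [set: state * innov] (fun z : state * innov => z.1.2 : bvec R d).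
Proof. exact: measurableT_comp. Qed.

Lemma measurable_next p : measurable_fun [set: state * innov] (next_state p).
Proof.
have m1 : measurable_fun [set: state * innov] (fun z : state * innov =>
  [tuple (tnth z.1.1 r : 'rV[R]_d) - g p.+1 *: H (tnth z.1.1 r) (tnth z.2 r) | r < L]
    : L.-tuple (bvec R d)).
  apply/measurable_fun_tnthP => r; apply: measurable_bvec => i.
  rewrite (_ : (fun z => _) = (fun z : state * innov =>
     (tnth z.1.1 r : 'rV[R]_d) 0 i - g p.+1 * H (tnth z.1.1 r) (tnth z.2 r) 0 i)).
    apply: measurable_funB; first exact: measurable_coord_of.
    by apply: measurable_funM => //; exact: measurable_H_coord.
  by apply/funext => z /=; rewrite tnth_mktuple !mxE.
rewrite /next_state; case: (p < p0)%N; apply: (measurable_fun_pair m1) => //.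
apply: measurable_bvec => i.
rewrite (_ : (fun z => _) = (fun z : state * innov =>
   (z.1.2 : 'rV[R]_d) 0 i - g p.+1 * (\sum_j (z.1.2 : 'rV[R]_d) 0 j * A j i) -
   g p.+1 * \sum_r wgt r * (H (tnth z.1.1 r) (tnth z.2 r) 0 i - f r (tnth z.1.1 r) 0 i))).
  apply: measurable_funB; first apply: measurable_funB.
  - exact: measurable_coord_of.
  - apply: measurable_funM => //; apply: measurable_sum => j.
    by apply: measurable_funM => //; exact: measurable_coord_of.
  - apply: measurable_funM => //; apply: measurable_sum => r.
    apply: measurable_funM => //; apply: measurable_funB.
      exact: measurable_H_coord.
    exact: measurable_field_coord.
apply/funext => z /=; rewrite !mxE summxE; congr (_ - _ * _).
by apply: eq_bigr => r _; rewrite !mxE.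
Qed.

Let mV p : measurable_fun setT (joint (fun r => V r p)).
Proof. by apply: measurable_joint => r. Qed.

Lemma measurable_state p : measurable_fun setT (state_at p).
Proof.
elim: p => [|p IH].
  have m0 : measurable_fun setT (joint (fun r => level r 0 : Omega -> bvec R d)).
    by apply: measurable_joint => r; exact: (measurable_funP (x0 r)).
  have m0' : measurable_fun setT (martingale 0 : Omega -> bvec R d) by exact: measurable_cst.
  exact: (measurable_fun_pair m0 m0').
rewrite (_ : state_at p.+1 = next_state p \o (fun w => (state_at p w, joint (fun r => V r p.+1) w))).
  apply: measurableT_comp; first exact: measurable_next.
  exact: measurable_fun_pair.
by apply/funext => w; rewrite state_atS.
Qed.

Lemma state_indep p : (p < M)%N ->
  indep P (state_at p) (joint (fun r => V r p.+1)).
Proof.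
move=> pM; apply: (@chain_indep _ _ _ P _ _ _ _ state_at
  (fun p => joint (fun r => V r p)) next_state M _ _ _ _ _ p pM).2 => //.
- exact: measurable_state.
- exact: measurable_next.
- exact: state_atS.
have mx0 : measurable_fun setT (joint x0).
  by apply: measurable_joint => r; exact: (measurable_funP (x0 r)).
have mf : measurable_fun setT (fun z : L.-tuple (bvec R d) => (z, 0 : bvec R d)).
  exact: measurable_fun_pair.
exact: (@chain_initial _ _ _ P _ _ _ _ _ _ (joint x0)
  (fun z : L.-tuple (bvec R d) => (z, 0 : bvec R d)) _ M mx0 mf).
Qed.

Lemma state_freeze p (F : state * innov -> R) (G : state -> R) (c : R) :
  (p < M)%N -> measurable_fun setT F -> (forall z, 0 <= F z) ->
  (forall x, mean_le P (fun w => F (x, joint law w)) (G x)) ->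
  mean_le P (fun w => G (state_at p w)) c ->
  mean_le P (fun w => F (state_at p w, joint (fun r => V r p.+1) w)) c.
Proof.
move=> pM mF F0 FG Gc; apply: (mean_le_freeze (Y' := joint law) (G := G)) => //.
- exact: measurable_state.
- exact: mV.
- by apply: measurable_joint => r.
- exact: state_indep.
- by apply: V_law; rewrite pM.
Qed.

Variables (Ch lp : R).
Hypothesis Ch0 : 0 <= Ch.
Hypothesis HC : forall r x, mean_le P (fun w => enorm (H x (law r w)) ^+ 2)
  (Ch * (1 + enorm (x - root r) ^+ 2)).
Hypothesis mono : forall r x, lp * enorm (x - root r) ^+ 2 <= dot (x - root r) (f r x).
Hypothesis g0 : forall p, 0 <= g p.

Let mlaw_coord r (x : 'rV[R]_d) i : measurable_fun setT (fun w => H x (law r w) 0 i).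
Proof. by apply: (@measurable_H_coord _ _ (fun=> x) (law r)). Qed.

(** With the state frozen, strong monotonicity makes the drift contribute
    - 2 lp g |x - root|^2, and the second moment of H adds at most
    Ch g^2 (1 + |x - root|^2). *)
Lemma level_step r p (k a : R) : (p < M)%N -> 0 <= k ->
  1 - 2 * lp * g p.+1 + Ch * g p.+1 ^+ 2 <= k ->
  mean_le P (fun w => enorm (level r p w - root r) ^+ 2) a ->
  mean_le P (fun w => enorm (level r p.+1 w - root r) ^+ 2) (k * a + Ch * g p.+1 ^+ 2).
Proof.
move=> pM k0 kge Ma.
pose F (z : state * innov) :=
  enorm (((tnth z.1.1 r : 'rV[R]_d) - g p.+1 *: H (tnth z.1.1 r) (tnth z.2 r)) - root r) ^+ 2.
pose G (x : state) := k * enorm ((tnth x.1 r : 'rV[R]_d) - root r) ^+ 2 + Ch * g p.+1 ^+ 2.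
have -> : (fun w => enorm (level r p.+1 w - root r) ^+ 2) =
   (fun w => F (state_at p w, joint (fun r => V r p.+1) w)).
  by apply/funext => w; rewrite /F /= !tnth_mktuple.
apply: (state_freeze (G := G)) => //.
- apply: measurable_funX; apply: measurable_enorm => i.
  rewrite (_ : (fun z => _) = (fun z : state * innov =>
     (tnth z.1.1 r : 'rV[R]_d) 0 i - g p.+1 * H (tnth z.1.1 r) (tnth z.2 r) 0 i - root r 0 i)).
    apply: measurable_funB => //; apply: measurable_funB; first exact: measurable_coord_of.
    by apply: measurable_funM => //; exact: measurable_H_coord.
  by apply/funext => z /=; rewrite !mxE.
- by move=> z; rewrite sqr_ge0.
- move=> x; set y : 'rV[R]_d := tnth x.1 r.
  have := mean_le_affine_sqr (mlaw_coord r y) (HC r y) (fE r y) (y - root r) (g p.+1).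
  have -> : (fun w => F (x, joint law w)) =
    (fun w => enorm (y - root r - g p.+1 *: H y (law r w)) ^+ 2).
    by apply/funext => w; rewrite /F /= tnth_mktuple addrAC.
  apply: mean_le_trans; rewrite /G -/y.
  have h1 : g p.+1 * (lp * enorm (y - root r) ^+ 2) <= g p.+1 * dot (y - root r) (f r y).
    by rewrite ler_wpM2l.
  have h2 : (1 - 2 * lp * g p.+1 + Ch * g p.+1 ^+ 2) * enorm (y - root r) ^+ 2 <=
     k * enorm (y - root r) ^+ 2 by rewrite ler_wpM2r ?sqr_ge0.
  lra.
- rewrite (_ : (fun w => _) = (fun w => k * enorm (level r p w - root r) ^+ 2 + Ch * g p.+1 ^+ 2)).
    apply: mean_leD; first exact: mean_leZ.
    by apply: mean_le_cst; rewrite mulr_ge0 ?sqr_ge0.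
  by apply/funext => w; rewrite /G /= tnth_mktuple.
Qed.

Variables (B1 C3 : R).
Hypothesis B10 : 0 <= B1.
Hypothesis C30 : 0 <= C3.
Hypothesis noise_bound : forall x : 'I_L -> 'rV[R]_d,
  mean_le P (fun w => enorm (\sum_r wgt r *: H (x r) (law r w)) ^+ 2)
    (B1 + C3 * \sum_r enorm (x r - root r) ^+ 2).

(** With the state frozen the noise is centred, so there is no cross term and its
    second moment is at most that of the weighted values of H. *)
Lemma mart_step p (k b a : R) : (p < M)%N -> (p0 <= p)%N -> 0 <= k ->
  (forall y, enorm (y - g p.+1 *: (y *m A)) ^+ 2 <= k * enorm y ^+ 2) ->
  mean_le P (fun w => enorm (martingale p w) ^+ 2) b ->
  (forall r, mean_le P (fun w => enorm (level r p w - root r) ^+ 2) a) ->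
  mean_le P (fun w => enorm (martingale p.+1 w) ^+ 2)
    (k * b + g p.+1 ^+ 2 * (B1 + C3 * (L%:R * a))).
Proof.
move=> pM p0p k0 contr Mb Ma.
pose F (z : state * innov) := enorm ((next_state p z).2 : 'rV[R]_d) ^+ 2.
pose G (x : state) := k * enorm (x.2 : 'rV[R]_d) ^+ 2 +
  g p.+1 ^+ 2 * (B1 + C3 * \sum_r enorm ((tnth x.1 r : 'rV[R]_d) - root r) ^+ 2).
have -> : (fun w => enorm (martingale p.+1 w) ^+ 2) =
   (fun w => F (state_at p w, joint (fun r => V r p.+1) w)).
  by apply/funext => w; rewrite /F -state_atS.
apply: (state_freeze (G := G)) => //.
- apply: measurable_funX; apply: measurable_enorm => i.
  apply: measurable_coord_of; apply: (measurableT_comp _ (measurable_next p)) => //.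
- by move=> z; rewrite sqr_ge0.
- move=> x; set m : 'rV[R]_d := x.2; pose th r : 'rV[R]_d := tnth x.1 r.
  pose Y w := \sum_r wgt r *: H (th r) (law r w).
  pose mu := \sum_r wgt r *: f r (th r).
  have mY i : measurable_fun setT (fun w => Y w 0 i).
    rewrite (_ : (fun w => _) = (fun w => \sum_r wgt r * H (th r) (law r w) 0 i)).
      by apply: measurable_sum => r; apply: measurable_funM.
    by apply/funext => w; rewrite summxE; apply: eq_bigr => r _; rewrite mxE.
  have muE i : mu 0 i = fine (\int[P]_w (Y w 0 i)%:E)%E.
    have intH r : P.-integrable setT (fun w => (H (th r) (law r w) 0 i)%:E).
      exact: (coord_integrable (mlaw_coord r (th r)) (HC r (th r))).
    have [_] := integral_linear_comb (index_enum 'I_L) wgt intH (fun r => fE r (th r) i).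
    have -> : (fun w => (\sum_(r <- index_enum 'I_L) wgt r * H (th r) (law r w) 0 i)%:E) =
        (fun w => (Y w 0 i)%:E).
      by apply/funext => w; rewrite summxE; congr _%:E; apply: eq_bigr => r _; rewrite mxE.
    by move=> ->; rewrite summxE /=; apply: eq_bigr => r _; rewrite mxE.
  have := mean_le_centered_sqr mY (noise_bound th) muE (m - g p.+1 *: (m *m A)) (g p.+1).
  have -> : (fun w => F (x, joint law w)) =
    (fun w => enorm (m - g p.+1 *: (m *m A) - g p.+1 *: (Y w - mu)) ^+ 2).
    apply/funext => w; rewrite /F /= ltnNge p0p /=.
    congr (enorm (_ - _ *: _) ^+ 2); rewrite /noise /Y /mu -sumrB.
    by apply: eq_bigr => r _; rewrite tnth_mktuple scalerBr.
  by apply: mean_le_trans; rewrite /G -/m lerD2r contr.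
- rewrite (_ : (fun w => _) = (fun w => k * enorm (martingale p w) ^+ 2 +
     g p.+1 ^+ 2 * (B1 + C3 * \sum_r enorm (level r p w - root r) ^+ 2))).
    apply: mean_leD; first exact: mean_leZ.
    apply: mean_leZ; first exact: sqr_ge0.
    apply: mean_leD; first exact: mean_le_cst.
    apply: mean_leZ => //.
    have -> : L%:R * a = \sum_(r < L) a by rewrite sumr_const card_ord mulr_natl.
    exact: mean_le_sum.
  apply/funext => w; rewrite /G /=; congr (_ + _ * (_ + _ * _)).
  by apply: eq_bigr => r _; rewrite tnth_mktuple.
Qed.

Lemma measurable_level_coord r p i : measurable_fun setT (fun w => level r p w 0 i).
Proof.
apply: (@measurable_coord_of _ Omega d (level r p : Omega -> bvec R d) i).
rewrite (_ : level r p = (fun w => tnth (state_at p w).1 r)).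
  apply: (@measurableT_comp _ _ _ _ _ _ (fun x : L.-tuple (bvec R d) => tnth x r)).
    exact: measurable_tnth.
  exact: (measurableT_comp measurable_fst (measurable_state p)).
by apply/funext => w; rewrite /= tnth_mktuple.
Qed.

Lemma measurable_mart_coord p i : measurable_fun setT (fun w => martingale p w 0 i).
Proof.
apply: (@measurable_coord_of _ Omega d (martingale p : Omega -> bvec R d) i).
exact: (measurableT_comp measurable_snd (measurable_state p)).
Qed.

Lemma measurable_residual_enorm p : measurable_fun setT (fun w => enorm (residual p w)).
Proof.
apply: measurable_enorm => i.
rewrite (_ : (fun w => _) = (fun w => \sum_r wgt r * (level r p w 0 i - root r 0 i) -
   martingale p w 0 i)).
  apply: measurable_funB; last exact: measurable_mart_coord.
  apply: measurable_sum => r; apply: measurable_funM => //.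
  by apply: measurable_funB => //; exact: measurable_level_coord.
apply/funext => w; rewrite !mxE summxE; congr (_ - _).
by apply: eq_bigr => r _; rewrite !mxE.
Qed.

Variables (eps K : R).
Hypothesis eps0 : 0 <= eps.
Hypothesis K0 : 0 <= K.
Hypothesis linearization : forall r x,
  enorm (f r x - (x - root r) *m A) <= eps * enorm (x - root r) + K * enorm (x - root r) ^+ 2.

(** The innovations cancel between the weighted error and its martingale part:
    the residual is driven by the distance of the fields to their common linear
    part. *)
Lemma residual_rec p w : (p0 <= p)%N ->
  residual p.+1 w = residual p w - g p.+1 *: (residual p w *m A) -
    g p.+1 *: \sum_r wgt r *: (f r (level r p w) - (level r p w - root r) *m A).
Proof.
move=> p0p; rewrite /residual /= ltnNge p0p /=.
set m := martingale p w.
have -> : weighted_error p.+1 w = weighted_error p w -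
    g p.+1 *: \sum_r wgt r *: H (level r p w) (V r p.+1 w).
  rewrite /weighted_error scaler_sumr -sumrB; apply: eq_bigr => r _ /=.
  by rewrite scalerA mulrC -scalerA -scalerBr addrAC.
set S := \sum_r wgt r *: H _ _.
have -> : noise (fun r => level r p w) (fun r => V r p.+1 w) =
    S - \sum_r wgt r *: f r (level r p w).
  by rewrite /noise /S -sumrB; apply: eq_bigr => r _; rewrite scalerBr.
have -> : \sum_r wgt r *: (f r (level r p w) - (level r p w - root r) *m A) =
    \sum_r wgt r *: f r (level r p w) - weighted_error p w *m A.
  rewrite /weighted_error mulmx_suml -sumrB; apply: eq_bigr => r _.
  by rewrite scalerBr scalemxAl.
set T := \sum_r wgt r *: f _ _; set e := weighted_error p w.
rewrite mulmxBl; set eA := e *m A; set mA := m *m A.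
apply/rowP => i; rewrite !mxE; ring.
Qed.

Lemma residual_step p (k c a : R) : (p0 <= p)%N -> 0 <= k ->
  (forall y, enorm (y - g p.+1 *: (y *m A)) <= k * enorm y) ->
  mean_le P (fun w => enorm (residual p w)) c ->
  (forall r, mean_le P (fun w => eps * enorm (level r p w - root r) +
     K * enorm (level r p w - root r) ^+ 2) a) ->
  mean_le P (fun w => enorm (residual p.+1 w))
    (k * c + g p.+1 * ((\sum_r `|wgt r|) * a)).
Proof.
move=> p0p k0 contr Mc Ma.
have M1 : mean_le P (fun w => k * enorm (residual p w) + g p.+1 * \sum_r `|wgt r| *
     (eps * enorm (level r p w - root r) + K * enorm (level r p w - root r) ^+ 2))
    (k * c + g p.+1 * ((\sum_r `|wgt r|) * a)).
  apply: mean_leD; first exact: mean_leZ.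
  apply: mean_leZ => //; rewrite mulr_suml; apply: mean_le_sum => r.
  exact: mean_leZ.
apply: mean_le_mono M1.
- exact: measurable_residual_enorm.
- by move=> w; exact: enorm_ge0.
move=> w; rewrite residual_rec//.
apply: le_trans (enormB _ _) _; rewrite lerD// enormZ ger0_norm// ler_wpM2l//.
apply: le_trans (enorm_sum _ _ _) _; apply: ler_sum => r _.
by rewrite enormZ ler_wpM2l.
Qed.

Variables (lambda a0 C2 : R) (p1 : nat).
Let s (p : nat) : R := Num.sqrt (g p).
Hypothesis s0 : forall p, 0 < s p.
Hypothesis init : forall r, mean_le P (fun w => enorm (level r 0 w - root r) ^+ 2) a0.
Hypothesis C20 : 0 <= C2.
Hypothesis decay_a : forall p, 0 <= second_moment_seq gamma lambda Ch a0 p1 p <= C2 * g p.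
Hypothesis step_p1 : forall p, (p1 <= p)%N ->
  1 - 2 * lp * g p.+1 + Ch * g p.+1 ^+ 2 <= expR (- (2 * lambda) * g p.+1).
Hypothesis lp0 : 0 <= lp.
Hypothesis g_le : forall p, g p.+1 <= g 0%N.

Lemma mean_le_level r p : (p <= M)%N ->
  mean_le P (fun w => enorm (level r p w - root r) ^+ 2) (C2 * g p).
Proof.
move=> pM; have /andP[_ le] := decay_a p; apply: mean_le_trans le _.
elim: p pM => [|p IH] pM; first exact: init.
rewrite [second_moment_seq _ _ _ _ _ _]/=; apply: level_step => //; last exact: IH (ltnW pM).
  by case: ifP => _; rewrite ?expR_ge0// addr_ge0// mulr_ge0// sqr_ge0.
case: ifPn => [_|]; last by rewrite -leqNgt => /step_p1.
have h1 : 0 <= 2 * lp * g p.+1 by rewrite !mulr_ge0.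
have h2 : Ch * g p.+1 ^+ 2 <= Ch * g 0%N ^+ 2.
  by rewrite ler_wpM2l// ler_sqr ?nnegrE.
rewrite -/(g 0%N); lra.
Qed.

Hypothesis contraction : forall p y, (p0 <= p)%N ->
  enorm (y - g p.+1 *: (y *m A)) ^+ 2 <= expR (- (2 * lambda) * g p.+1) * enorm y ^+ 2.

Lemma mean_le_mart p : (p <= M)%N ->
  mean_le P (fun w => enorm (martingale p w) ^+ 2)
    (martingale_seq gamma lambda B1 (C3 * L%:R) C2 p0 p).
Proof.
elim: p => [|p IH] pM.
  have -> : (fun w => enorm (martingale 0 w) ^+ 2) = (fun=> 0).
    by apply/funext => w; rewrite enorm0 expr0n.
  exact: mean_le_cst.
rewrite [martingale_seq _ _ _ _ _ _ _]/=; case: ifPn => [pp0|].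
  have -> : (fun w => enorm (martingale p.+1 w) ^+ 2) = (fun=> 0).
    by apply/funext => w; rewrite /= pp0 enorm0 expr0n.
  exact: mean_le_cst.
rewrite -leqNgt => p0p; rewrite -[C3 * _ * _]mulrA.
apply: mart_step => //; rewrite ?expR_ge0//.
- by move=> y; exact: contraction.
- exact: IH (ltnW pM).
- by move=> r; apply: mean_le_level; exact: ltnW.
Qed.

(** From x <= s + x^2 / s, where s^2 has the order of the mean of x^2. *)
Lemma mean_le_level1 r p : (p <= M)%N ->
  mean_le P (fun w => enorm (level r p w - root r)) ((1 + C2) * s p).
Proof.
move=> pM; have sp := s0 p.
have M1 := mean_leD (mean_le_cst P (ltW sp)) (mean_leZ (_ : 0 <= (s p)^-1) (mean_le_level r pM)).
have {}M1 := M1 (ltac:(by rewrite invr_ge0 ltW)).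
apply: (@mean_le_trans _ _ _ _ _ (s p + (s p)^-1 * (C2 * g p))).
  have -> : g p = s p ^+ 2 by rewrite sqr_sqrtr.
  by rewrite le_eqVlt; apply/orP; left; apply/eqP; field; rewrite gt_eqF.
apply: mean_le_mono M1.
- apply: measurable_enorm => i; under eq_fun do rewrite !mxE.
  by apply: measurable_funB => //; exact: measurable_level_coord.
- by move=> w; exact: enorm_ge0.
move=> w; set x := enorm _.
rewrite -(ler_pM2l sp) mulrDr mulrA mulfV ?gt_eqF// mul1r.
have := sqr_ge0 (s p - x); have := sqr_ge0 x; have := sqr_ge0 (s p).
have : 0 <= x by exact: enorm_ge0.
nra.
Qed.

Lemma weighted_error_le p w :
  enorm (weighted_error p w) <= \sum_r `|wgt r| * enorm (level r p w - root r).
Proof.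
apply: le_trans (enorm_sum _ _ _) _; apply: ler_sum => r _.
by rewrite enormZ.
Qed.

Let W := \sum_r `|wgt r|.

Hypothesis s_le : forall p, s p <= s 0%N.

Lemma mart0 p w : (p <= p0)%N -> martingale p w = 0.
Proof. by case: p => [|p] //= ->. Qed.

Lemma mean_le_residual p : (p <= M)%N ->
  mean_le P (fun w => enorm (residual p w))
    (residual_seq gamma lambda eps K W C2 (W * ((1 + C2) * s 0%N)) p0 p).
Proof.
have start i : (i <= p0)%N -> (i <= M)%N ->
    mean_le P (fun w => enorm (residual i w)) (W * ((1 + C2) * s 0%N)).
  move=> ip0 iM.
  have M1 : mean_le P (fun w => \sum_r `|wgt r| * enorm (level r i w - root r))
      (W * ((1 + C2) * s 0%N)).
    rewrite /W mulr_suml; apply: mean_le_sum => r; apply: mean_leZ => //.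
    apply: mean_le_trans (mean_le_level1 r iM).
    by rewrite ler_wpM2l// addr_ge0.
  apply: mean_le_mono M1.
  - exact: measurable_residual_enorm.
  - by move=> w; exact: enorm_ge0.
  - by move=> w; rewrite /residual mart0// subr0 weighted_error_le.
elim: p => [|p IH] pM; first exact: start.
rewrite [residual_seq _ _ _ _ _ _ _ _ _]/=; case: ifPn => [pp0|]; first exact: start.
rewrite -leqNgt => p0p.
apply: residual_step => //; rewrite ?expR_ge0//.
- move=> y; rewrite -ler_sqr ?nnegrE ?mulr_ge0 ?expR_ge0 ?enorm_ge0//.
  rewrite exprMn -expRM_natl (_ : 2%:R * (- lambda * g p.+1) = - (2 * lambda) * g p.+1).
    exact: contraction.
  by ring.
- exact: IH (ltnW pM).
- move=> r; apply: mean_leD; apply: mean_leZ => //.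
    exact: mean_le_level1 (ltnW pM).
  exact: mean_le_level (ltnW pM).
Qed.

(** The inequality x <= (tau + x^2 / tau) / 2 passes from the second moment of the
    martingale part to its mean. *)
Lemma mean_le_weighted_error (b c : R) :
  martingale_seq gamma lambda B1 (C3 * L%:R) C2 p0 M <= b ->
  residual_seq gamma lambda eps K W C2 (W * ((1 + C2) * s 0%N)) p0 M <= c ->
  forall tau, 0 < tau ->
  mean_le P (fun w => enorm (weighted_error M w)) ((tau + b / tau) / 2 + c).
Proof.
move=> hb hc tau tau0.
have Mb := mean_le_trans hb (mean_le_mart (leqnn M)).
have Mc := mean_le_trans hc (mean_le_residual (leqnn M)).
have M1 : mean_le P (fun w => 2^-1 * (tau + tau^-1 * enorm (martingale M w) ^+ 2) +
    enorm (residual M w)) ((tau + b / tau) / 2 + c).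
  apply: mean_leD => //.
  have -> : (tau + b / tau) / 2 = 2^-1 * (tau + tau^-1 * b) by rewrite mulrC [b / _]mulrC.
  apply: mean_leZ; first by rewrite invr_ge0.
  apply: mean_leD; first by apply: mean_le_cst; exact: ltW.
  by apply: mean_leZ; first by rewrite invr_ge0 ltW.
apply: mean_le_mono M1.
- apply: measurable_enorm => i.
  rewrite (_ : (fun w => _) = (fun w => \sum_r wgt r * (level r M w 0 i - root r 0 i))).
    apply: measurable_sum => r; apply: measurable_funM => //.
    by apply: measurable_funB => //; exact: measurable_level_coord.
  by apply/funext => w; rewrite summxE; apply: eq_bigr => r _; rewrite !mxE.
- by move=> w; exact: enorm_ge0.
move=> w; have -> : weighted_error M w = martingale M w + residual M w.
  by rewrite /residual addrC subrK.
apply: le_trans (enormD _ _) _; rewrite lerD2r.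
set x := enorm _.
have -> : 2^-1 * (tau + tau^-1 * x ^+ 2) = (tau ^+ 2 + x ^+ 2) / (2 * tau).
  by field; rewrite gt_eqF.
rewrite ler_pdivlMr ?mulr_gt0//; have := sqr_ge0 (tau - x); nra.
Qed.

End coupled_schemes.

(** * Zeros and derivatives of the approximate fields *)

Section regularity.
Context {R : realType} {d : nat}.
Local Notation V := 'rV[R]_d.

Lemma cvg_powRN (b : R) : 0 < b -> (n%:R : R) `^ (- b) @[n --> \oo] --> 0.
Proof.
move=> b0; apply/cvgrPdist_le => e e0.
pose T := e^-1 `^ b^-1.
exists (Num.bound T).+1 => // n /= Tn.
rewrite sub0r normrN ger0_norm ?powR_ge0// powRN -[leRHS]invrK.
have n0 : (0 : R) < n%:R by rewrite ltr0n; apply: leq_trans Tn.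
rewrite lef_pV2 ?posrE ?powR_gt0 ?invr_gt0//.
have -> : e^-1 = T `^ b by rewrite /T -powRrM mulVf ?gt_eqF// powRr1// invr_ge0 ltW.
rewrite ge0_ler_powR ?nnegrE ?powR_ge0 ?(ltW b0)//.
apply: le_trans (ltW (archi_boundP _)) _; first exact: powR_ge0.
by rewrite ler_nat; exact: ltnW.
Qed.

Variables (alpha : R) (L : nat) (h : V -> V) (hn : nat -> V -> V).
Variables (thstar : V) (thstarn : nat -> V) (lambda : R).
Hypothesis lambda0 : 0 < lambda.
Hypothesis L0 : (0 < L)%N.
Hypothesis alpha0 : 0 < alpha.
Hypothesis hHR : HR alpha L h hn thstar.
Hypothesis hHUA : HUA hn lambda.
Hypothesis h0 : h thstar = 0.
Hypothesis hn0 : forall n, (0 < n)%N -> hn n (thstarn n) = 0.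

(** Every term in the expansion of h - hn at the zero of h has a negative order
    in n. *)
Lemma field_cvg : enorm (hn n thstar) @[n --> \oo] --> 0.
Proof.
have [[Lam /(_ thstar) HLam] _ _ _] := hHR.
set r := (fun n => _) in HLam.
have rle : \forall n \near \oo, `|r n| <= n%:R `^ (- (alpha * L%:R)).
  have /eqoP/(_ _ ltr01) := HLam; apply: filterS => n /=.
  by rewrite mul1r [ `|_ : R^o|]ger0_norm ?powR_ge0.
pose B (n : nat) : R := d%:R * n%:R `^ (- (alpha * L%:R)) +
  \sum_(1 <= j < L.+1) n%:R `^ (- (alpha * j%:R)) * enorm (Lam j thstar).
have Bcvg : B n @[n --> \oo] --> 0.
  have c1 : d%:R * (n%:R : R) `^ (- (alpha * L%:R)) @[n --> \oo] --> d%:R * (0 : R).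
    by apply: cvgMl_tmp; apply: cvg_powRN; rewrite mulr_gt0// ltr0n.
  have c2 : (\sum_(1 <= j < L.+1) (n%:R : R) `^ (- (alpha * j%:R)) * enorm (Lam j thstar))
     @[n --> \oo] --> 0.
    have z : \sum_(j <- index_iota 0 L) (0 : R) = 0 by rewrite big1.
    rewrite (_ : (fun n => _) = (fun n : nat => \sum_(j <- index_iota 0 L)
        (n%:R : R) `^ (- (alpha * j.+1%:R)) * enorm (Lam j.+1 thstar))); last first.
      by apply/funext => n; rewrite big_add1.
    rewrite -[X in _ --> X]z; apply: cvg_sumr => j.
    rewrite -[X in _ --> X](mul0r (enorm (Lam j.+1 thstar))).
    by apply: cvgMr_tmp; apply: cvg_powRN; rewrite mulr_gt0// ltr0n.
  by have := cvgD c1 c2; rewrite mulr0 addr0; exact.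
apply: (@squeeze_cvgr _ _ _ _ (fun=> 0) B) => //; last exact: cvg_cst.
apply: filterS rle => n rn; rewrite enorm_ge0/=.
have -> : hn n thstar = - (r n + \sum_(1 <= j < L.+1) n%:R `^ (- (alpha * j%:R)) *: Lam j thstar).
  by rewrite /r h0 sub0r subrK opprK.
rewrite enormN; apply: le_trans (enormD _ _) _; apply: lerD.
  by apply: le_trans (enorm_le_norm _) _; rewrite ler_wpM2l.
apply: le_trans (enorm_sum _ _ _) _; apply: ler_sum => j _.
by rewrite enormZ ger0_norm ?powR_ge0.
Qed.

(** The convergence of first derivatives is read at one point, on the canonical
    basis. *)
Lemma jacobian_cvg : mxsum ('J (hn n) thstar - 'J h thstar) @[n --> \oo] --> 0.
Proof.
have [_ _ /(_ 1%N) H3 _] := hHR.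
have [B Bnbhs HB] := H3 L0 thstar.
have Bth := nbhs_singleton Bnbhs.
apply/cvgrPdist_le => e e0.
have e1 : 0 < e / ((d * d)%:R + 1) by rewrite divr_gt0// ltr_wpDl.
apply: filterS (HB _ e1) => n /(_ thstar Bth) Hn.
rewrite sub0r normrN ger0_norm ?mxsum_ge0//.
have Jij i j : `|('J (hn n) thstar - 'J h thstar) i j| <= e / ((d * d)%:R + 1).
  have := Hn [tuple (delta_mx 0 i : 'rV[R]_d)] _.
  move=> hop; apply: le_trans (hop _); last first.
    move=> k; rewrite (ord1 k) tnth0 /=.
    rewrite enormE /dot (bigD1 i)//= big1 ?addr0.
      by rewrite mxE !eqxx mulr1 sqrtr1.
    by move=> l li; rewrite mxE eqxx/= (negbTE li) mulr0.
  by apply: le_trans (coord_le_enorm _ j); rewrite !mxE.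
apply: le_trans (ler_sum _ (fun i _ => ler_sum _ (fun j _ => Jij i j))) _.
rewrite sumr_const sumr_const !card_ord -mulrnA -[leLHS]mulr_natr mulrAC.
by rewrite ler_pdivrMr ?ltr_wpDl// ler_wpM2l ?(ltW e0)// lerDl.
Qed.

(** Extracts the margin above lambda in which the quadratic terms of the
    recursions are absorbed. *)
Lemma HUA_bound : exists2 lp, lambda < lp & forall n x, (0 < n)%N ->
  lp <= lambda_min (2^-1 *: ('J (hn n) x + ('J (hn n) x)^T)).
Proof.
have [_ _] := hHUA; set E := [set z | _].
have Elb n x : (0 < n)%N ->
   (ereal_inf E <= (lambda_min (2^-1 *: ('J (hn n) x + ('J (hn n) x)^T)))%:E)%E.
  by move=> n0; apply: ereal_inf_lbound; exists n, x.
case: (ereal_inf E) Elb => [i| |] // Elb li.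
  by exists i; rewrite -?lte_fin// => n x n0; rewrite -lee_fin; exact: Elb.
by have := Elb 1%N 0 isT.
Qed.

(** All that the schemes require from the fields. By strong monotonicity, the
    distance of the two zeros is at most |h^n| / lp taken at the zero of h, so the
    zeros converge. The Jacobian of h^n at its zero is then close to the Jacobian of
    h at its own, which gives the slope eps n, and equi-Lipschitz Jacobians give a
    quadratic remainder with a constant K common to all n. *)
Lemma field_regularity : exists lp K : R, [/\ lambda < lp, 0 <= K &
  [/\ forall n x, (0 < n)%N -> differentiable (hn n) x,
      forall n x, (0 < n)%N ->
        lp * enorm (x - thstarn n) ^+ 2 <= dot (x - thstarn n) (hn n x),
      forall y, lp * enorm y ^+ 2 <= dot y (y *m 'J h thstar),
      enorm (thstarn n - thstar) @[n --> \oo] --> 0 &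
      exists eps : nat -> R, [/\ forall n, 0 <= eps n, eps n @[n --> \oo] --> 0 &
        forall n x, (0 < n)%N ->
          enorm (hn n x - (x - thstarn n) *m 'J h thstar) <=
            eps n * enorm (x - thstarn n) + K * enorm (x - thstarn n) ^+ 2]]].
Proof.
have [lp llp lpmin] := HUA_bound.
have lp0 : 0 < lp by apply: lt_trans llp.
have [C1 [k Hk] _] := hHUA.
have df n x : (0 < n)%N -> differentiable (hn n) x.
  by move=> n0; have [H1 _] := C1 n n0; exact: (H1 [::] isT x).
pose K := (d * d)%:R * `|k|.
have K0 : 0 <= K by rewrite mulr_ge0.
have Jlip n : (0 < n)%N -> forall z z', mxsum ('J (hn n) z - 'J (hn n) z') <= K * enorm (z - z').
  by move=> n0; apply: jacobian_lip => z z'; exact: (Hk n n0 (z, z') (conj I I)).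
have mono n x : (0 < n)%N ->
    lp * enorm (x - thstarn n) ^+ 2 <= dot (x - thstarn n) (hn n x).
  move=> n0; have := strong_monotone (fun z => df n z n0) (fun z => lpmin n z n0)
    (thstarn n) (x - thstarn n).
  by rewrite [thstarn n + _]addrC subrK hn0// subr0 dotC.
have root_cvg : enorm (thstarn n - thstar) @[n --> \oo] --> 0.
  have c1 : lp^-1 * enorm (hn n thstar) @[n --> \oo] --> lp^-1 * (0 : R).
    by apply: cvgMl_tmp; exact: field_cvg.
  rewrite mulr0 in c1.
  apply: (@squeeze_cvgr _ _ _ _ (fun=> 0) _ _ _ _ _ c1); last exact: cvg_cst.
  exists 1%N => // n /= n0; rewrite enorm_ge0/= enorm_dist.
  have := mono n thstar n0; set y := enorm _ => h1.
  have h2 := le_trans h1 (cauchy_schwarz _ _); rewrite -/y in h2.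
  have y0 : 0 <= y by exact: enorm_ge0.
  have [->|yn0] := eqVneq y 0; first by rewrite mulr_ge0 ?enorm_ge0// invr_ge0 ltW.
  have ygt : 0 < y by rewrite lt_neqAle eq_sym yn0.
  rewrite -(ler_pM2l lp0) mulrA mulfV ?gt_eqF// mul1r -(ler_pM2l ygt).
  by apply: le_trans h2; rewrite expr2 mulrCA.
pose eps n := mxsum ('J (hn n) thstar - 'J h thstar) + K * enorm (thstarn n - thstar).
have eps_cvg : eps n @[n --> \oo] --> 0.
  have c2 : K * enorm (thstarn n - thstar) @[n --> \oo] --> K * (0 : R).
    by apply: cvgMl_tmp; exact: root_cvg.
  by have := cvgD jacobian_cvg c2; rewrite mulr0 addr0; exact.
have mxsumD (X Y : 'M[R]_d) : mxsum (X + Y) <= mxsum X + mxsum Y.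
  rewrite /mxsum -big_split; apply: ler_sum => i _; rewrite -big_split.
  by apply: ler_sum => j _; rewrite mxE ler_normD.
exists lp, K; split => //; split => //.
- move=> y; apply/ler_addgt0Pr => e e0.
  have e1 : 0 < e / (enorm y ^+ 2 + 1) by rewrite divr_gt0// ltr_wpDl// sqr_ge0.
  have /cvgrPdist_le/(_ _ e1)[N _ HN] := jacobian_cvg.
  have := HN N.+1 (leqnSn N); rewrite /= sub0r normrN ger0_norm ?mxsum_ge0//.
  set D := _ - _ => hD.
  have h1 := le_trans (ler_wpM2r (dotxx_ge0 y) (lpmin N.+1 thstar isT))
    (lambda_min_sym_part ('J (hn N.+1) thstar) y).
  rewrite enorm_sqr; apply: le_trans h1 _.
  have -> : 'J (hn N.+1) thstar = 'J h thstar + D by rewrite /D addrC subrK.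
  rewrite mulmxDr dotDr lerD2l; apply: le_trans (cauchy_schwarz _ _) _.
  apply: (@le_trans _ _ (enorm y * (e / (enorm y ^+ 2 + 1) * enorm y))).
    rewrite ler_wpM2l ?enorm_ge0//; apply: le_trans (enorm_mulmx _ _) _.
    by rewrite ler_wpM2r ?enorm_ge0.
  have -> : enorm y * (e / (enorm y ^+ 2 + 1) * enorm y) =
     e * (enorm y ^+ 2 / (enorm y ^+ 2 + 1)).
    by field; rewrite gt_eqF// ltr_wpDl// sqr_ge0.
  by rewrite ler_piMr ?(ltW e0)// ler_pdivrMr ?ltr_wpDl ?sqr_ge0// mul1r lerDl.
- exists eps; split => //.
    by move=> n; rewrite addr_ge0 ?mxsum_ge0// mulr_ge0 ?enorm_ge0.
  move=> n x n0; set y := x - thstarn n.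
  have q1 := quadratic_remainder (fun z => df n z n0) K0 (Jlip n n0) (thstarn n) y.
  rewrite hn0// subr0 [thstarn n + y]addrC subrK in q1.
  have -> : hn n x - y *m 'J h thstar = (hn n x - y *m 'J (hn n) (thstarn n)) +
     y *m ('J (hn n) (thstarn n) - 'J h thstar).
    by rewrite mulmxBr addrA subrK.
  apply: le_trans (enormD _ _) _; rewrite addrC lerD//.
  apply: le_trans (enorm_mulmx _ _) _; rewrite ler_wpM2r ?enorm_ge0//.
  have -> : 'J (hn n) (thstarn n) - 'J h thstar =
    ('J (hn n) thstar - 'J h thstar) + ('J (hn n) (thstarn n) - 'J (hn n) thstar).
    by rewrite [RHS]addrC addrA subrK.
  by apply: le_trans (mxsumD _ _) _; rewrite lerD2l Jlip.
Qed.

End regularity.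

(** * The asymptotic noise level *)

Section tails.
Context {R : realType}.

(** The supremum of the tail is nonincreasing, and a harmonic term makes it
    positive. *)
Lemma nonincreasing_majorant (psi : nat -> R) :
  (forall M, 0 <= psi M) -> psi M @[M --> \oo] --> 0 ->
  exists phi : nat -> R, [/\ forall M, 0 < phi M, phi M @[M --> \oo] --> 0,
    nonincreasing_seq phi & forall M, psi M <= phi M].
Proof.
move=> psi0 psicvg.
have [B psiB] : exists B : R, forall p, psi p <= B.
  have /cvg_seq_bounded[B [Breal HB]] : cvgn psi by apply/cvg_ex; exists 0.
  exists (`|B| + 1) => p; apply: le_trans (ler_norm _) _; apply: HB => //.
  by rewrite (le_lt_trans (ler_norm _))// ltrDl.
pose T M := [set psi k | k in [set k | (M <= k)%N]].
have Tsup M : has_sup (T M).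
  split; first by exists (psi M), M => /=.
  by exists B => _ [k _ <-].
have supT M k : (M <= k)%N -> psi k <= sup (T M).
  by move=> Mk; apply: ub_le_sup; [exact: (Tsup M).2|exists k].
exists (fun M => sup (T M) + M.+1%:R^-1); split.
- by move=> M; rewrite ltr_wpDl ?invr_gt0// (le_trans (psi0 M))// supT.
- have c1 : sup (T M) @[M --> \oo] --> 0.
    apply/cvgrPdist_le => e e0; move/cvgrPdist_le : psicvg => /(_ _ e0)[N _ HN].
    exists N => // M /= NM; rewrite sub0r normrN ger0_norm; last first.
      by rewrite (le_trans (psi0 M))// supT.
    apply: ge_sup; first exact: (Tsup M).1.
    move=> _ [k /= Mk <-]; have := HN k (leq_trans NM Mk).
    by rewrite /= sub0r normrN ger0_norm.
  by have := cvgD c1 (@cvg_harmonic R); rewrite addr0; exact.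
- move=> M N MN; apply: lerD; last by rewrite lef_pV2 ?posrE// ler_nat.
  apply: ge_sup; first exact: (Tsup N).1.
  by move=> _ [k /= Nk <-]; apply: supT; exact: leq_trans MN Nk.
- by move=> M; rewrite (le_trans (supT M M (leqnn M)))// lerDl.
Qed.

Lemma cvg_dilation (u : nat -> R) (k : nat) (l : R) : (0 < k)%N ->
  u n @[n --> \oo] --> l -> u (k * n)%N @[n --> \oo] --> l.
Proof.
move=> k0 /cvgrPdist_le ul; apply/cvgrPdist_le => e /ul[N _ HN].
by exists N => // n /= Nn; apply: HN; rewrite /= (leq_trans Nn)// leq_pmull.
Qed.

End tails.

Section noise.
Context {R : realType} {disp : measure_display} {Omega : measurableType disp}.
Variable P : probability Omega R.
Context {d q L : nat}.
Variables (H : 'rV[R]_d -> 'rV[R]_q -> 'rV[R]_d) (wgt : 'I_L -> R).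
Variables (law : 'I_L -> {RV P >-> bvec R q}) (xs : 'rV[R]_d) (root : 'I_L -> 'rV[R]_d).
Hypothesis mH : measurable_fun [set: bvec R d * bvec R q]
    (fun z : bvec R d * bvec R q => H z.1 z.2 : bvec R d).
Let W := \sum_r `|wgt r|.

Lemma measurable_H_law r x i : measurable_fun setT (fun w => H x (law r w) 0 i).
Proof. by apply: (@measurable_H_coord R d q H mH _ _ (fun=> x) (law r)). Qed.

(** The weighted sum is compared with its value at xs by
    (x + y)^2 <= 2 x^2 + 2 y^2. The Holder bound on the difference is then traded
    for eta and squared distances, and the distance to xs is split at root r. *)
Lemma noise_second_moment (a Cg E1 eta Ke : R) : 0 <= Cg -> 0 <= Ke ->
  (forall r x y, mean_le P (fun w => enorm (H x (law r w) - H y (law r w)) ^+ 2)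
     (Cg * enorm (x - y) `^ (2 * a))) ->
  mean_le P (fun w => enorm (\sum_r wgt r *: H xs (law r w)) ^+ 2) E1 ->
  (forall t, 0 <= t -> t `^ (2 * a) <= eta + Ke * t ^+ 2) ->
  forall x : 'I_L -> 'rV[R]_d,
  mean_le P (fun w => enorm (\sum_r wgt r *: H (x r) (law r w)) ^+ 2)
    (2 * E1 + 2 * (W ^+ 2 * (Cg * (L%:R * eta))) +
      4 * W ^+ 2 * Cg * Ke * (\sum_r enorm (root r - xs) ^+ 2) +
      4 * W ^+ 2 * Cg * Ke * \sum_r enorm (x r - root r) ^+ 2).
Proof.
move=> Cg0 Ke0 HG HE Heta x.
have W0 : 0 <= W ^+ 2 by rewrite sqr_ge0.
have M1 : mean_le P (fun w => 2 * enorm (\sum_r wgt r *: H xs (law r w)) ^+ 2 +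
    2 * (W ^+ 2 * \sum_r enorm (H (x r) (law r w) - H xs (law r w)) ^+ 2))
    (2 * E1 + 2 * (W ^+ 2 * \sum_r Cg * enorm (x r - xs) `^ (2 * a))).
  apply: mean_leD; first exact: mean_leZ.
  by apply: mean_leZ => //; apply: mean_leZ => //; apply: mean_le_sum => r.
apply: (@mean_le_trans _ _ _ _ _ (2 * E1 + 2 * (W ^+ 2 * \sum_r Cg * enorm (x r - xs) `^ (2 * a)))).
  rewrite -!addrA lerD2l.
  have -> : 2 * (W ^+ 2 * (Cg * (L%:R * eta))) +
     (4 * W ^+ 2 * Cg * Ke * (\sum_r enorm (root r - xs) ^+ 2) +
      4 * W ^+ 2 * Cg * Ke * \sum_r enorm (x r - root r) ^+ 2) =
     2 * (W ^+ 2 * \sum_r Cg * (eta + Ke *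
       (2 * enorm (x r - root r) ^+ 2 + 2 * enorm (root r - xs) ^+ 2))).
    rewrite -mulr_sumr big_split /= -mulr_sumr big_split /= -!mulr_sumr.
    by rewrite sumr_const card_ord -[eta *+ L]mulr_natl; ring.
  rewrite ler_wpM2l// ler_wpM2l//; apply: ler_sum => r _; rewrite ler_wpM2l//.
  apply: le_trans (Heta _ (enorm_ge0 _)) _; rewrite lerD2l ler_wpM2l//.
  have -> : x r - xs = (x r - root r) + (root r - xs) by rewrite addrA subrK.
  have h : enorm (x r - root r + (root r - xs)) ^+ 2 <=
      (enorm (x r - root r) + enorm (root r - xs)) ^+ 2.
    by rewrite ler_sqr ?nnegrE ?addr_ge0 ?enorm_ge0// enormD.
  apply: le_trans h _.
  have := sqr_ge0 (enorm (x r - root r) - enorm (root r - xs)); nra.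
apply: mean_le_mono M1.
- apply: measurable_funX; apply: measurable_weighted_enorm => r i.
  exact: measurable_H_law.
- by move=> w; rewrite sqr_ge0.
move=> w.
have -> : \sum_r wgt r *: H (x r) (law r w) = \sum_r wgt r *: H xs (law r w) +
    \sum_r wgt r *: (H (x r) (law r w) - H xs (law r w)).
  by rewrite -big_split /=; apply: eq_bigr => r _; rewrite -scalerDr addrC subrK.
set A := \sum_r wgt r *: H xs _; set D := \sum_r wgt r *: (_ - _).
have hD : enorm D ^+ 2 <= W ^+ 2 * \sum_r enorm (H (x r) (law r w) - H xs (law r w)) ^+ 2.
  exact: weighted_enorm_sqr_le.
have h : enorm (A + D) ^+ 2 <= (enorm A + enorm D) ^+ 2.
  by rewrite ler_sqr ?nnegrE ?addr_ge0 ?enorm_ge0// enormD.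
apply: le_trans h _; have := sqr_ge0 (enorm A - enorm D); nra.
Qed.

End noise.

Section transfer.
Context {R : realType} {disp : measure_display} {Omega : measurableType disp}.
Variable P : probability Omega R.

Lemma same_law_integral_signed {d1} {T1 : measurableType d1} (X Y : {RV P >-> T1})
    (F : T1 -> R) :
  same_law P X Y -> measurable_fun setT F ->
  P.-integrable setT (fun w => (F (X w))%:E) -> P.-integrable setT (fun w => (F (Y w))%:E) ->
  (\int[P]_w (F (X w))%:E = \int[P]_w (F (Y w))%:E)%E.
Proof.
move=> XY mF iX iY; have mEF : measurable_fun setT (EFin \o F) by exact/measurable_EFinP.
transitivity (\int[distribution P X]_z (F z)%:E)%E; first by rewrite integral_distribution.
transitivity (\int[distribution P Y]_z (F z)%:E)%E; last by rewrite integral_distribution.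
by apply: eq_measure_integral => S mS _; exact: XY.
Qed.

Lemma ereal_bound (x : \bar R) : (x < +oo)%E -> exists2 c : R, 0 <= c & (x <= c%:E)%E.
Proof.
case: x => [r _| |_] //; last by exists 0 => //; rewrite leNye.
by exists `|r| => //; rewrite lee_fin ler_norm.
Qed.

Lemma mean_le_same_law {d1} {T1 : measurableType d1} (X Y : {RV P >-> T1}) (F : T1 -> R) c :
  same_law P X Y -> measurable_fun setT F -> (forall z, 0 <= F z) ->
  ('E_P[fun w => F (Y w)] <= c%:E)%E -> mean_le P (fun w => F (X w)) c.
Proof.
move=> XY mF F0; rewrite unlock => Yc; split => //.
  by apply: (measurableT_comp mF).
rewrite (same_law_integral (X := X) (Y := Y) (F := fun z => (F z)%:E))//.
exact/measurable_EFinP.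
Qed.

End transfer.

Section moments.
Context {R : realType} {disp : measure_display} {Omega : measurableType disp}.
Variable P : probability Omega R.
Context {d q : nat}.
Variables (H : 'rV[R]_d -> 'rV[R]_q -> 'rV[R]_d).
Variables (Un : nat -> {RV P >-> bvec R q}) (thstarn : nat -> 'rV[R]_d).
Hypothesis mH : measurable_fun [set: bvec R d * bvec R q]
    (fun z : bvec R d * bvec R q => H z.1 z.2 : bvec R d).

Lemma measurable_H x : measurable_fun [set: bvec R q] (fun u : bvec R q => H x u : bvec R d).
Proof.
apply: measurable_bvec => i.
exact: (@measurable_H_coord R d q H mH _ _ (fun=> x) id).
Qed.

Let menorm : measurable_fun [set: bvec R d] (fun x : bvec R d => enorm (x : 'rV_d) : R).
Proof. by apply: measurable_enorm => i; exact: measurable_coord. Qed.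

Let mHenorm x : measurable_fun [set: bvec R q] (fun u : bvec R q => enorm (H x u) : R).
Proof. exact: (measurableT_comp menorm (measurable_H x)). Qed.

Lemma HC1_mean_le : HC1 P H Un thstarn -> exists2 Ch : R, 0 < Ch &
  forall m (Z : {RV P >-> bvec R q}) x, (0 < m)%N -> same_law P Z (Un m) ->
    mean_le P (fun w => enorm (H x (Z w)) ^+ 2) (Ch * (1 + enorm (x - thstarn m) ^+ 2)).
Proof.
move=> [Ch Ch0 HCh]; exists Ch => // m Z x m0 ZU.
apply: (mean_le_same_law (F := fun u : bvec R q => enorm (H x u) ^+ 2) ZU).
- exact: measurable_funX.
- by move=> u; exact: sqr_ge0.
- exact: HCh.
Qed.

Lemma mean_field_law m (Z : {RV P >-> bvec R q}) x i :
  HC1 P H Un thstarn -> (0 < m)%N -> same_law P Z (Un m) ->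
  mean_field P H (Un m) x 0 i = fine (\int[P]_w (H x (Z w) 0 i)%:E)%E.
Proof.
move=> hHC1 m0 ZU; have [Ch Ch0 HC] := HC1_mean_le hHC1.
have intH (Y : {RV P >-> bvec R q}) : same_law P Y (Un m) ->
    P.-integrable setT (fun w => (H x (Y w) 0 i)%:E).
  move=> YU; apply: (coord_integrable _ (HC m Y x m0 YU)) => j.
  exact: (measurableT_comp (measurable_coord j) (measurableT_comp (measurable_H x) _)).
rewrite /mean_field mxE unlock; congr fine; apply/esym.
apply: (same_law_integral_signed (F := fun u : bvec R q => H x u 0 i : R)) => //.
- exact: (measurableT_comp (measurable_coord i) (measurable_H x)).
- exact: intH.
- exact: (intH (Un m) (fun _ _ => erefl)).
Qed.

Lemma HRG_mean_le : HRG P H Un -> exists a Cg : R, [/\ 0 < a <= 1, 0 <= Cg &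
  forall m (Z : {RV P >-> bvec R q}) x y, (0 < m)%N -> same_law P Z (Un m) ->
    mean_le P (fun w => enorm (H x (Z w) - H y (Z w)) ^+ 2) (Cg * enorm (x - y) `^ (2 * a))].
Proof.
move=> [a /andP[a0 a1] supG]; have [Cg Cg0 HCg] := ereal_bound supG.
exists a, Cg; split => //; first by rewrite a0 a1.
move=> m Z x y m0 ZU.
have [<-|xy] := pselect (x = y).
  rewrite subrr enorm0 powR0 ?mulf_neq0 ?gt_eqF// mulr0.
  rewrite (_ : (fun w => _) = (fun=> 0)); first exact: mean_le_cst.
  by apply/funext => w; rewrite subrr enorm0 expr0n.
have exy : 0 < enorm (x - y) `^ (2 * a).
  rewrite powR_gt0// lt_neqAle enorm_ge0 andbT eq_sym; apply/eqP => /enorm_eq0/eqP.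
  by rewrite subr_eq0 => /eqP.
apply: (mean_le_same_law (F := fun u : bvec R q => enorm (H x u - H y u) ^+ 2) ZU).
- apply: measurable_funX; apply: measurable_enorm => i; under eq_fun do rewrite !mxE.
  by apply: measurable_funB; exact: (measurableT_comp (measurable_coord i) (measurable_H _)).
- by move=> u; exact: sqr_ge0.
have h := le_trans (ereal_sup_ubound _) HCg.
have {h} := h _ (ex_intro _ m (ex_intro _ x (ex_intro _ y (And3 m0 xy erefl)))).
by rewrite lee_pdivrMr// -EFinM.
Qed.

Lemma HUI_mean_le x : HUI P H Un -> exists delta B : R, [/\ 0 < delta, 0 <= B &
  forall m (Z : {RV P >-> bvec R q}), (0 < m)%N -> same_law P Z (Un m) ->
    mean_le P (fun w => enorm (H x (Z w)) `^ (2 + delta)) B].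
Proof.
move=> [delta delta0 /(_ x) supU]; have [B B0 HB] := ereal_bound supU.
exists delta, B; split => // m Z m0 ZU.
apply: (mean_le_same_law (F := fun u : bvec R q => enorm (H x u) `^ (2 + delta)) ZU).
- exact: (measurableT_comp (measurable_powR _) (mHenorm x)).
- by move=> u; exact: powR_ge0.
have h := le_trans (ereal_sup_ubound _) HB.
exact: (h _ (ex_intro2 _ _ m m0 erefl)).
Qed.

Section multilevel.
Context {L : nat}.
Variables (wgt : 'I_L -> R) (U : {RV P >-> bvec R q}).
Variables (Urn : 'I_L -> nat -> {RV P >-> bvec R q}) (Ur : 'I_L -> {RV P >-> bvec R q}).
Variable (thstar : 'rV[R]_d).
Hypothesis Urn_law : forall (r : 'I_L) n, (0 < n)%N -> same_law P (Urn r n) (Un (r.+1 * n)%N).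
Hypothesis Ur_law : forall r : 'I_L, same_law P (Ur r) U.
Hypothesis Urn_cvg : forall r : 'I_L, cvg_in_proba P (Urn r) (Ur r).
Hypothesis hHC2 : HC2 P H U.
Hypothesis hHUI : HUI P H Un.
Hypothesis hHC1 : HC1 P H Un thstarn.
Hypothesis hHRG : HRG P H Un.
Hypothesis root_cvg : enorm (thstarn n - thstar) @[n --> \oo] --> 0.
Variable e : R.
Hypothesis e0 : 0 < e.
Hypothesis limit_noise : mean_le P (fun w => enorm (\sum_r wgt r *: H thstar (Ur r w)) ^+ 2) e.

Let rn_gt0 (r : 'I_L) n : (0 < n)%N -> (0 < r.+1 * n)%N.
Proof. by rewrite muln_gt0. Qed.

Let W := \sum_r `|wgt r|.

Let sumL (x : R) : \sum_(r < L) x = L%:R * x.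
Proof. by rewrite sumr_const card_ord mulr_natl. Qed.

Let mHc (Z : {RV P >-> bvec R q}) x i : measurable_fun setT (fun w => H x (Z w) 0 i).
Proof. exact: (measurableT_comp (measurable_coord i) (measurableT_comp (measurable_H x) _)). Qed.

(** That H thstar is almost surely continuous at the limit only concerns its law,
    so it passes from U to every Ur r. *)
Lemma noise_at_root_eventually : exists N, forall n, (N <= n)%N ->
  mean_le P (fun w => enorm (\sum_r wgt r *: H thstar (Urn r n w)) ^+ 2) (2 * e).
Proof.
have [delta [B [delta0 B0 HU]]] := HUI_mean_le thstar hHUI.
have Ur_cont r : P [set w | ~ {for Ur r w, continuous (H thstar)}] = 0%E.
  have mD := measurable_discontinuity (H thstar).
  rewrite -(hHC2 thstar); exact: (Ur_law r mD).
apply: (second_moment_limsup (Zoo := fun r w => H thstar (Ur r w)) _ _ delta0 B0 _ e0 limit_noise).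
- by move=> r n i; exact: mHc.
- move=> r ep et ep0 et0.
  exact: (continuous_mapping (measurable_H thstar) (Ur_cont r) (@Urn_cvg r) ep0 et0).
- by move=> r n n0; apply: (HU (r.+1 * n)%N); [exact: rn_gt0|exact: Urn_law].
Qed.

Lemma cvg_bounded : exists2 T : R, 0 <= T & forall m, enorm (thstarn m - thstar) <= T.
Proof.
have /cvg_seq_bounded[B [Breal HB]] : cvgn (fun m => enorm (thstarn m - thstar)).
  by apply/cvg_ex; exists 0.
exists (`|B| + 1) => [|p]; first by rewrite addr_ge0.
apply: le_trans (ler_norm _) _; apply: HB => //.
by rewrite (le_lt_trans (ler_norm _))// ltrDl.
Qed.

(** Covers the values of n before the asymptotic regime. *)
Lemma noise_at_root_bounded : exists2 BB : R, 0 <= BB & forall n, (0 < n)%N ->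
  mean_le P (fun w => enorm (\sum_r wgt r *: H thstar (Urn r n w)) ^+ 2) BB.
Proof.
have [Ch Ch0 HC] := HC1_mean_le hHC1.
have [T T0 rootT] := cvg_bounded.
exists (W ^+ 2 * (L%:R * (Ch * (1 + T ^+ 2)))) => [|n n0].
  by rewrite mulr_ge0 ?sqr_ge0// mulr_ge0// mulr_ge0 ?(ltW Ch0)// addr_ge0// sqr_ge0.
have M1 : mean_le P (fun w => W ^+ 2 * \sum_r enorm (H thstar (Urn r n w)) ^+ 2)
    (W ^+ 2 * (L%:R * (Ch * (1 + T ^+ 2)))).
  apply: mean_leZ; first exact: sqr_ge0.
  rewrite -sumL; apply: mean_le_sum => r.
  apply: mean_le_trans (HC _ (Urn r n) thstar (rn_gt0 r n0) (Urn_law r n0)).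
  rewrite ler_wpM2l ?(ltW Ch0)// lerD2l ler_sqr ?nnegrE ?enorm_ge0//.
  by rewrite enorm_dist rootT.
apply: mean_le_mono M1.
- by apply: measurable_funX; apply: measurable_weighted_enorm => r i; exact: mHc.
- by move=> w; rewrite sqr_ge0.
- by move=> w; exact: weighted_enorm_sqr_le.
Qed.

(** Twice the eventual bound 2 e at thstar, and e / 2 for the constant left by the
    Holder modulus, fit in 5 e. The excess collects the distances of the zeros to
    thstar and the values of n before the asymptotic regime. *)
Lemma noise_bound_asymptotic : exists (C3 : R) (excess : nat -> R),
  [/\ 0 <= C3, forall n, 0 <= excess n, excess n @[n --> \oo] --> 0 &
   forall n, (0 < n)%N -> forall x : 'I_L -> 'rV[R]_d,
    mean_le P (fun w => enorm (\sum_r wgt r *: H (x r) (Urn r n w)) ^+ 2)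
    (5 * e + excess n + C3 * \sum_r enorm (x r - thstarn (r.+1 * n)%N) ^+ 2)].
Proof.
have [a [Cg [/andP[a0 a1] Cg0 HG]]] := HRG_mean_le hHRG.
have [N HN] := noise_at_root_eventually.
have [BB BB0 HBB] := noise_at_root_bounded.
have W20 : 0 <= W ^+ 2 by exact: sqr_ge0.
have WCL0 : 0 <= W ^+ 2 * Cg * L%:R by do 2 apply: mulr_ge0 => //.
pose eta := e / (4 * (W ^+ 2 * Cg * L%:R) + 1).
have den0 : 0 < 4 * (W ^+ 2 * Cg * L%:R) + 1 by rewrite ltr_wpDl// mulr_ge0.
have eta0 : 0 < eta by rewrite divr_gt0.
have etaE : 2 * (W ^+ 2 * (Cg * (L%:R * eta))) <= e / 2.
  have -> : 2 * (W ^+ 2 * (Cg * (L%:R * eta))) = e / 2 *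
      (4 * (W ^+ 2 * Cg * L%:R) / (4 * (W ^+ 2 * Cg * L%:R) + 1)).
    by rewrite /eta; field; rewrite gt_eqF.
  by rewrite ler_piMr ?divr_ge0 ?(ltW e0)// ler_pdivrMr// mul1r lerDl.
have [Ke Ke0 HKe] : exists2 K : R, 0 <= K & forall t, 0 <= t -> t `^ (2 * a) <= eta + K * t ^+ 2.
  by apply: powR_le_sqr => //; rewrite mulr_gt0//= -[leRHS]mulr1 ler_wpM2l.
pose C3 := 4 * W ^+ 2 * Cg * Ke.
have C30 : 0 <= C3 by rewrite mulr_ge0// mulr_ge0// mulr_ge0// sqr_ge0.
pose rho n := C3 * \sum_(r < L) enorm (thstarn (r.+1 * n)%N - thstar) ^+ 2.
have rho0 n : 0 <= rho n by rewrite mulr_ge0// sumr_ge0// => r _; rewrite sqr_ge0.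
have rho_cvg : rho n @[n --> \oo] --> 0.
  have c1 : (\sum_(r < L) enorm (thstarn (r.+1 * n)%N - thstar) ^+ 2) @[n --> \oo] -->
      \sum_(r < L) (0 : R).
    apply: cvg_sumr => r.
    have c2 := cvg_dilation (ltn0Sn r) root_cvg.
    have c3 := cvgM c2 c2; rewrite mulr0 in c3.
    rewrite (_ : (fun n => _) = (fun n => enorm (thstarn (r.+1 * n)%N - thstar)) \*
      (fun n => enorm (thstarn (r.+1 * n)%N - thstar))).
      exact: c3.
    by apply/funext => n.
  have c4 : rho n @[n --> \oo] --> C3 * \sum_(r < L) (0 : R).
    by apply: cvgMl_tmp; exact: c1.
  by rewrite big1// mulr0 in c4.
pose bad n : R := if (N <= n)%N then 0 else 2 * BB.
have bad0 n : 0 <= bad n by rewrite /bad; case: ifP => // _; rewrite mulr_ge0.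
have bad_cvg : bad n @[n --> \oo] --> 0.
  by apply: cvg_near_cst; exists N => // n Nn; rewrite /bad ifT.
exists C3, (fun n => rho n + bad n); split => //.
- by move=> n; rewrite addr_ge0.
- by have := cvgD rho_cvg bad_cvg; rewrite addr0; exact.
move=> n n0 x.
have HGn r y z : mean_le P (fun w => enorm (H y (Urn r n w) - H z (Urn r n w)) ^+ 2)
   (Cg * enorm (y - z) `^ (2 * a)) by exact: HG (rn_gt0 r n0) (Urn_law r n0).
have HE1 : mean_le P (fun w => enorm (\sum_r wgt r *: H thstar (Urn r n w)) ^+ 2)
   (2 * e + bad n / 2).
  rewrite /bad; case: ifPn => [/HN|_]; first by rewrite mul0r addr0.
  apply: mean_le_trans (HBB n n0).
  have -> : 2 * BB / 2 = BB by field.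
  by rewrite lerDr mulr_ge0// ltW.
have := @noise_second_moment R disp Omega P d q L H wgt (fun r => Urn r n) thstar
  (fun r => thstarn (r.+1 * n)%N) mH a Cg (2 * e + bad n / 2) eta Ke Cg0 Ke0 HGn HE1 HKe x.
apply: mean_le_trans; rewrite -/W -/C3 lerD2r -/(rho n).
by move: (rho n) (bad n) etaE e0 => r b h1 h2; lra.
Qed.

Lemma initial_error_bound (theta0 : nat -> {RV P >-> bvec R d}) :
  (ereal_sup [set 'E_P[fun w => (enorm (theta0 n w) ^+ 2)%R] |
              n in [set n | (0 < n)%N]] < +oo)%E ->
  exists2 a0 : R, 0 <= a0 & forall m, (0 < m)%N ->
    mean_le P (fun w => enorm ((theta0 m w : 'rV[R]_d) - thstarn m) ^+ 2) a0.
Proof.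
move=> theta0_sup; have [B0 B00 HB0] := ereal_bound theta0_sup.
have [T T0 rootT] := cvg_bounded.
have mth m i : measurable_fun setT (fun w => (theta0 m w : 'rV[R]_d) 0 i).
  exact: (measurableT_comp (measurable_coord i) _).
exists (2 * B0 + 2 * (T + enorm thstar) ^+ 2) => [|m m0].
  by apply: addr_ge0; apply: mulr_ge0 => //; exact: sqr_ge0.
have M0 : mean_le P (fun w => enorm (theta0 m w) ^+ 2) B0.
  split.
  - by apply: measurable_funX; exact: measurable_enorm.
  - by move=> w; rewrite sqr_ge0.
  have h := le_trans (ereal_sup_ubound _) HB0.
  by have {h} := h _ (ex_intro2 _ _ m m0 erefl); rewrite unlock.
have M1 : mean_le P (fun w => 2 * enorm (theta0 m w) ^+ 2 + 2 * (T + enorm thstar) ^+ 2)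
    (2 * B0 + 2 * (T + enorm thstar) ^+ 2).
  apply: mean_leD; first exact: mean_leZ.
  by apply: mean_le_cst; rewrite mulr_ge0 ?sqr_ge0.
apply: mean_le_mono M1.
- apply: measurable_funX; apply: measurable_enorm => i; under eq_fun do rewrite !mxE.
  exact: measurable_funB.
- by move=> w; rewrite sqr_ge0.
move=> w; set x : 'rV[R]_d := theta0 m w.
have h1 : enorm (x - thstarn m) <= enorm x + (T + enorm thstar).
  apply: le_trans (enormB _ _) _; rewrite lerD2l.
  have -> : thstarn m = (thstarn m - thstar) + thstar by rewrite subrK.
  by apply: le_trans (enormD _ _) _; rewrite lerD2r.
have h2 : enorm (x - thstarn m) ^+ 2 <= (enorm x + (T + enorm thstar)) ^+ 2.
  by rewrite ler_sqr ?nnegrE ?enorm_ge0// !addr_ge0 ?enorm_ge0.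
apply: le_trans h2 _.
by have := sqr_ge0 (enorm x - (T + enorm thstar)); nra.
Qed.

End multilevel.
End moments.

(** * The bound on the statistical error *)

Theorem proposition2p3 (R : realType) (gamma : R -> R) (lambda : R)
    (lambda_gt0 : 0 < lambda)
    (gamma_steps : admissible_steps gamma) (gamma_HS : HS gamma lambda) :
  exists2 C : R, 0 < C &
  forall (L : nat) (alpha : R) (d q : nat) (disp : measure_display)
    (Omega : measurableType disp) (P : probability Omega R)
    (H : 'rV[R]_d -> 'rV[R]_q -> 'rV[R]_d)
    (U : {RV P >-> bvec R q}) (Un : nat -> {RV P >-> bvec R q})
    (Urn : 'I_L -> nat -> {RV P >-> bvec R q})
    (Ur : 'I_L -> {RV P >-> bvec R q})
    (theta0 : nat -> {RV P >-> bvec R d}) (theta0_lim : {RV P >-> bvec R d})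
    (V : nat -> nat -> 'I_L -> nat -> {RV P >-> bvec R q})
    (thstar : 'rV[R]_d) (thstarn : nat -> 'rV[R]_d),
  let h := mean_field P H U in
  let hn := fun n => mean_field P H (Un n) in
  let Elim :=
    ('E_P[fun w => (enorm (\sum_(r < L)
       H thstar (Ur r w) *m weight_mx d alpha L r.+1) ^+ 2)%R])%E in
  (0 < L)%N -> 0 < alpha ->
  measurable_fun [set: bvec R d * bvec R q]
    (fun z : bvec R d * bvec R q => H z.1 z.2 : bvec R d) ->
  h thstar = 0 ->
  (forall n, (0 < n)%N -> hn n (thstarn n) = 0) ->
  (forall (r : 'I_L) (n : nat), (0 < n)%N ->
     same_law P (Urn r n) (Un (r.+1 * n)%N)) ->
  (forall r : 'I_L, same_law P (Ur r) U) ->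
  (forall r : 'I_L, cvg_in_proba P (Urn r) (Ur r)) ->
  cvg_in_proba P theta0 theta0_lim ->
  (ereal_sup [set 'E_P[fun w => (enorm (theta0 n w) ^+ 2)%R] |
              n in [set n | (0 < n)%N]] < +oo)%E ->
  (forall n M p, (0 < n)%N -> (0 < p <= M)%N ->
     same_law P (joint (fun r => V n M r p)) (joint (fun r => Urn r n))) ->
  (forall n M, (0 < n)%N ->
     mutual_indep P [set p | (0 < p <= M)%N]
       (fun p => joint (fun r => V n M r p))) ->
  (forall n M, (0 < n)%N ->
     indep P (joint (fun r : 'I_L => theta0 (r.+1 * n)%N))
       (joint (fun p : 'I_M => joint (fun r => V n M r p.+1)))) ->
  HR alpha L h hn thstar ->
  HUI P H Un -> HC1 P H Un thstarn -> HC2 P H U -> HRG P H Un ->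
  HUA hn lambda ->
  (0 < Elim)%E ->
  exists phi1 phi2 : nat -> R,
    [/\ (forall n, 0 < phi1 n) /\ (forall M, 0 < phi2 M),
        phi1 n @[n --> \oo] --> 0,
        phi2 M @[M --> \oo] --> 0,
        nonincreasing_seq phi2 &
        forall n M, (0 < n)%N -> (0 < M)%N ->
          ('E_P[fun w => enorm (stat_error H gamma alpha thstarn
                  (fun m => theta0 m w) (fun r p => V n M r p w) n M)]
           <= C%:E * Elim `^ (2^-1)%R
              * (Num.sqrt (gamma M%:R) * (1 + phi1 n + phi2 M))%R%:E)%E].
Proof.
have [c [C0 [c0 cl C01 slow_s]]] := HS_slow lambda_gt0 gamma_HS.
have [gam0 gam_dec gam_cvg _] := gamma_HS.
pose g (p : nat) : R := gamma p%:R.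
have g0 p : 0 < g p by apply: gam0.
have gdec i j : (i <= j)%N -> g j <= g i by move=> ij; rewrite gam_dec// ler_nat.
have gcvg : g p @[p --> \oo] --> 0 by exact: (cvg_comp _ _ cvgr_idn gam_cvg).
have gsum := elapsed_cvgy gamma_steps.
pose s p : R := Num.sqrt (g p).
have s0 p : 0 < s p by rewrite sqrtr_gt0.
have s_le p : s p <= s 0%N by rewrite ler_sqrt ?gdec// ltW.
set U2 := (1 + (2 * lambda - 2 * c) * g 0%N) / (2 * lambda - 2 * c).
have U20 : 0 <= U2.
  have h : 0 < 2 * lambda - 2 * c by lra.
  by rewrite divr_ge0 ?(ltW h)// addr_ge0// mulr_ge0 ?(ltW h) ?(ltW (g0 _)).
have C0U2 : 0 <= C0 ^+ 2 * U2 by rewrite mulr_ge0 ?sqr_ge0.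
(* c, C0 and U2 are determined by the steps and lambda *)
exists (1 + 5 * (C0 ^+ 2 * U2)); first by rewrite ltr_pwDl// mulr_ge0.
move=> L alpha d q disp Omega P H U Un Urn Ur theta0 theta0_lim V thstar thstarn.
move=> h hn Elim L0 alpha0 mH h0 hn0 Urn_law Ur_law Urn_cvg _ theta0_sup V_law V_indep
  V0_indep hHR hHUI hHC1 hHC2 hHRG hHUA Elim0.
pose wgt (r : 'I_L) : R := weight alpha L r.+1.
have ElimE : Elim = (\int[P]_w (enorm (\sum_r wgt r *: H thstar (Ur r w)) ^+ 2)%:E)%E.
  rewrite /Elim unlock; apply: eq_integral => w _; congr ((enorm _ ^+ 2)%:E).
  by apply: eq_bigr => r _; rewrite /weight_mx mul_mx_scalar.
have [phi0 [phi00 phi0cvg phi0dec _]] := nonincreasing_majorant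
  (fun=> lexx (0 : R)) (@cvg_cst _ _ _ _ _).
have [E E0 EE] : exists2 E : \bar R, (0 < E)%E & E = Elim by exists Elim.
case: E E0 EE => [e | | //] e0 EE; last first.
  (* with an infinite noise level the right-hand side is infinite *)
  exists phi0, phi0; split => // n M n0 M0.
  rewrite -EE poweRyr ?invr_eq0//.
  have b0 : 0 < Num.sqrt (gamma M%:R) * (1 + phi0 n + phi0 M).
    rewrite mulr_gt0// ?sqrtr_gt0 ?g0//.
    by rewrite ltr_pwDr// addr_ge0// ltW.
  have C_gt0 : (0 < (1 + 5 * (C0 ^+ 2 * U2))%:E)%E by rewrite lte_fin ltr_pwDl// mulr_ge0.
  by rewrite (gt0_muley C_gt0) gt0_mulye ?lte_fin// leey.
rewrite lte_fin in e0.
have [lp [K [llp K0 [df mono monoA root_cvg [eps [eps0 eps_cvg lin]]]]]] :=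
  field_regularity lambda_gt0 L0 alpha0 hHR hHUA h0 hn0.
have lp0 : 0 < lp by apply: lt_trans llp.
set A := 'J h thstar in monoA lin.
have Urn_Un r n : (0 < n)%N -> same_law P (Urn r n) (Un (r.+1 * n)%N) by exact: Urn_law.
have rn_gt0 (r : 'I_L) n : (0 < n)%N -> (0 < r.+1 * n)%N by rewrite muln_gt0.
have [Ch Ch0 HC] := HC1_mean_le mH hHC1.
have mHthstar (Z : {RV P >-> bvec R q}) i : measurable_fun setT (fun w => H thstar (Z w) 0 i).
  exact: (measurableT_comp (measurable_coord i) (measurableT_comp (measurable_H mH thstar) _)).
have Elim_le : mean_le P (fun w => enorm (\sum_r wgt r *: H thstar (Ur r w)) ^+ 2) e.
  split.
  - by apply: measurable_funX; exact: measurable_weighted_enorm.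
  - by move=> w; rewrite sqr_ge0.
  - by rewrite -ElimE -EE.
have [C3 [excess [C30 excess0 excess_cvg noise_bound]]] := noise_bound_asymptotic mH
  Urn_law Ur_law Urn_cvg hHC2 hHUI hHC1 hHRG root_cvg e0 Elim_le.
have [a0 a00 init] := initial_error_bound root_cvg theta0_sup.
pose W := \sum_r `|wgt r|.
have W0 : 0 <= W by exact: sumr_ge0.
pose Bn n := 5 * e + excess n.
have Bn0 n : 0 <= Bn n by rewrite !addr_ge0// mulr_ge0// ltW.
pose epsn n := \sum_(r < L) eps (r.+1 * n)%N.
have epsn0 n : 0 <= epsn n by apply: sumr_ge0.
have epsn_cvg : epsn n @[n --> \oo] --> 0.
  have z : \sum_(r < L) (0 : R) = 0 by rewrite big1.
  rewrite -[X in _ --> X]z; apply: cvg_sumr => r.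
  exact: (cvg_dilation (ltn0Sn r) eps_cvg).
have gap0 : 0 < 2 * (lp - lambda) by rewrite mulr_gt0// subr_gt0.
have [p1 Hp1] := step_small g0 gcvg Ch gap0.
have [p0 Hp0] := step_small g0 gcvg (mxsum A ^+ 2) gap0.
have step_p1 p : (p1 <= p)%N ->
    1 - 2 * lp * g p.+1 + Ch * g p.+1 ^+ 2 <= expR (- (2 * lambda) * g p.+1).
  by move=> /Hp1 h1; apply: quadratic_le_exp => //; exact: ltW.
have contraction p y : (p0 <= p)%N ->
    enorm (y - g p.+1 *: (y *m A)) ^+ 2 <= expR (- (2 * lambda) * g p.+1) * enorm y ^+ 2.
  move=> /Hp0 h1; apply: le_trans (euler_step_sqr (ltW (g0 _)) (monoA y)) _.
  by rewrite ler_wpM2r ?sqr_ge0// quadratic_le_exp// ltW.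
have [C2 C20 HC2] := second_moment_seq_le g0 gdec gsum cl C01 slow_s p1 (ltW Ch0) a00.
have CL0 : 0 <= C3 * L%:R by rewrite mulr_ge0.
have [psi1 [psi10 psi1cvg Hpsi1]] :=
  martingale_seq_le g0 gdec gcvg gsum cl C01 slow_s p0 CL0 C20.
have Ares0 : 0 <= W * ((1 + C2) * s 0%N).
  by rewrite mulr_ge0// mulr_ge0 ?(ltW (s0 _))// addr_ge0.
have [C6 [psi2 [C60 psi20 psi2cvg Hpsi2]]] :=
  residual_seq_le g0 gdec gcvg gsum c0 cl C01 slow_s p0 K0 W0 C20 Ares0.
pose sigma := Num.sqrt e.
have sigma0 : 0 < sigma by rewrite sqrtr_gt0.
have sigma2 : sigma ^+ 2 = e by rewrite sqr_sqrtr// ltW.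
(* psi and phi1 gather the vanishing terms in M and in n, relative to the
   leading term sigma * s M *)
pose psi M := C0 ^+ 2 * psi1 M / (2 * e) + C0 * psi2 M / sigma.
have C00 : 0 <= C0 by apply: le_trans C01.
have psi0 M : 0 <= psi M.
  rewrite addr_ge0 ?mulr_ge0 ?sqr_ge0 ?invr_ge0 ?(ltW sigma0)//.
  by rewrite mulr_ge0// ltW.
have psi_cvg : psi M @[M --> \oo] --> 0.
  have c1 : C0 ^+ 2 * psi1 M / (2 * e) + C0 * psi2 M / sigma @[M --> \oo] -->
      C0 ^+ 2 * (0 : R) / (2 * e) + C0 * (0 : R) / sigma.
    by apply: cvgD; apply: cvgMr_tmp; apply: cvgMl_tmp.
  by rewrite !mulr0 !mul0r addr0 in c1.
have [phi2 [phi20 phi2cvg phi2dec phi2ge]] := nonincreasing_majorant psi0 psi_cvg.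
pose phi1 n := C0 ^+ 2 * U2 * excess n / (2 * e) + C0 * (C6 * epsn n) / sigma + n.+1%:R^-1.
have phi1_ge n : C0 ^+ 2 * U2 * excess n / (2 * e) + C0 * (C6 * epsn n) / sigma <= phi1 n.
  by rewrite /phi1 lerDl.
have phi1_pos n : 0 <= C0 ^+ 2 * U2 * excess n / (2 * e) + C0 * (C6 * epsn n) / sigma.
  apply: addr_ge0; apply: mulr_ge0.
  - exact: mulr_ge0.
  - by rewrite invr_ge0 mulr_ge0// ltW.
  - by apply: mulr_ge0 => //; apply: mulr_ge0.
  - by rewrite invr_ge0 ltW.
have phi10 n : 0 < phi1 n by rewrite ltr_wpDl// invr_gt0.
have phi1_cvg : phi1 n @[n --> \oo] --> 0.
  have c1 : C0 ^+ 2 * U2 * excess n / (2 * e) + C0 * (C6 * epsn n) / sigma + n.+1%:R^-1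
      @[n --> \oo] --> C0 ^+ 2 * U2 * (0 : R) / (2 * e) + C0 * (C6 * (0 : R)) / sigma + 0.
    apply: cvgD; last exact: cvg_harmonic.
    apply: cvgD; apply: cvgMr_tmp; apply: cvgMl_tmp => //.
    by apply: cvgMl_tmp.
  by rewrite !addr0 !mulr0 !mul0r !addr0 in c1.
exists phi1, phi2; split => // n M n0 M0.
have lin_r (r : 'I_L) x : enorm (hn (r.+1 * n)%N x - (x - thstarn (r.+1 * n)%N) *m A) <=
    epsn n * enorm (x - thstarn (r.+1 * n)%N) + K * enorm (x - thstarn (r.+1 * n)%N) ^+ 2.
  apply: le_trans (lin _ x (rn_gt0 r n n0)) _; rewrite lerD2r ler_wpM2r ?enorm_ge0//.
  by rewrite /epsn (bigD1 r)//= lerDl sumr_ge0.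
(* sigma * s M has the order of the root mean square of the martingale part,
   which makes it the right value of tau *)
have tau0 : 0 < sigma * s M by rewrite mulr_gt0.
have HcontF (r : 'I_L) : continuous (hn (r.+1 * n)%N).
  by move=> x; apply: differentiable_continuous; apply: df; exact: rn_gt0.
have Vlaw p : (0 < p <= M)%N -> same_law P (joint (fun r => V n M r p)) (joint (fun r => Urn r n)).
  by move=> pM; exact: V_law pM.
have MW := @mean_le_weighted_error R disp Omega P d q L H gamma wgt A
  (fun r => hn (r.+1 * n)%N) (fun r => thstarn (r.+1 * n)%N) (fun r => Urn r n)
  (fun r => theta0 (r.+1 * n)%N) (fun r p => V n M r p) M p0 mH HcontF
  (fun r x i => mean_field_law mH x i hHC1 (rn_gt0 r n n0) (Urn_Un r n n0))
  Vlaw (V_indep n M n0) (V0_indep n M n0) Ch lp (ltW Ch0)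
  (fun r x => HC (r.+1 * n)%N (Urn r n) x (rn_gt0 r n n0) (Urn_Un r n n0))
  (fun r x => mono (r.+1 * n)%N x (rn_gt0 r n n0)) (fun p => ltW (g0 p))
  (Bn n) C3 (Bn0 n) C30 (noise_bound n n0) (epsn n) K (epsn0 n) K0 lin_r
  lambda a0 C2 p1 s0 (fun r => init (r.+1 * n)%N (rn_gt0 r n n0)) C20 HC2 step_p1 (ltW lp0)
  (fun p => gdec _ _ (leq0n p.+1)) contraction s_le _ _
  (Hpsi1 (Bn n) M (Bn0 n)) (Hpsi2 (epsn n) M (epsn0 n)) _ tau0.
have [_ _ MWle] := MW.
have -> : ('E_P[fun w => enorm (stat_error H gamma alpha thstarn
      (fun m => theta0 m w) (fun r p => V n M r p w) n M)])%E =
    (\int[P]_w (enorm (weighted_error H gamma wgt (fun r => thstarn (r.+1 * n)%N)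
      (fun r => theta0 (r.+1 * n)%N) (fun r p => V n M r p) M w))%:E)%E.
  rewrite unlock; apply: eq_integral => w _; congr _%:E.
  rewrite -[RHS]enormN /weighted_error /stat_error -sumrN; congr enorm.
  by apply: eq_bigr => r _; rewrite /weight_mx mul_mx_scalar -scalerN opprB.
apply: le_trans MWle _.
rewrite -EE poweR_EFin powR12_sqrt ?(ltW e0)// -!EFinM lee_fin -/sigma.
have gM : gamma M%:R = s M ^+ 2 by rewrite sqr_sqrtr// ltW// gam0.
rewrite -/U2 -/(s M) gM.
have := phi2ge M; have := phi1_ge n; have := phi1_pos n; have := psi0 M.
rewrite /psi; set X1 := C0 ^+ 2 * U2 * _ / _; set X2 := C0 * (C6 * _) / _.
set Y1 := C0 ^+ 2 * psi1 M / _; set Y2 := C0 * psi2 M / _ => Yge Xge Xle Yle.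
have -> : (sigma * s M + C0 ^+ 2 * s M ^+ 2 * (U2 * Bn n + psi1 M) / (sigma * s M)) / 2 +
    C0 * s M * (C6 * epsn n + psi2 M) =
   sigma * s M * (2^-1 + 5 / 2 * (C0 ^+ 2 * U2) + (X1 + X2) + (Y1 + Y2)).
  rewrite /X1 /X2 /Y1 /Y2 /Bn -sigma2; field.
  by rewrite !gt_eqF.
have -> : (1 + 5 * (C0 ^+ 2 * U2)) * sigma * (s M * (1 + phi1 n + phi2 M)) =
    sigma * s M * ((1 + 5 * (C0 ^+ 2 * U2)) * (1 + phi1 n + phi2 M)) by ring.
rewrite ler_wpM2l ?(ltW tau0)//.
have := mulr_ge0 C0U2 (addr_ge0 (ltW (phi10 n)) (ltW (phi20 M))).
move: (phi1 n) (phi2 M) C0U2 X1 X2 Y1 Y2 Yge Xge Xle Yle; set X := C0 ^+ 2 * U2.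
clear; move=> f1 f2 X0 X1 X2 Y1 Y2 *; nra.
Qed.
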